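(* Let $X_1,\dots,X_n$ be independent symmetric real random variables with logarithmically concave tails such that $\mathbf{E}X_i^2=1$ for all $i$, and let $a=(a_1,\dots,a_n)$ be a sequence of real numbers. Then for any real $p\ge3$, $$\bigg|\Big\|\sum_{i=1}^n a_iX_i\Big\|_p-\gamma_p\|a\|_2\bigg|\le p\|a\|_\infty.$$
   Context: For a random variable $X$, $\|X\|_p=(\mathbf{E}|X|^p)^{1/p}$. For the sequence $a$, $\|a\|_2=(\sum_i a_i^2)^{1/2}$ and $\|a\|_\infty=\sup_i|a_i|$. A random variable $X$ has logarithmically concave tails if the function $t\mapsto\ln\mathbf{P}(|X|\ge t)$ is concave from $[0,\infty)$ to $[-\infty,0]$. $\gamma_p=\|\mathcal{N}(0,1)\|_p=(\mathbf{E}|G|^p)^{1/p}$ for a standard Gaussian $G$, so $\gamma_p^p=2^{p/2}\Gamma(\frac{p+1}{2})/\sqrt\pi$. *)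

(* Defs.v *)
From mathcomp Require Import all_boot all_order all_algebra.
From mathcomp Require Import all_classical all_reals all_analysis.
Import Order.TTheory GRing.Theory Num.Theory.
Import numFieldNormedType.Exports.

Set Implicit Arguments.
Unset Strict Implicit.
Unset Printing Implicit Defensive.

Local Open Scope classical_set_scope.
Local Open Scope ring_scope.
Local Open Scope ereal_scope.

Definition independent_RVs d (T : measurableType d) (R : realType)
    (P : probability T R) (n : nat) (X : 'I_n -> {RV P >-> R}) : Prop :=
  forall B : 'I_n -> set R, (forall i, measurable (B i)) ->
    P (\bigcap_(i in [set: 'I_n]) (X i @^-1` B i)) =
    \prod_(i < n) P (X i @^-1` B i).

Definition symmetric_RV d (T : measurableType d) (R : realType)
    (P : probability T R) (X : {RV P >-> R}) : Prop :=
  forall B : set R, measurable B ->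
    P ((fun w => - X w)%R @^-1` B) = P (X @^-1` B).

Definition log_tail d (T : measurableType d) (R : realType)
    (P : probability T R) (X : {RV P >-> R}) (t : R) : \bar R :=
  lne (P [set w | t <= `|X w|]%R).

(* [lne 0 = -oo], so [log_tail X] takes values in [-oo, 0] and the left-hand
   side never meets [+oo]. At [l = 0] and [l = 1] the convention
   [0 * -oo = 0] makes the inequality trivially true. *)
Definition log_concave_tails d (T : measurableType d) (R : realType)
    (P : probability T R) (X : {RV P >-> R}) : Prop :=
  forall s t l : R, (0 <= s)%R -> (0 <= t)%R -> (0 <= l <= 1)%R ->
    l%:E * log_tail X s + (1 - l)%:E * log_tail X t
    <= log_tail X (l * s + (1 - l) * t)%R.

(* A priori extended-real valued, like [Lnorm] itself. *)
Definition gaussian_Lnorm (R : realType) (p : R) : \bar R :=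
  'N[normal_prob (0 : R) 1]_(p%:E)[EFin].

Definition l2norm (R : realType) (n : nat) (a : 'I_n -> R) : R :=
  Num.sqrt (\sum_(i < n) a i ^+ 2)%R.

(* For [n = 0] this is [sup set0 = 0]. *)
Definition linfnorm (R : realType) (n : nat) (a : 'I_n -> R) : R :=
  sup (range (fun i => `|a i|%R)).

(* Main.v *)
(* Upper bound. Let [g_i] be Gaussian, [r_i] exponential and [k > 1]. The variable
   [k sqrt(r_i) |g_i|] has tail [exp (- sqrt 2 t / k)] and second moment
   [k^2 > E X_i^2], so by log-concavity its tail crosses that of [|X_i|] exactly
   once. For [p >= 3] the derivative of [h |-> (|w+h|^p + |w-h|^p) / 2] divided by
   [h] is nondecreasing, hence replacing [X_i] by [k sqrt(r_i) g_i] can only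
   increase the [p]-th moment. Given the [r_i], the new sum is Gaussian with
   variance [V = k^2 sum a_i^2 r_i], and [V^(p/2) <= (p/(2 e lam))^(p/2) exp(lam V)]
   for the optimal [lam] yields
   [E |S|^p <= gamma_p^p k^p (|a|_2^2 + (p/2) |a|_oo^2)^(p/2)]; let [k -> 1].

   Lower bound. The same comparison replaces [X_i] by random signs [eps_i]. Then
   [E |S|^p >= (p-1) sum a_i^2 E |S - a_i eps_i|^(p-2)], while
   [gamma_p^p = (p-1) gamma_(p-2)^(p-2)]; so
   [|S|_p >= gamma_p (|a|_2 - sqrt p |a|_oo)] for [p >= 5] follows from the bound
   for [p - 2], and for [3 <= p < 5] it follows by exchanging the signs one by one
   for Gaussian variables (Lindeberg).

   As [gamma_p <= sqrt p], both errors are at most [p |a|_oo]. *)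
Require Import Defs.
From HB Require Import structures.
From mathcomp Require Import all_boot all_order all_algebra.
From mathcomp Require Import ring lra.
From mathcomp Require Import all_classical all_reals all_analysis.
From mathcomp Require Import measurable_realfun.
Import Order.TTheory GRing.Theory Num.Theory.
Import numFieldNormedType.Exports.
Set Implicit Arguments.
Unset Strict Implicit.
Unset Printing Implicit Defensive.
Local Open Scope classical_set_scope.
Local Open Scope ring_scope.

(** * Powers of absolute values *)

(** The hypothesis [p >= 3] enters as [p - 2 >= 1]: convexity of [|x| ^ (p - 2)] is what makes the
    derivative of the symmetrized power, divided by [h], nondecreasing. The product [sqrt r |g|] is
    chosen because its law is exponential, the extreme case of log-concave tails, and yet it is
    Gaussian once [r] is fixed, so that variances simply add. The factor [k > 1] rules out one case:
    were the tail of [|X_i|] above the exponential one for ever, integrating [2 t] against both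
    tails would give [k ^ 2 <= 1]. In the lower bound, passing from [p] to [p - 2] deletes one sign
    and costs at most [|a|_oo ^ 2] in the squared norm; the gain from [sqrt p] to [sqrt (p - 2)]
    pays for it, because their squares differ by 2. The induction starts on the whole range below 5,
    so that [p - 2] never falls under 3. If [|a|_2 < sqrt p |a|_oo] there is nothing to prove, as
    [gamma_p |a|_2] is then at most [p |a|_oo]. *)

Section AbsPower.
Context {R : realType}.
Implicit Types (a b c e h k l p q r s t u v w x y z : R).

Lemma powRD_gt0 x p q : 0 < x -> x `^ (p + q) = x `^ p * x `^ q.
Proof. by move=> x0; rewrite powRD// (gt_eqF x0) implybT. Qed.

(** For the origin, where the derivative of [powR] at positive points says nothing: the difference
    quotient is at most [|h| ^ q] and vanishes with [h]. *)
Lemma is_derive0_powR_bound (F : R -> R) q : 0 < q -> F 0 = 0 ->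
  (forall h, `|F h| <= `|h| * `|h| `^ q) -> is_derive (0:R) 1 F 0.
Proof.
move=> q0 F0 FB.
have lim : h^-1 *: (F (h *: 1 + 0) - F 0) @[h --> (0:R)^'] --> (0 : R).
  apply/cvgrPdist_le => e e0; near=> h.
  have h0 : h != 0 by near: h; exact: nbhs_dnbhs_neq.
  rewrite F0 subr0 addr0 sub0r normrN /GRing.scale/= mulr1 normrM normfV.
  rewrite ler_pdivrMl ?normr_gt0//; apply: le_trans (FB h) _.
  rewrite ler_pM2l ?normr_gt0//.
  have he : `|h| < e `^ q^-1.
    near: h; apply: dnbhs0_lt; exact: powR_gt0.
  have -> : e = (e `^ q^-1) `^ q.
    by rewrite -powRrM mulVf ?gt_eqF// powRr1// ltW.
  by rewrite ge0_ler_powR ?nnegrE// ?powR_ge0// ltW.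
by split; [apply/cvg_ex; exists 0 | apply/cvg_lim].
Unshelve. all: end_near. Qed.

Lemma is_derive_absr_powR p x : 1 < p ->
  is_derive x 1 (fun y => `|y| `^ p) (p * (x * `|x| `^ (p - 2))).
Proof.
move=> p1; have [x0|x0|<-] := ltgtP 0 x.
- have := is_derive1_powR p x0.
  rewrite (_ : p * x `^ (p - 1) = p * (x * `|x| `^ (p - 2))); last first.
    rewrite gtr0_norm// -{2}(powRr1 (ltW x0)) -powRD_gt0//.
    by congr (_ * (_ `^ _)); ring.
  apply: near_eq_is_derive => //.
  by near=> y; rewrite gtr0_norm//; near: y; exact: lt_nbhsr.
- have nx0 : 0 < - x by lra.
  have := is_derive1_comp (is_derive1_powR p nx0) (is_deriveN (is_derive_id x 1)).
  rewrite (_ : _ * -1 = p * (x * `|x| `^ (p - 2))); last first.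
    rewrite ltr0_norm//.
    rewrite (_ : p - 1 = 1 + (p - 2)); last by ring.
    by rewrite (powRD_gt0 1 (p - 2) nx0) powRr1 ?ltW//; ring.
  apply: near_eq_is_derive => //.
  by near=> y; rewrite ltr0_norm//=; near: y; exact: lt_nbhsl.
- rewrite mul0r mulr0; apply: (@is_derive0_powR_bound _ (p - 1)); first by lra.
    by rewrite normr0 powR0//; apply/eqP; lra.
  move=> h; rewrite ger0_norm ?powR_ge0// mulr_powRB1//; lra.
Unshelve. all: end_near. Qed.

Lemma is_derive_spowR p x : 2 < p ->
  is_derive x 1 (fun y => y * `|y| `^ (p - 2)) ((p - 1) * `|x| `^ (p - 2)).
Proof.
move=> p2; have [x0|x0|<-] := ltgtP 0 x.
- have := is_derive1_powR (p - 1) x0.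
  rewrite (_ : p - 1 - 1 = p - 2); last by ring.
  rewrite -[in X in is_derive _ _ _ X](gtr0_norm x0).
  apply: near_eq_is_derive => //.
  near=> y; have y0 : 0 < y by near: y; exact: lt_nbhsr.
  rewrite gtr0_norm// (_ : p - 1 = 1 + (p - 2)); last by ring.
  by rewrite (powRD_gt0 1 (p - 2) y0) (powRr1 (ltW y0)).
- have nx0 : 0 < - x by lra.
  have := is_deriveN (is_derive1_comp (is_derive1_powR (p - 1) nx0) (is_deriveN (is_derive_id x 1))).
  rewrite (_ : - (_ * -1) = (p - 1) * `|x| `^ (p - 2)); last first.
    rewrite ltr0_norm// (_ : p - 1 - 1 = p - 2); last by ring.
    by ring.
  apply: near_eq_is_derive => //.
  near=> y; have y0 : y < 0 by near: y; exact: lt_nbhsl.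
  rewrite ltr0_norm// /comp/= (_ : p - 1 = 1 + (p - 2)); last by ring.
  have ny0 : 0 < - y by rewrite oppr_gt0.
  by rewrite !fctE (powRD_gt0 1 (p - 2) ny0) powRr1 ?(ltW ny0)//; ring.
- rewrite normr0 powR0 ?mulr0; last by apply/eqP; lra.
  apply: (@is_derive0_powR_bound _ (p - 2)); first by lra.
    by rewrite mul0r.
  by move=> h; rewrite normrM (ger0_norm (powR_ge0 _ _)).
Unshelve. all: end_near. Qed.


Lemma ler_is_derive (f df : R -> R) a b : a <= b ->
  (forall x, is_derive x 1 f (df x)) ->
  (forall x, a < x -> x < b -> 0 <= df x) -> f a <= f b.
Proof.
move=> ab fdf df0.
have cf : {within `[a, b], continuous f}.
  apply: continuous_subspaceT => x; apply: differentiable_continuous.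
  by apply/derivable1_diffP; case: (fdf x).
apply: (@ger0_derive1_le_cc _ f a b) => //; rewrite ?in_itv/= ?lexx ?ab//.
move=> x; rewrite in_itv/= => /andP[ax xb].
by rewrite derive1E; have [_ ->] := fdf x; exact: df0.
Qed.

Lemma bernoulli_powR_ge p x : 1 <= p -> 0 <= x -> 1 + p * (x - 1) <= x `^ p.
Proof.
move=> p1 x0; have [->|pn1] := eqVneq p 1; first by rewrite powRr1//; lra.
have {pn1} {}p1 : 1 < p by rewrite lt_neqAle eq_sym pn1.
have p0 : 0 < p by lra.
have q0 : 0 < p / (p - 1) by rewrite divr_gt0//; lra.
have pq : p^-1 + (p / (p - 1))^-1 = 1 by field; lra.
(* Young's inequality for the product [x * 1]. *)
have := conjugate_powR x0 ler01 p0 q0 pq.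
rewrite powR1 mulr1 div1r => h.
have : p * x <= p * (x `^ p / p + (p / (p - 1))^-1) by rewrite ler_pM2l.
rewrite (_ : p * (_ + _) = x `^ p + (p - 1)); last by field; lra.
lra.
Qed.

(** The previous inequality with exponent [q^-1], at the point [x ^ q]. *)
Lemma bernoulli_powR_le q x : 0 < q <= 1 -> 0 <= x -> x `^ q <= 1 + q * (x - 1).
Proof.
move=> /andP[q0 q1] x0.
have q1' : 1 <= q^-1 by rewrite -[leLHS]invr1 lef_pV2 ?posrE.
have := bernoulli_powR_ge q1' (powR_ge0 x q).
rewrite -powRrM mulfV ?gt_eqF// powRr1// => h.
have : q * (1 + q^-1 * (x `^ q - 1)) <= q * x by rewrite ler_pM2l.
rewrite (_ : q * (_ + _) = q + x `^ q - 1); last by field; lra.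
lra.
Qed.

(** A concave power lies below its tangent at [t]; by homogeneity this is Bernoulli's inequality at
    [x / t]. *)
Lemma powR_le_tangent q x t : 0 < q <= 1 -> 0 <= x -> 0 < t ->
  x `^ q <= t `^ q * (1 + q * (x / t - 1)).
Proof.
move=> q01 x0 t0; rewrite -[in leLHS](divfK (lt0r_neq0 t0) x) mulrC.
rewrite powRM ?divr_ge0 ?(ltW t0)// ler_pM2l ?powR_gt0//.
by apply: bernoulli_powR_le => //; rewrite divr_ge0// ltW.
Qed.

Lemma powR_midpoint_concave q x y : 0 < q <= 1 -> 0 <= x -> 0 <= y ->
  (x `^ q + y `^ q) / 2 <= ((x + y) / 2) `^ q.
Proof.
move=> q01 x0 y0; have q0 : q != 0 by case/andP: q01 => /gt_eqF ->.
have [m0|m0] := eqVneq ((x + y) / 2) 0.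
  have -> : x = 0 by lra.
  have -> : y = 0 by lra.
  by rewrite addr0 mul0r powR0// addr0 mul0r.
have {}m0 : 0 < (x + y) / 2 by rewrite lt_neqAle eq_sym m0; lra.
set m := (x + y) / 2 in m0 *.
have hx := powR_le_tangent q01 x0 m0.
have hy := powR_le_tangent q01 y0 m0.
have -> : m `^ q = (m `^ q * (1 + q * (x / m - 1)) + m `^ q * (1 + q * (y / m - 1))) / 2.
  rewrite -mulrDr -mulrA -[LHS]mulr1; congr (_ * _).
  have : x / m + y / m = 2 by rewrite -mulrDl /m; field; rewrite /m in m0; lra.
  by move: (x / m) (y / m) => X Y e; rewrite (_ : X = 2 - Y); [field|lra].
lra.
Qed.

(** A ratio [u] in [[0, 1]] satisfies [u <= u ^ q]; apply this to [x / (x + y)] and [y / (x + y)],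
    which sum to 1. *)
Lemma powR_subadd q x y : 0 < q <= 1 -> 0 <= x -> 0 <= y ->
  (x + y) `^ q <= x `^ q + y `^ q.
Proof.
move=> /andP[q0 q1] x0 y0; have [s0|s0] := eqVneq (x + y) 0.
  by rewrite s0 powR0 ?gt_eqF// addr_ge0// powR_ge0.
have {}s0 : 0 < x + y by rewrite lt_neqAle eq_sym s0; lra.
have frac z : 0 <= z -> z <= x + y -> (x + y) `^ q * (z / (x + y)) <= z `^ q.
  move=> z0 zs; have zs0 : 0 <= z / (x + y) by rewrite divr_ge0// ltW.
  rewrite -{2}(divfK (lt0r_neq0 s0) z) mulrC powRM// ?(ltW s0)//.
  rewrite ler_wpM2r ?powR_ge0//.
  have [->|z1] := eqVneq (z / (x + y)) 0; first exact: powR_ge0.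
  by apply: ger1_powR => //; rewrite lt_neqAle eq_sym z1 zs0/= ler_pdivrMr// mul1r.
have hx := frac x x0 ltac:(lra); have hy := frac y y0 ltac:(lra).
apply: le_trans (lerD hx hy); rewrite -mulrDr -mulrDl divff ?gt_eqF// mulr1//.
Qed.

(** The mean of [|w + eps h| ^ p] over a random sign [eps]. Its derivative in [h] is [p] times
    [symspow], whose own derivative is [p - 1] times [sympow] of order [p - 2]; all expansions below
    climb this ladder. *)
Definition sympow p w h := (`|w + h| `^ p + `|w - h| `^ p) / 2.
Definition symspow p w h :=
  ((w + h) * `|w + h| `^ (p - 2) - (w - h) * `|w - h| `^ (p - 2)) / 2.

Lemma sympow_ge0 p w h : 0 <= sympow p w h.
Proof. by rewrite /sympow divr_ge0// addr_ge0// powR_ge0. Qed.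

Lemma sympowN p w h : sympow p w (- h) = sympow p w h.
Proof. by rewrite /sympow opprK addrC. Qed.

Lemma sympow_norm p w h : sympow p w `|h| = sympow p w h.
Proof. by case: (ger0P h) => _ //; rewrite sympowN. Qed.

Lemma sympow0 p w : sympow p w 0 = `|w| `^ p.
Proof. by rewrite /sympow addr0 subr0; field. Qed.

Lemma symspow0 p w : symspow p w 0 = 0.
Proof. by rewrite /symspow addr0 subr0 subrr mul0r. Qed.

Lemma is_derive_addr (f : R -> R) df w h :
  is_derive (w + h) 1 f df -> is_derive h 1 (fun t => f (w + t)) df.
Proof.
move=> fdf.
have g : is_derive h 1 (fun t => w + t) (1 : R).
  have := is_deriveD (is_derive_cst w h (1 : R)) (is_derive_id h (1 : R)).
  by rewrite add0r.
by have := is_derive1_comp fdf g; rewrite mulr1.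
Qed.

Lemma is_derive_subr (f : R -> R) df w h :
  is_derive (w - h) 1 f df -> is_derive h 1 (fun t => f (w - t)) (- df).
Proof.
move=> fdf.
have g : is_derive h 1 (fun t => w - t) (- 1 : R).
  have := is_deriveB (is_derive_cst w h (1 : R)) (is_derive_id h (1 : R)).
  by rewrite sub0r.
by have := @is_derive1_comp _ f (fun t => w - t) _ _ _ fdf g; rewrite mulrN1.
Qed.

Lemma is_derive_sympow p w h : 1 < p ->
  is_derive h 1 (sympow p w) (p * symspow p w h).
Proof.
move=> p1.
have h1 := is_derive_addr (is_derive_absr_powR (w + h) p1).
have h2 := is_derive_subr (is_derive_absr_powR (w - h) p1).
have := is_deriveZ 2^-1 (is_deriveD h1 h2).
rewrite (_ : _ *: _ = p * symspow p w h); last first.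
  by rewrite /symspow /GRing.scale/=; ring.
suff -> : 2^-1 \*: ((fun t => `|w + t| `^ p) + (fun t => `|w - t| `^ p)) = sympow p w by [].
by apply/funext => t; rewrite /sympow/= mulrC.
Qed.

Lemma is_derive_symspow p w h : 2 < p ->
  is_derive h 1 (symspow p w) ((p - 1) * sympow (p - 2) w h).
Proof.
move=> p2.
have h1 := is_derive_addr (is_derive_spowR (w + h) p2).
have h2 := is_derive_subr (is_derive_spowR (w - h) p2).
have := is_deriveZ 2^-1 (is_deriveB h1 h2).
rewrite (_ : _ *: _ = (p - 1) * sympow (p - 2) w h); last first.
  by rewrite /sympow /GRing.scale/=; ring.
suff -> : 2^-1 \*: ((fun t => (w + t) * `|w + t| `^ (p - 2))
    - (fun t => (w - t) * `|w - t| `^ (p - 2))) = symspow p w by [].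
by apply/funext => t; rewrite /symspow/= mulrC.
Qed.

Lemma powR_norm_convex p l x y : 1 <= p -> 0 <= l <= 1 ->
  `|l * x + (1 - l) * y| `^ p <= l * `|x| `^ p + (1 - l) * `|y| `^ p.
Proof.
move=> p1 /andP[l0 l1].
have := @convex_powR R p p1 (Itv01 l0 l1) `|x| `|y|.
rewrite !inE/= !in_itv/= !normr_ge0 => /(_ isT isT).
rewrite convRE [X in X `^ _ <= _ -> _]convRE/= => h; apply: le_trans h.
rewrite ge0_ler_powR ?nnegrE//; first by lra.
  by rewrite addr_ge0// mulr_ge0//= subr_ge0.
apply: le_trans (ler_normD _ _) _.
by rewrite !normrM (ger0_norm l0) (@ger0_norm _ (1 - l))//; lra.
Qed.

Lemma sympow_ge p w h : 1 <= p -> `|w| `^ p <= sympow p w h.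
Proof.
move=> p1; have l01 : 0 <= (2^-1 : R) <= 1 by lra.
have := powR_norm_convex (w + h) (w - h) p1 l01.
rewrite (_ : _ * (w + h) + _ = w); last by field.
by move=> H; apply: le_trans H _; rewrite /sympow; lra.
Qed.

Lemma sympow_homo p w h k : 1 <= p -> 0 <= h <= k -> sympow p w h <= sympow p w k.
Proof.
move=> p1 /andP[h0 hk]; have [k0|k0] := eqVneq k 0.
  have h00 : h = 0 by lra.
  by rewrite h00 k0.
have {}k0 : 0 < k by rewrite lt_neqAle eq_sym k0; lra.
(* The weight for which [w + h] and [w - h] are convex combinations of [w + k] and [w - k]. *)
pose l := (k + h) / (2 * k).
have l01 : 0 <= l <= 1.
  rewrite /l; apply/andP; split; first by rewrite divr_ge0//; lra.
  by rewrite ler_pdivrMr; lra.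
have h1 := powR_norm_convex (w + k) (w - k) p1 l01.
have h2 := powR_norm_convex (w - k) (w + k) p1 l01.
rewrite (_ : l * (w + k) + _ = w + h) in h1; last by rewrite /l; field; lra.
rewrite (_ : l * (w - k) + _ = w - h) in h2; last by rewrite /l; field; lra.
rewrite /sympow; lra.
Qed.

(** The ratio [symspow p w h / h] is nondecreasing, written without division so that [h = 0] is
    allowed. The difference [D], taken along the rays [h t] and [k t], vanishes at [t = 0], and its
    derivative has a sign because [sympow] of order [p - 2 >= 1] is monotone. *)
Lemma symspow_slope p w h k : 3 <= p -> 0 <= h <= k ->
  k * symspow p w h <= h * symspow p w k.
Proof.
move=> p3 /andP[h0 hk].
pose D t := h * symspow p w (k * t) - k * symspow p w (h * t).
have dl (c t : R) : is_derive t 1 ( *%R c) c.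
  by apply: is_derive_eq; rewrite /GRing.scale/= mulr1.
have dD (t : R) : is_derive t 1 D (h * (k * ((p - 1) * sympow (p - 2) w (k * t)))
    - k * (h * ((p - 1) * sympow (p - 2) w (h * t)))).
  have p2 : 2 < p by lra.
  have e1 := is_derive1_comp (is_derive_symspow w (k * t) p2) (dl k t).
  have e2 := is_derive1_comp (is_derive_symspow w (h * t) p2) (dl h t).
  have := is_deriveB (is_deriveZ h e1) (is_deriveZ k e2).
  rewrite (_ : _ - _ = h * (k * ((p - 1) * sympow (p - 2) w (k * t)))
    - k * (h * ((p - 1) * sympow (p - 2) w (h * t)))) //.
  by rewrite /GRing.scale/=; ring.
have D0 : D 0 <= D 1.
  apply: (ler_is_derive ler01 dD) => t t0 _.
  rewrite [X in _ - X]mulrCA -mulrBr mulr_ge0// -mulrBr mulr_ge0//; first by lra.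
  rewrite -mulrBr mulr_ge0//; first by lra.
  rewrite subr_ge0 sympow_homo//; first by lra.
  by rewrite mulr_ge0//= ?ler_wpM2r// ltW.
by move: D0; rewrite /D !mulr0 !symspow0 !mulr1 !mulr0 subr0 subr_ge0.
Qed.

(** The derivative of [symspow] is [(p - 1) * sympow (p - 2)], which by convexity is smallest at
    [h = 0]. *)
Lemma symspow_ge p w h : 3 <= p -> 0 <= h ->
  (p - 1) * `|w| `^ (p - 2) * h <= symspow p w h.
Proof.
move=> p3 h0.
pose D t := symspow p w t - (p - 1) * `|w| `^ (p - 2) * t.
have p2 : 2 < p by lra.
have dD (t : R) : is_derive t 1 D
    ((p - 1) * sympow (p - 2) w t - (p - 1) * `|w| `^ (p - 2)).
  have := is_deriveB (is_derive_symspow w t p2)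
    (is_deriveZ ((p - 1) * `|w| `^ (p - 2)) (is_derive_id t (1 : R))).
  by rewrite /GRing.scale/= mulr1.
have : D 0 <= D h.
  apply: (ler_is_derive h0 dD) => t t0 _.
  by rewrite subr_ge0 ler_wpM2l ?sympow_ge//; lra.
by rewrite /D symspow0 mulr0 subrr subr_ge0.
Qed.

Lemma symspowN p w h : symspow p w (- h) = - symspow p w h.
Proof. by rewrite /symspow opprK; ring. Qed.

Lemma mul_symspow_ge p w h : 3 <= p ->
  (p - 1) * `|w| `^ (p - 2) * h ^+ 2 <= h * symspow p w h.
Proof.
move=> p3; have [h0|/ltW h0] := leP 0 h.
  by rewrite expr2 mulrCA ler_wpM2l// symspow_ge.
have nh0 : 0 <= - h by lra.
have := ler_wpM2l nh0 (symspow_ge w p3 nh0).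
rewrite symspowN mulrNN => H; apply: le_trans H.
by rewrite le_eqVlt; apply/orP; left; apply/eqP; ring.
Qed.

(** A majorant [F] with the right value and slope at 0 only has to dominate the second derivative,
    which is a [sympow] of order [r - 2]: two integrations lift a bound from order [r - 2] to order
    [r]. *)
Lemma sympow_taylor_le r w h (F F' F'' : R -> R) : 2 < r -> 0 <= h ->
  (forall t, is_derive t (1 : R) F (F' t)) ->
  (forall t, is_derive t (1 : R) F' (F'' t)) ->
  F 0 = `|w| `^ r -> F' 0 = 0 ->
  (forall t, 0 <= t -> r * ((r - 1) * sympow (r - 2) w t) <= F'' t) ->
  sympow r w h <= F h.
Proof.
move=> r2 h0 dF dF' F0 F'0 F''ge; have r1 : 1 < r by lra.
have d1 t : is_derive t 1 (fun t => F t - sympow r w t) (F' t - r * symspow r w t).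
  exact: is_deriveB (dF t) (is_derive_sympow w t r1).
have d2 t : is_derive t 1 (fun t => F' t - r * symspow r w t)
    (F'' t - r * ((r - 1) * sympow (r - 2) w t)).
  exact: is_deriveB (dF' t) (is_deriveZ r (is_derive_symspow w t r2)).
have G t : 0 <= t -> 0 <= F' t - r * symspow r w t.
  move=> t0; have := ler_is_derive t0 d2.
  rewrite F'0 symspow0 mulr0 subr0; apply => s s0 _.
  by rewrite subr_ge0 F''ge// ltW.
have := ler_is_derive h0 d1.
rewrite F0 sympow0 subrr subr_ge0; apply => s s0 _; exact/G/ltW.
Qed.

Lemma sympow_taylor_ge r w h : 3 <= r ->
  `|w| `^ r + r * (r - 1) / 2 * `|w| `^ (r - 2) * h ^+ 2 <= sympow r w h.
Proof.
move=> r3; wlog h0 : h / 0 <= h => [H|].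
  by have := H `|h| (normr_ge0 h); rewrite sympow_norm real_normK ?num_real.
have r1 : 1 < r by lra.
pose c := r * (r - 1) / 2 * `|w| `^ (r - 2).
have d (t : R) : is_derive t 1 (fun t => sympow r w t - c * t ^+ 2)
    (r * symspow r w t - c * (2 * t)).
  have dsq : is_derive t 1 (fun t : R => t ^+ 2) (2 * t).
    by apply: is_derive_eq; rewrite /GRing.scale/=; ring.
  exact: is_deriveB (is_derive_sympow w t r1) (is_deriveZ c dsq).
have := ler_is_derive h0 d.
rewrite sympow0 expr0n/= mulr0 subr0 lerBrDr; apply => t t0 _.
have := symspow_ge w r3 (ltW t0) => /(ler_wpM2l (_ : 0 <= r)) H.
rewrite subr_ge0; apply: le_trans (H _); last by lra.
by rewrite /c le_eqVlt; apply/orP; left; apply/eqP; field.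
Qed.

(** Start of the ladder: concavity of [u ^ (s / 2)] at the squares, the parallelogram identity, then
    subadditivity. *)
Lemma sympow_le2 s w h : 0 < s <= 2 -> sympow s w h <= `|w| `^ s + `|h| `^ s.
Proof.
move=> /andP[s0 s2].
have q01 : 0 < s / 2 <= 1 by lra.
have e (x : R) : `|x| `^ s = (x ^+ 2) `^ (s / 2).
  rewrite -(real_normK (num_real x)) -powR_mulrn// -powRrM.
  by congr (_ `^ _); field.
rewrite /sympow !e.
apply: le_trans (powR_midpoint_concave q01 _ _) _; rewrite ?sqr_ge0//.
rewrite (_ : (_ + _) / 2 = w ^+ 2 + h ^+ 2); last by field.
by apply: powR_subadd => //; exact: sqr_ge0.
Qed.

(** [sympow_le2] at order [r - 2], integrated twice. *)
Lemma sympow_le4 r w h : 2 < r <= 4 ->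
  sympow r w h <= `|w| `^ r + r * (r - 1) / 2 * `|w| `^ (r - 2) * h ^+ 2 + `|h| `^ r.
Proof.
move=> /andP[r2 r4]; wlog h0 : h / 0 <= h => [H|].
  by have := H `|h| (normr_ge0 h); rewrite sympow_norm normr_id real_normK ?num_real.
pose c := r * (r - 1) / 2 * `|w| `^ (r - 2).
have r1 : 1 < r by lra.
apply: (@sympow_taylor_le r w h (fun t => `|w| `^ r + c * t ^+ 2 + `|t| `^ r)
  (fun t => c * 2 * t + r * (t * `|t| `^ (r - 2)))
  (fun t => c * 2 + r * ((r - 1) * `|t| `^ (r - 2))) r2 h0).
- move=> t; have dp := is_derive_absr_powR t r1.
  by apply: is_derive_eq; rewrite /GRing.scale/=; ring.
- move=> t; have dp := is_derive_spowR t r2.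
  by apply: is_derive_eq; rewrite /GRing.scale/=; ring.
- by rewrite expr0n/= mulr0 addr0 normr0 powR0 ?addr0//; apply/eqP; lra.
- by rewrite mulr0 mul0r mulr0 addr0.
- move=> t t0; have r02 : 0 < r - 2 <= 2 by lra.
  have := sympow_le2 w t r02.
  move=> /(ler_wpM2l (_ : 0 <= r * (r - 1))) H.
  rewrite mulrA; apply: le_trans (H _) _; first by apply: mulr_ge0; lra.
  by rewrite /c le_eqVlt; apply/orP; left; apply/eqP; field.
Qed.

(** [sympow_le4] at order [r - 2], integrated twice; the divisor 24 is the [4!] of Taylor's
    formula. *)
Lemma sympow_le6 r w h : 4 < r <= 6 ->
  sympow r w h <= `|w| `^ r + r * (r - 1) / 2 * `|w| `^ (r - 2) * h ^+ 2
    + r * (r - 1) * (r - 2) * (r - 3) / 24 * `|w| `^ (r - 4) * h ^+ 4 + `|h| `^ r.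
Proof.
move=> /andP[r4 r6].
wlog h0 : h / 0 <= h => [H|].
  have := H `|h| (normr_ge0 h); rewrite sympow_norm normr_id (exprM _ 2 2).
  by rewrite real_normK ?num_real// -exprM.
pose c := r * (r - 1) / 2 * `|w| `^ (r - 2).
pose e := r * (r - 1) * (r - 2) * (r - 3) / 24 * `|w| `^ (r - 4).
have r1 : 1 < r by lra.
have r2 : 2 < r by lra.
apply: (@sympow_taylor_le r w h
  (fun t => `|w| `^ r + c * t ^+ 2 + e * t ^+ 4 + `|t| `^ r)
  (fun t => c * 2 * t + e * 4 * t ^+ 3 + r * (t * `|t| `^ (r - 2)))
  (fun t => c * 2 + e * 12 * t ^+ 2 + r * ((r - 1) * `|t| `^ (r - 2))) r2 h0).
- move=> t; have dp := is_derive_absr_powR t r1.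
  by apply: is_derive_eq; rewrite /GRing.scale/=; ring.
- move=> t; have dp := is_derive_spowR t r2.
  by apply: is_derive_eq; rewrite /GRing.scale/=; ring.
- by rewrite !expr0n/= !mulr0 !addr0 normr0 powR0 ?addr0//; apply/eqP; lra.
- by rewrite expr0n/= !mulr0 mul0r mulr0 !addr0.
- move=> t t0; have r02 : 2 < r - 2 <= 4 by lra.
  have := sympow_le4 w t r02.
  move=> /(ler_wpM2l (_ : 0 <= r * (r - 1))) H.
  rewrite mulrA; apply: le_trans (H _) _; first by apply: mulr_ge0; lra.
  rewrite /c /e (_ : r - 2 - 2 = r - 4); last by ring.
  by rewrite le_eqVlt; apply/orP; left; apply/eqP; field.
Qed.

End AbsPower.

(** * The Gaussian distribution and its moments *)

Ltac mfun := repeat first [ done | assumption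
  | apply: measurable_funD | apply: measurable_funB | apply: measurable_funM ].

(** * Integrals against densities and under affine maps *)

Section IntegralDensity.
Context {R : realType}.
Local Notation mu := (@lebesgue_measure R).
Local Open Scope ereal_scope.

(** Absolute continuity gives a Radon-Nikodym derivative; it equals [g] almost everywhere because
    both have the same integral over every measurable set. *)
Lemma ge0_integral_density (nu : {finite_measure set (measurableTypeR R) -> \bar R})
    (g : R -> R) (f : R -> \bar R) :
  measurable_fun [set: R] g -> (forall x, (0 <= g x)%R) ->
  (forall A, measurable A -> nu A = \int[mu]_(x in A) (g x)%:E) ->
  measurable_fun [set: R] f -> (forall x, 0 <= f x) ->
  \int[nu]_x f x = \int[mu]_x (f x * (g x)%:E).
Proof.
move=> mg g0 nuE mf f0.
have mEg : measurable_fun [set: R] (EFin \o g) by exact/measurable_EFinP.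
have numu : nu `<< mu.
  apply/null_content_dominatesP => A mA A0; rewrite nuE//.
  by apply: null_set_integral => //; exact: measurable_funTS.
rewrite -(Radon_Nikodym_SigmaFinite.change_of_variables numu)//.
apply: ae_eq_integral => //.
- apply: emeasurable_funM => //.
  exact: measurable_int (Radon_Nikodym_SigmaFinite.f_integrable numu).
- exact: emeasurable_funM.
- apply: ae_eqe_mul2l; apply: integral_ae_eq => //.
    exact: Radon_Nikodym_SigmaFinite.f_integrable.
  by move=> E _ mE; rewrite -Radon_Nikodym_SigmaFinite.f_integral// nuE.
Qed.

Lemma ge0_integral_oppr (f : R -> \bar R) :
  measurable_fun [set: R] f -> (forall x, 0 <= f x) ->
  \int[mu]_x f (- x)%R = \int[mu]_x f x.
Proof.
move=> mf f0.
rewrite -(@ge0_integral_pushforward _ _ (measurableTypeR R) (measurableTypeR R) _ -%R _ mu setT f)//.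
by apply: eq_measure_integral => /= A mA _; exact: lebesgue_measureN.
Qed.

(** The image of Lebesgue measure under [x |-> a x + b], scaled by [a], gives every half-open
    interval its length, hence is Lebesgue measure. *)
Lemma ge0_integral_affine (a b : R) (f : R -> \bar R) : (0 < a)%R ->
  measurable_fun [set: R] f -> (forall x, 0 <= f x) ->
  \int[mu]_x f x = a%:E * \int[mu]_x f (a * x + b)%R.
Proof.
move=> a0 mf f0.
pose phi (x : measurableTypeR R) : measurableTypeR R := (a * x + b)%R.
have mphi : measurable_fun [set: measurableTypeR R] phi.
  by apply: measurable_funD => //; exact: measurable_funM.
pose aN : {nonneg R} := NngNum (ltW a0).
have E : forall A, measurable A -> mscale aN (pushforward mu phi) A = mu A.
  move=> m A mA; apply/esym/lebesgue_measure_unique => //= _ [[c d]] _ <-.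
  rewrite /mscale/= /pushforward.
  have -> : phi @^-1` `]c, d] = `]((c - b) / a)%R, ((d - b) / a)%R]%classic.
    apply/seteqP; split => x /=; rewrite !in_itv/= /phi ltr_pdivrMr// ler_pdivlMr//.
      by move=> /andP[? ?]; apply/andP; split; lra.
    by move=> /andP[? ?]; apply/andP; split; lra.
  rewrite !lebesgue_measure_itv/= !lte_fin ltr_pM2r ?invr_gt0// ltrD2r.
  case: ifPn => _; last by rewrite mule0.
  by rewrite -!EFinD -EFinM; congr (_%:E); field; rewrite gt_eqF.
rewrite -(@ge0_integral_pushforward _ _ (measurableTypeR R) (measurableTypeR R) _
  phi mphi mu setT f)//.
rewrite (_ : a%:E = aN%:num%:E)// -ge0_integral_mscale//.
by apply: eq_measure_integral => A mA _; apply/esym; exact: (E mphi A mA).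
Qed.

End IntegralDensity.

(** * Density and stability of the standard Gaussian law *)

Section Normal.
Context {R : realType}.
Local Notation mu := (@lebesgue_measure R).
Local Notation N := (@normal_prob R 0 1).
Local Open Scope ereal_scope.

Definition gauss_density (x : R) : R :=
  ((Num.sqrt (2 * pi))^-1 * expR (- (x ^+ 2 / 2)))%R.

Lemma normal_pdf01E (x : R) : normal_pdf 0 1 x = gauss_density x.
Proof.
rewrite normal_pdfE ?oner_eq0// /normal_peak /normal_fun /gauss_density.
rewrite expr1n mul1r subr0 mulNr; congr (_ * _)%R.
by rewrite mulr_natl.
Qed.

Lemma gauss_density_ge0 (x : R) : (0 <= gauss_density x)%R.
Proof. by rewrite -normal_pdf01E normal_pdf_ge0. Qed.

Lemma continuous_gauss_density : continuous gauss_density.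
Proof.
rewrite (_ : gauss_density = normal_pdf 0 1).
  by apply: continuous_normal_pdf; rewrite oner_eq0.
by apply/funext => x; rewrite normal_pdf01E.
Qed.

Lemma measurable_gauss_density : measurable_fun [set: R] gauss_density.
Proof.
rewrite (_ : gauss_density = normal_pdf 0 1); first exact: measurable_normal_pdf.
by apply/funext => x; rewrite normal_pdf01E.
Qed.

Lemma ge0_integral_normal (f : R -> \bar R) :
  measurable_fun [set: R] f -> (forall x, 0 <= f x) ->
  \int[N]_x f x = \int[mu]_x (f x * (gauss_density x)%:E).
Proof.
move=> mf f0; apply: ge0_integral_density => //.
- exact: measurable_gauss_density.
- exact: gauss_density_ge0.
- move=> A mA; rewrite /= /normal_prob.
  by apply: eq_integral => x _; rewrite normal_pdf01E.
Qed.

Lemma ge0_integral_normalN (f : R -> \bar R) :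
  measurable_fun [set: R] f -> (forall x, 0 <= f x) ->
  \int[N]_x f (- x)%R = \int[N]_x f x.
Proof.
move=> mf f0; rewrite !ge0_integral_normal//; last exact: measurableT_comp.
rewrite -(@ge0_integral_oppr _ (fun x => f x * (gauss_density x)%:E)).
- by apply: eq_integral => x _; rewrite /gauss_density sqrrN.
- apply: emeasurable_funM => //.
  by apply/measurable_EFinP; exact: measurable_gauss_density.
- by move=> x; rewrite mule_ge0// lee_fin gauss_density_ge0.
Qed.

Lemma integral_gauss_density_affine (m s : R) : (0 < s)%R ->
  \int[mu]_x (s^-1 * gauss_density ((x - m) / s))%:E = 1.
Proof.
move=> s0.
have : \int[mu]_x (gauss_density x)%:E = 1.
  rewrite -(integral_normal_pdf (0 : R) 1).
  by apply: eq_integral => x _; rewrite normal_pdf01E.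
have si0 : (0 < s^-1)%R by rewrite invr_gt0.
rewrite (@ge0_integral_affine _ s^-1 (- (m / s))%R _ si0); last 2 first.
- apply/measurable_EFinP; exact: measurable_gauss_density.
- by move=> x; rewrite lee_fin gauss_density_ge0.
rewrite -ge0_integralZl//; last 3 first.
- apply/measurable_EFinP; apply: measurableT_comp; first exact: measurable_gauss_density.
  by apply: measurable_funD => //; exact: measurable_funM.
- by move=> x _; rewrite lee_fin gauss_density_ge0.
- by rewrite lee_fin ltW.
move=> <-; apply: eq_integral => x _; rewrite -EFinM; congr ((_ * gauss_density _)%:E).
by rewrite mulrBl mulrC.
Qed.

(** Two factorizations of the joint density of [y] and [z = a x + b y]: the law of [y] times that of
    [z] given [y], and the law of [z] times that of [y] given [z]. The latter has mean [b z / c ^ 2]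
    and standard deviation [a / c]; completing the square shows that the exponents agree. *)
Lemma gauss_density_convolution (a b y z : R) : (0 < a)%R ->
  let c := Num.sqrt (a ^+ 2 + b ^+ 2) in
  (gauss_density y * (a^-1 * gauss_density ((z - b * y) / a)) =
   (c^-1 * gauss_density (z / c)) *
   ((a / c)^-1 * gauss_density ((y - b * z / c ^+ 2) / (a / c))))%R.
Proof.
move=> a0 c; have c20 : (0 < a ^+ 2 + b ^+ 2)%R by rewrite ltr_pwDl ?sqr_ge0 ?exprn_gt0.
have c0 : (0 < c)%R by rewrite sqrtr_gt0.
have c2 : (c ^+ 2 = a ^+ 2 + b ^+ 2)%R by rewrite sqr_sqrtr// ltW.
rewrite /gauss_density.
set k := (Num.sqrt _)^-1%R.
have eE : (expR (- (y ^+ 2 / 2)) * expR (- (((z - b * y) / a) ^+ 2 / 2)) =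
  expR (- ((z / c) ^+ 2 / 2)) * expR (- (((y - b * z / c ^+ 2) / (a / c)) ^+ 2 / 2)))%R.
  rewrite -!expRD; congr expR; rewrite -!opprD; congr (- _)%R.
  have bE : (b ^+ 2 = c ^+ 2 - a ^+ 2)%R by rewrite c2; ring.
  rewrite !expr_div_n !sqrrB !exprMn !mulrA.
  apply/eqP; rewrite -subr_eq0; apply/eqP.
  rewrite bE; field; rewrite !gt_eqF//.
transitivity (k ^+ 2 * a^-1 * (expR (- (y ^+ 2 / 2)) * expR (- (((z - b * y) / a) ^+ 2 / 2))))%R.
  by ring.
by rewrite eE; field; rewrite !gt_eqF.
Qed.

Lemma normal_stable_gt0 (a b : R) (F : R -> \bar R) : (0 < a)%R ->
  measurable_fun [set: R] F -> (forall x, 0 <= F x) ->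
  \int[N]_y \int[N]_x F (a * x + b * y)%R =
  \int[N]_z F (Num.sqrt (a ^+ 2 + b ^+ 2) * z)%R.
Proof.
move=> a0 mF F0; set c := Num.sqrt _.
have c20 : (0 < a ^+ 2 + b ^+ 2)%R by rewrite ltr_pwDl ?sqr_ge0 ?exprn_gt0.
have c0 : (0 < c)%R by rewrite sqrtr_gt0.
have mgd := @measurable_gauss_density.
have mEgd : measurable_fun [set: R] (EFin \o gauss_density) by exact/measurable_EFinP.
have gd0 := gauss_density_ge0.
have mlin (u v : R) : measurable_fun [set: R] (fun x : R => u * x + v)%R.
  by apply: measurable_funD => //; exact: measurable_funM.
have inner y : \int[N]_x F (a * x + b * y)%R =
    \int[mu]_z (F z * (a^-1 * gauss_density ((z - b * y) / a))%:E).
  have mFa : measurable_fun [set: R] (fun x => F (a * x + b * y)%R).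
    by apply: measurableT_comp => //; exact: mlin.
  rewrite ge0_integral_normal//.
  have ai0 : (0 < a^-1)%R by rewrite invr_gt0.
  rewrite (@ge0_integral_affine _ a^-1 (- (b * y / a))%R _ ai0); last 2 first.
  - exact: emeasurable_funM.
  - by move=> x; rewrite mule_ge0// lee_fin.
  rewrite -ge0_integralZl//; last 3 first.
  - apply: emeasurable_funM; first by apply: measurableT_comp => //; mfun.
    by apply/measurable_EFinP; apply: measurableT_comp => //; mfun.
  - by move=> x _; rewrite mule_ge0// lee_fin.
  - by rewrite lee_fin ltW.
  apply: eq_integral => z _.
  rewrite muleCA -EFinM; congr (F _ * (_ * gauss_density _)%:E).
    by field; rewrite gt_eqF.
  by rewrite mulrBl mulrC.
have mK : measurable_fun [set: R * R] (fun q : R * R =>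
    (a^-1 * gauss_density ((q.2 - b * q.1) / a))%R).
  apply: measurable_funM => //; apply: measurableT_comp => //.
  apply: measurable_funM => //; apply: measurable_funB => //.
  exact: measurable_funM.
under eq_integral do rewrite inner.
have mK2 : measurable_fun [set: R * R] (fun q : R * R =>
    F q.2 * (a^-1 * gauss_density ((q.2 - b * q.1) / a))%:E).
  apply: emeasurable_funM; last exact/measurable_EFinP.
  exact: measurableT_comp.
have K0 q : 0 <= F q.2 * (a^-1 * gauss_density ((q.2 - b * q.1) / a))%:E.
  by rewrite mule_ge0// lee_fin mulr_ge0// invr_ge0 ltW.
rewrite [LHS]ge0_integral_normal; last 2 first.
- exact: (@measurable_fun_fubini_tonelli_F _ _ _ _ _ mu _ mK2 K0).
- by move=> y; apply: integral_ge0 => z _; exact: (K0 (y, z)).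
(* In this form the variable [y] occurs only in a probability density, which integrates to 1 after
   exchanging the integrals. *)
transitivity (\int[mu]_y \int[mu]_z (F z *
   (c^-1 * gauss_density (z / c))%:E *
   ((a / c)^-1 * gauss_density ((y - b * z / c ^+ 2) / (a / c)))%:E)).
  apply: eq_integral => y _.
  rewrite -ge0_integralZr//; last 3 first.
  - exact: (measurableT_comp mK2 (pair1_measurable y)).
  - by move=> z _; exact: (K0 (y, z)).
  - by rewrite lee_fin.
  apply: eq_integral => z _.
  by rewrite -!muleA -!EFinM; congr (_ * _%:E); rewrite mulrC gauss_density_convolution.
rewrite (@fubini_tonelli _ _ _ _ _ mu mu (fun q : R * R => F q.2 *
   (c^-1 * gauss_density (q.2 / c))%:E *
   ((a / c)^-1 * gauss_density ((q.1 - b * q.2 / c ^+ 2) / (a / c)))%:E)); last 2 first.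
- apply: emeasurable_funM.
    apply: emeasurable_funM; first exact: measurableT_comp.
    apply/measurable_EFinP; apply: measurable_funM => //.
    by apply: measurableT_comp => //; exact: measurable_funM.
  apply/measurable_EFinP; apply: measurable_funM => //; apply: measurableT_comp => //.
  apply: measurable_funM => //; apply: measurable_funB => //.
  by apply: measurable_funM => //; exact: measurable_funM.
- move=> q; rewrite !mule_ge0// lee_fin mulr_ge0// ?invr_ge0 ?ltW// ?divr_gt0//.
transitivity (\int[mu]_z (F z * (c^-1 * gauss_density (z / c))%:E)).
  apply: eq_integral => z _; rewrite /=.
  rewrite ge0_integralZl//; last 3 first.
  - apply/measurable_EFinP; apply: measurable_funM => //; apply: measurableT_comp => //.
    by apply: measurable_funM => //; exact: measurable_funB.
  - by move=> y _; rewrite lee_fin mulr_ge0// invr_ge0 ltW// divr_gt0.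
  - by rewrite mule_ge0// lee_fin mulr_ge0// invr_ge0 ltW.
  by rewrite integral_gauss_density_affine ?divr_gt0// mule1.
rewrite (@ge0_integral_affine _ c 0 _ c0); last 2 first.
- apply: emeasurable_funM => //; apply/measurable_EFinP.
  by apply: measurable_funM => //; apply: measurableT_comp => //; exact: measurable_funM.
- by move=> z; rewrite mule_ge0// lee_fin mulr_ge0// invr_ge0 ltW.
have mFc : measurable_fun [set: R] (fun x => F (c * x)%R).
  by apply: measurableT_comp => //; exact: measurable_funM.
rewrite -ge0_integralZl//; last 3 first.
- apply: emeasurable_funM; first by apply: measurableT_comp => //; exact: mlin.
  apply/measurable_EFinP; apply: measurable_funM => //; apply: measurableT_comp => //.
  by apply: measurable_funM => //; exact: mlin.
- by move=> x _; rewrite mule_ge0// lee_fin mulr_ge0// invr_ge0 ltW.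
- by rewrite lee_fin ltW.
rewrite ge0_integral_normal//; apply: eq_integral => z _.
rewrite addr0 muleCA -EFinM mulrA mulfV ?gt_eqF// mul1r.
by congr (_ * (gauss_density _)%:E); field; rewrite gt_eqF.
Qed.

(** The sign of [a] is absorbed by the symmetry of the Gaussian law; for [a = 0] the standard
    deviation is [|b|]. *)
Lemma normal_stable (a b : R) (F : R -> \bar R) :
  measurable_fun [set: R] F -> (forall x, 0 <= F x) ->
  \int[N]_y \int[N]_x F (a * x + b * y)%R =
  \int[N]_z F (Num.sqrt (a ^+ 2 + b ^+ 2) * z)%R.
Proof.
move=> mF F0; have [a0|a0|->] := ltgtP a 0%R.
- have na0 : (0 < - a)%R by rewrite oppr_gt0.
  rewrite -(sqrrN a) -(normal_stable_gt0 b na0 mF F0).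
  apply: eq_integral => y _.
  rewrite -(@ge0_integral_normalN (fun x => F (- a * x + b * y)%R))//.
    by apply: eq_integral => x _; rewrite mulrNN.
  by apply: measurableT_comp => //; mfun.
- exact: normal_stable_gt0.
- rewrite expr0n/= add0r sqrtr_sqr.
  under eq_integral => y _ do under eq_integral do rewrite mul0r add0r.
  transitivity (\int[N]_y F (b * y)%R).
    apply: eq_integral => y _.
    by rewrite integral_cst// [X in _ * X](@probability_setT _ _ _ N) mule1.
  have [b0|b0] := ger0P b; first by [].
  rewrite -(@ge0_integral_normalN (fun x => F (b * x)%R))//; last first.
    by apply: measurableT_comp => //; exact: measurable_funM.
  by apply: eq_integral => y _; rewrite mulrN -mulNr.
Qed.

End Normal.

Section PowerExp.
Context {R : realType}.
Implicit Types (p q u x : R).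

(** The maximum of [u ^ q * exp (- u)] is reached at [u = q]; it follows from [1 + v <= exp v] at
    [v = u / q - 1], raised to the power [q]. *)
Lemma powR_le_expR q u : 0 < q -> 0 <= u ->
  u `^ q <= (q / expR 1) `^ q * expR u.
Proof.
move=> q0 u0.
have -> : expR u = (expR (u / q)) `^ q.
  by rewrite -expRM divfK// gt_eqF.
rewrite -powRM ?expR_ge0 ?divr_ge0 ?(ltW q0)//.
rewrite ge0_ler_powR ?nnegrE ?(ltW q0) ?mulr_ge0 ?invr_ge0 ?expR_ge0 ?(ltW q0)//.
have := expR_ge1Dx (u / q - 1); rewrite addrC subrK expRD expRN => h.
rewrite ler_pdivrMr// in h; apply: le_trans h _.
by rewrite le_eqVlt; apply/orP; left; apply/eqP; ring.
Qed.

Lemma continuous_absr_powR p : 0 <= p -> continuous (fun x : R => `|x| `^ p).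
Proof.
move=> p0 x; have [->|p_neq0] := eqVneq p 0.
  rewrite (_ : (fun _ => _) = cst 1); first exact: cst_continuous.
  by apply/funext => y; rewrite powRr0.
have {p_neq0} {}p0 : 0 < p by rewrite lt_neqAle eq_sym p_neq0.
have [->|x0] := eqVneq x 0.
  rewrite /continuous_at normr0 powR0 ?gt_eqF//.
  apply/cvgrPdist_le => e e0; near=> y.
  rewrite sub0r normrN ger0_norm ?powR_ge0//.
  have -> : e = (e `^ p^-1) `^ p.
    by rewrite -powRrM mulVf ?gt_eqF// powRr1// ltW.
  rewrite ge0_ler_powR ?nnegrE// ?powR_ge0// ?ltW//.
  near: y; exists (e `^ p^-1) => /=; first exact: powR_gt0.
  by move=> z /=; rewrite sub0r normrN.
apply: (@continuous_comp _ _ _ (fun x : R => `|x|) (fun y => y `^ p)).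
  exact: norm_continuous.
apply: differentiable_continuous; apply/derivable1_diffP.
by have [] := @is_derive1_powR R p `|x| ltac:(by rewrite normr_gt0).
Unshelve. all: end_near. Qed.

Lemma measurable_absr_powR p : measurable_fun [set: R] (fun x : R => `|x| `^ p).
Proof. by apply: (measurableT_comp (measurable_powR _)) => //; exact: measurable_normr. Qed.

End PowerExp.

(** * Gaussian moments: recursion, finiteness and bounds *)

Section GaussMoments.
Context {R : realType}.
Local Notation mu := (@lebesgue_measure R).
Local Notation N := (@normal_prob R 0 1).
Local Open Scope ereal_scope.

Lemma integral_normal_cst (c : \bar R) : \int[N]_x c = c.
Proof. by rewrite integral_cst// [X in _ * X](@probability_setT _ _ _ N) mule1. Qed.

Definition gauss_moment (p : R) : \bar R := \int[N]_x (`|x| `^ p)%:E.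

Let half_moment (p : R) := \int[mu]_(x in `[0%R, +oo[) (`|x| `^ p * gauss_density x)%:E.

Lemma gauss_moment_half (p : R) : (0 <= p)%R -> gauss_moment p = 2%:E * half_moment p.
Proof.
move=> p0; rewrite /gauss_moment ge0_integral_normal; last 2 first.
- by apply/measurable_EFinP; exact: measurable_absr_powR.
- by move=> x; rewrite lee_fin powR_ge0.
under eq_integral do rewrite -EFinM.
rewrite ge0_symfun_integralT//.
- congr (_ * _); rewrite /half_moment (_ : [set x | (0 <= x)%R] = `[0%R, +oo[%classic)//.
  by apply/seteqP; split => x /=; rewrite in_itv/= andbT.
- by move=> x; rewrite mulr_ge0 ?powR_ge0 ?gauss_density_ge0.
- move=> x; apply: cvgM; first exact: continuous_absr_powR.
  exact: continuous_gauss_density.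
- by move=> x /=; rewrite normrN /gauss_density sqrrN.
Qed.

Let gd := @gauss_density R.

Lemma is_derive_gauss_density (x : R) : is_derive x 1%R gd (- (x * gd x))%R.
Proof.
pose h (y : R) : R := (- (y ^+ 2 / 2))%R.
have dh : is_derive x 1%R h (- x)%R.
  by apply: is_derive_eq; rewrite /GRing.scale/=; field.
have de := is_derive1_comp (is_derive_expR (h x)) dh.
have := is_deriveZ (Num.sqrt (2 * pi))^-1%R de.
by rewrite (_ : (_ *: _)%R = (- (x * gd x))%R)// /gd /gauss_density /GRing.scale/= /h; ring.
Qed.

(** Makes the boundary term at infinity vanish in the integration by parts below. It is
    [powR_le_expR] at [u = x ^ 2 / 2] with exponent [p / 2]. *)
Lemma gauss_density_decay (p : R) : (1 < p)%R -> exists K : R,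
  (0 <= K)%R /\ forall x : R, (0 < x)%R -> (x `^ (p - 1) * gd x <= K / x)%R.
Proof.
move=> p1; pose K := ((p / 2 / expR 1) `^ (p / 2) * 2 `^ (p / 2) * (Num.sqrt (2 * pi))^-1)%R.
have K0 : (0 <= K)%R by rewrite /K !mulr_ge0 ?powR_ge0 ?invr_ge0 ?sqrtr_ge0.
exists K; split => // x x0.
rewrite ler_pdivlMr//.
have p20 : (0 < p / 2)%R by lra.
have x20 : (0 <= x ^+ 2 / 2)%R by rewrite divr_ge0 ?sqr_ge0.
have := powR_le_expR p20 x20.
have -> : (x `^ (p - 1) * gd x * x = x `^ p * gd x)%R.
  by rewrite -(@mulr_powRB1 _ x p) ?(ltW x0)//; [ring|lra].
have xE : (x `^ p = (x ^+ 2 / 2) `^ (p / 2) * 2 `^ (p / 2))%R.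
  rewrite -powRM// divfK//.
  by rewrite -powR_mulrn ?(ltW x0)// -powRrM; congr (_ `^ _)%R; field.
rewrite xE => h; rewrite /gd /gauss_density expRN.
have -> : (K = (p / 2 / expR 1) `^ (p / 2) * expR (x ^+ 2 / 2) * (2 `^ (p / 2) * ((Num.sqrt (2 * pi))^-1 * (expR (x ^+ 2 / 2))^-1)))%R.
  by rewrite /K; field; rewrite gt_eqF ?expR_gt0//= gt_eqF// sqrtr_gt0 mulr_gt0 ?pi_gt0.
rewrite -mulrA ler_wpM2r// !mulr_ge0 ?powR_ge0 ?invr_ge0 ?sqrtr_ge0 ?expR_ge0//.
Qed.

(** Integration by parts: the derivative of [- x ^ (p - 1) * gd x] is [x ^ p * gd x - (p - 1) * x ^
    (p - 2) * gd x]. The fundamental theorem on a half-line is applied to a nonnegative integrand,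
    so a multiple of [exp (- x)], whose integral is known, is added and finally cancelled. *)
Lemma gauss_half_moment_rec (p : R) : (2 <= p)%R ->
  half_moment p = (p - 1)%:E * half_moment (p - 2).
Proof.
move=> p2.
pose G0 := (Num.sqrt (2 * pi))^-1%R : R.
have G00 : (0 <= G0)%R by rewrite invr_ge0 sqrtr_ge0.
have gdG0 x : (gd x <= G0)%R.
  rewrite /gd /gauss_density ler_piMr// -expR0 ler_expR oppr_le0.
  by rewrite divr_ge0// sqr_ge0.
have gd0 := @gauss_density_ge0 R.
(* Large enough to keep [f] nonnegative: below [p] the negative term is at most
   [(p - 1) * p ^ (p - 2) * G0], and [exp (p - x) >= 1]; from [p] on, [x ^ 2 >= p - 1] suffices. *)
pose C := ((p - 1) * p `^ (p - 2) * G0 * expR p)%R.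
have C0 : (0 <= C)%R by rewrite /C !mulr_ge0 ?powR_ge0 ?expR_ge0//; lra.
pose f (x : R) := (`|x| `^ p * gd x - (p - 1) * (`|x| `^ (p - 2) * gd x) + C * expR (- x))%R.
pose F (x : R) := (- (x * `|x| `^ (p - 2) * gd x) - C * expR (- x))%R.
have cexp : continuous (fun x : R => expR (- x)).
  by move=> x; apply: continuous_comp; [exact: continuousN|exact: continuous_expR].
have cgd : continuous gd by exact: continuous_gauss_density.
have cpow q : (0 <= q)%R -> continuous (fun x : R => `|x| `^ q * gd x)%R.
  by move=> q0 x; apply: cvgM; [exact: continuous_absr_powR|exact: cgd].
have f0 x : (0 <= x)%R -> (0 <= f x)%R.
  move=> x0; rewrite /f ger0_norm//.
  have [xp|xp] := leP p x.
    have : ((p - 1) * x `^ (p - 2) <= x `^ p)%R.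
      have -> : (x `^ p = x `^ 2 * x `^ (p - 2))%R.
        by rewrite -powRD_gt0; [congr (_ `^ _)%R; ring|lra].
      rewrite ler_wpM2r ?powR_ge0// (powR_mulrn 2)// expr2; nra.
    move=> h; rewrite mulrA -mulrBl addr_ge0//; last by rewrite mulr_ge0// expR_ge0.
    by rewrite mulr_ge0// subr_ge0.
  have h1 : ((p - 1) * (x `^ (p - 2) * gd x) <= C * expR (- x))%R.
    rewrite (_ : C * expR (- x) = (p - 1) * (p `^ (p - 2) * (G0 * expR (p - x))))%R; last first.
      by rewrite /C expRD; ring.
    rewrite ler_wpM2l//; first by lra.
    apply: ler_pM; rewrite ?powR_ge0 ?gd0//.
      by apply: ge0_ler_powR; rewrite ?nnegrE; lra.
    apply: le_trans (gdG0 x) _; rewrite ler_peMr//.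
    by rewrite -[leLHS]expR0 ler_expR; lra.
  have h2 : (0 <= x `^ p * gd x)%R by rewrite mulr_ge0 ?powR_ge0.
  lra.
have cf : continuous f.
  move=> x; apply: cvgD; first apply: cvgB.
  - by apply: cpow; lra.
  - apply: cvgM; first exact: cvg_cst.
    by apply: cpow; lra.
  - by apply: cvgM; [exact: cvg_cst|exact: cexp].
have dF (x : R) : (0 < x)%R -> is_derive x 1%R F (f x).
  move=> x0.
  (* Computed afresh at positive [x], since [is_derive_spowR] asks for [p > 2] and the case [p = 2]
     is needed here. *)
  have dxp : is_derive x 1%R (fun y : R => y * `|y| `^ (p - 2))%R ((p - 1) * `|x| `^ (p - 2))%R.
    have := is_derive1_powR (p - 1) x0.
    rewrite (_ : p - 1 - 1 = p - 2)%R; last by ring.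
    rewrite -[in X in is_derive _ _ _ X](gtr0_norm x0).
    apply: near_eq_is_derive; near=> y; have y0 : (0 < y)%R by near: y; exact: lt_nbhsr.
    rewrite gtr0_norm// (_ : p - 1 = 1 + (p - 2))%R; last by ring.
    by rewrite (powRD_gt0 1 (p - 2) y0) (powRr1 (ltW y0)).
  have dg := is_derive_gauss_density x.
  have de : is_derive x 1%R (fun y : R => expR (- y)) (- expR (- x))%R.
    have dn : is_derive x 1%R (fun y : R => - y)%R (-1)%R by exact: is_deriveN (is_derive_id x (1%R : R)).
    by have := is_derive1_comp (is_derive_expR (- x)%R) dn; rewrite mulrN1.
  have D : is_derive x 1%R F (- (x * `|x| `^ (p - 2) * (- (x * gd x)) +
      gd x * ((p - 1) * `|x| `^ (p - 2))) - C * (- expR (- x)))%R.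
    exact: is_deriveB (is_deriveN (is_deriveM dxp dg)) (is_deriveZ C de).
  suff -> : f x = (- (x * `|x| `^ (p - 2) * (- (x * gd x)) +
      gd x * ((p - 1) * `|x| `^ (p - 2))) - C * (- expR (- x)))%R by exact: D.
  rewrite /f gtr0_norm//.
  have -> : (x `^ p = x * (x * x `^ (p - 2)))%R.
    rewrite mulrA -expr2 -(powR_mulrn 2 (ltW x0)) -powRD_gt0//.
    by congr (_ `^ _)%R; ring.
  by ring.
have F_lim : F x @[x --> +oo%R] --> (0%R : R).
  have p1 : (1 < p)%R by lra.
  have [K [K0 hK]] := gauss_density_decay p1.
  rewrite [X in _ --> X](_ : _ = - 0 - C * 0)%R; last by rewrite mulr0 oppr0 addr0.
  apply: cvgB; last first.
    by apply: cvgM; [exact: cvg_cst|exact: cvgr_expR].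
  apply: cvgN; apply: (@squeeze_cvgr _ _ _ _ (cst 0%R) (fun x => K / x)%R); last 2 first.
  - exact: cvg_cst.
  - rewrite -[X in _ --> X](mulr0 K); apply: cvgM; first exact: cvg_cst.
    by apply/gtr0_cvgV0; [near=> x|exact: cvg_id].
  near=> x; have x0 : (0 < x)%R by near: x; exact: nbhs_pinfty_gt.
  rewrite gtr0_norm// !mulr_ge0 ?powR_ge0 ?(ltW x0)//=.
  apply: le_trans (hK x x0); rewrite (_ : p - 1 = 1 + (p - 2))%R; last by ring.
  by rewrite (powRD_gt0 1 (p - 2) x0) (powRr1 (ltW x0)).
have mp q : measurable_fun (`[0%R, +oo[ : set R) (fun x : R => (`|x| `^ q * gd x)%:E).
  apply: measurable_funTS; apply/measurable_EFinP; apply: measurable_funM.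
    exact: measurable_absr_powR.
  exact: measurable_gauss_density.
have int_f : \int[mu]_(x in `[0%R, +oo[) (f x)%:E = C%:E.
  rewrite (@ge0_continuous_FTC2y _ f F 0 0)//.
  - by rewrite /F mul0r mul0r oppr0 sub0r expR0 mulr1 EFinN oppeK add0e.
  - exact: continuous_subspaceT.
  - by move=> x x0; have [] := dF x x0.
  - apply: cvg_at_right_filter; apply: cvgB; last by apply: cvgM; [exact: cvg_cst|exact: cexp].
    apply: cvgN; apply: cvgM; last exact: cgd.
    by apply: cvgM; [exact: cvg_id|apply: continuous_absr_powR; lra].
  - by move=> x; rewrite in_itv/= andbT => x0; rewrite derive1E; have [_ ->] := dF x x0.
have int_e : \int[mu]_(x in `[0%R, +oo[) (expR (- x))%:E = 1.
  rewrite (@ge0_continuous_FTC2y _ _ (fun x => - expR (- x)) 0 0)%R//.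
  - by rewrite oppr0 expR0 EFinN oppeK add0e.
  - exact: continuous_subspaceT.
  - by rewrite -[X in _ --> X]oppr0; apply: cvgN; exact: cvgr_expR.
  - by apply: cvg_at_right_filter; apply: cvgN; exact: cexp.
  - move=> x _; have dn : is_derive x 1%R (fun y : R => - y)%R (-1)%R by exact: is_deriveN (is_derive_id x (1%R : R)).
    have := is_deriveN (is_derive1_comp (is_derive_expR (- x)%R) dn).
    by rewrite mulrN1 opprK derive1E => -[_].
have mI : measurable (`[0%R, +oo[ : set R) by exact: measurable_itv.
have I0 (x : R) : `[0%R, +oo[%classic x -> (0 <= x)%R by rewrite /= in_itv/= andbT.
have me : measurable_fun (`[0%R, +oo[ : set R) (fun x : R => (C * expR (- x))%:E).
  apply: measurable_funTS; apply/measurable_EFinP; apply: measurable_funM => //.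
  exact: measurableT_comp.
have mf : measurable_fun (`[0%R, +oo[ : set R) (fun x : R => (f x)%:E).
  apply: measurable_funTS; apply/measurable_EFinP.
  exact: continuous_measurable_fun.
have e1 : \int[mu]_(x in `[0%R, +oo[) ((f x)%:E + ((p - 1) * (`|x| `^ (p - 2) * gd x))%:E) =
    C%:E + (p - 1)%:E * half_moment (p - 2).
  rewrite ge0_integralD//=; last 3 first.
  - by move=> x /I0 x0; rewrite lee_fin f0.
  - by move=> x _; rewrite lee_fin mulr_ge0 ?mulr_ge0 ?powR_ge0//; lra.
  - apply/measurable_EFinP; apply: measurable_funM => //.
    by apply/measurable_EFinP; exact: mp.
  rewrite int_f; congr (_ + _); under eq_integral do rewrite EFinM.
  rewrite ge0_integralZl//=; first exact: mp.
  - by move=> x _; rewrite lee_fin mulr_ge0 ?powR_ge0.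
  - by rewrite lee_fin; lra.
have e2 : \int[mu]_(x in `[0%R, +oo[) ((`|x| `^ p * gd x)%:E + (C * expR (- x))%:E) =
    half_moment p + C%:E.
  rewrite ge0_integralD//=; last 3 first.
  - by move=> x _; rewrite lee_fin mulr_ge0 ?powR_ge0.
  - exact: mp.
  - by move=> x _; rewrite lee_fin mulr_ge0 ?expR_ge0.
  congr (_ + _); under eq_integral do rewrite EFinM.
  rewrite ge0_integralZl//= ?int_e ?mule1//.
  - apply: measurable_funTS; apply/measurable_EFinP; exact: measurableT_comp.
have : half_moment p + C%:E = (p - 1)%:E * half_moment (p - 2) + C%:E.
  rewrite -e2 addeC -e1; apply: eq_integral => x _.
  by rewrite -!EFinD; congr (_%:E); rewrite /f; ring.
by move=> /(congr1 (fun z => z - C%:E)); rewrite !addeK.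
Unshelve. all: end_near. Qed.

Lemma gauss_moment_rec (p : R) : (2 <= p)%R ->
  gauss_moment p = (p - 1)%:E * gauss_moment (p - 2).
Proof.
move=> p2; have p0 : (0 <= p)%R by lra.
have p20 : (0 <= p - 2)%R by lra.
by rewrite (gauss_moment_half p0) (gauss_moment_half p20) (gauss_half_moment_rec p2) muleCA.
Qed.

Lemma gauss_moment0 : gauss_moment 0 = 1.
Proof.
rewrite /gauss_moment; under eq_integral do rewrite powRr0.
exact: integral_normal_cst.
Qed.

Lemma gauss_moment2 : gauss_moment 2 = 1.
Proof. by rewrite gauss_moment_rec// subrr gauss_moment0 mule1; congr (_%:E); lra. Qed.

Lemma gauss_moment_ge0 (p : R) : 0 <= gauss_moment p.
Proof. by apply: integral_ge0 => x _; rewrite lee_fin powR_ge0. Qed.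

Let mpow (p : R) : measurable_fun [set: R] (fun x : R => (`|x| `^ p)%:E).
Proof. by apply/measurable_EFinP; exact: measurable_absr_powR. Qed.

(** The recursion lowers [p] by 2 until [p < 2], where [|x| ^ p <= 1 + |x| ^ 2]. *)
Lemma gauss_moment_lty (p : R) : (0 <= p)%R -> gauss_moment p < +oo.
Proof.
move=> p0; have [n pn] : exists n, (p <= n%:R)%R.
  by exists (Num.bound p); apply/ltW/archi_boundP.
elim: n p p0 pn => [p p0 p00|n IH p p0 pn].
  have -> : p = 0%R by lra.
  by rewrite gauss_moment0 ltry.
have [p2|p2] := leP 2%R p.
  rewrite gauss_moment_rec// lte_mul_pinfty ?lee_fin//; first by lra.
  by apply: IH; [lra|rewrite -natr1 in pn; lra].
apply: (@le_lt_trans _ _ (\int[N]_x (1 + (`|x| `^ 2)%:E))).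
  apply: ge0_le_integral => //.
  - exact: mpow.
  - by apply: emeasurable_funD => //; exact: mpow.
  - move=> x _; rewrite -EFinD lee_fin.
    have [x1|x1] := leP (1%R : R) (`|x|)%R.
      apply: le_trans (_ : `|x| `^ 2 <= _)%R; last by rewrite lerDr.
      by apply: ler_powR => //; exact: ltW.
    have := powR_ge0 (`|x|)%R 2.
    have : (`|x| `^ p <= 1)%R.
      have [->|xn0] := eqVneq (`|x|)%R 0%R; first by rewrite /powR eqxx; case: eqP.
      rewrite -[leRHS](powRr0 (`|x|)%R); apply: ger_powR => //.
      by rewrite lt_neqAle eq_sym xn0 normr_ge0 ltW.
    lra.
rewrite ge0_integralD//=; last exact: mpow.
by rewrite -/(gauss_moment 2) gauss_moment2 integral_normal_cst -EFinD ltry.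
Qed.

Lemma gauss_moment_fin_num (p : R) : (0 <= p)%R -> gauss_moment p \is a fin_num.
Proof. by move=> p0; rewrite ge0_fin_numE ?gauss_moment_ge0 ?gauss_moment_lty. Qed.

(** Jensen's inequality, through Bernoulli's inequality for [|x| ^ 2] with exponent [p / 2], and the
    unit second moment. *)
Lemma gauss_moment_ge1 (p : R) : (2 <= p)%R -> 1 <= gauss_moment p.
Proof.
move=> p2.
have : \int[N]_x ((p / 2)%:E * (`|x| `^ 2)%:E) <= \int[N]_x ((`|x| `^ p)%:E + (p / 2 - 1)%:E).
  apply: ge0_le_integral => //.
  - by move=> x _; rewrite mule_ge0// lee_fin ?powR_ge0//; lra.
  - by apply: measurable_funeM; exact: mpow.
  - by apply: emeasurable_funD => //; exact: mpow.
  - move=> x _; rewrite -EFinD -EFinM lee_fin.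
    have p21 : (1 <= p / 2)%R by lra.
    have := bernoulli_powR_ge p21 (powR_ge0 (`|x|)%R 2).
    rewrite -powRrM (_ : 2 * (p / 2) = p)%R; last by field.
    lra.
rewrite ge0_integralZl//=; last 2 first.
- exact: mpow.
- by rewrite lee_fin; lra.
rewrite ge0_integralD//=; last 2 first.
- exact: mpow.
- by move=> x _; rewrite lee_fin; lra.
rewrite -/(gauss_moment 2) -/(gauss_moment p) gauss_moment2 mule1.
rewrite integral_normal_cst.
have p0 : (0 <= p)%R by lra.
rewrite -(fineK (gauss_moment_fin_num p0)) -EFinD !lee_fin; lra.
Qed.

Lemma gauss_moment4 : gauss_moment 4 = 3%:E.
Proof.
rewrite gauss_moment_rec; last by lra.
rewrite (_ : 4 - 2 = 2 :> R)%R; last by lra.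
by rewrite gauss_moment2 mule1; congr (_%:E); lra.
Qed.

Lemma gauss_moment6 : gauss_moment 6 = 15%:E.
Proof.
rewrite gauss_moment_rec; last by lra.
rewrite (_ : 6 - 2 = 4 :> R)%R; last by lra.
by rewrite gauss_moment4 -EFinM; congr (_%:E); lra.
Qed.

(** This is [gamma_p <= sqrt p]. From 5 on it is inherited from [p - 2] by the recursion; the
    remaining range is treated directly. *)
Lemma gauss_moment_le (p : R) : (3 <= p)%R -> gauss_moment p <= (p `^ (p / 2))%:E.
Proof.
move=> p3; have p0 : (0 <= p)%R by lra.
have [n pn] : exists n, (p <= n%:R)%R.
  by exists (Num.bound p); apply/ltW/archi_boundP.
elim: n p p0 p3 pn => [|n IH] p p0 p3 pn; first by exfalso; lra.
have [p5|p5] := leP 5%R p.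
  rewrite gauss_moment_rec//; last by lra.
  have h : gauss_moment (p - 2) <= ((p - 2) `^ ((p - 2) / 2))%:E.
    by rewrite -natr1 in pn; apply: IH; lra.
  apply: le_trans (_ : (p - 1)%:E * ((p - 2) `^ ((p - 2) / 2))%:E <= _).
    by rewrite lee_wpmul2l// lee_fin; lra.
  rewrite -EFinM lee_fin.
  have -> : (p `^ (p / 2) = p * p `^ ((p - 2) / 2))%R.
    have pp : (0 < p)%R by lra.
    by rewrite (_ : p / 2 = 1 + (p - 2) / 2)%R; [rewrite powRD_gt0// powRr1|field].
  apply: ler_pM; rewrite ?powR_ge0//; try lra.
  by apply: ge0_ler_powR; rewrite ?nnegrE; lra.
(* With [y = x ^ 2 / p], interpolate [y ^ (p / 2) <= y + y ^ 3], valid because [p / 2] lies between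
   1 and 3. Only the second and sixth moments remain. *)
apply: (@le_trans _ _ (\int[N]_x ((p `^ (p / 2))%:E *
   ((p^-1)%:E * (`|x| `^ 2)%:E + (p^-1 ^+ 3)%:E * (`|x| `^ 6)%:E)))).
  apply: ge0_le_integral => //.
  - exact: mpow.
  - by apply: measurable_funeM; apply: emeasurable_funD; apply: measurable_funeM; exact: mpow.
  - move=> x _; rewrite [X in _ <= X](_ : _ = (p `^ (p / 2) *
      (p^-1 * `|x| `^ 2 + p^-1 ^+ 3 * `|x| `^ 6))%:E)// lee_fin.
    pose y := (`|x| `^ 2 / p)%R.
    have y0 : (0 <= y)%R by rewrite /y divr_ge0 ?powR_ge0.
    have -> : (`|x| `^ p = p `^ (p / 2) * y `^ (p / 2))%R.
      rewrite -powRM// /y mulrCA mulfV ?mulr1 -?powRrM; last by apply/eqP; lra.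
      by congr (_ `^ _)%R; field.
    rewrite ler_wpM2l ?powR_ge0//.
    have -> : (p^-1 * `|x| `^ 2 = y)%R by rewrite /y mulrC.
    have -> : (p^-1 ^+ 3 * `|x| `^ 6 = y ^+ 3)%R.
      by rewrite /y exprMn mulrC -(powR_mulrn 3 (powR_ge0 (`|x|)%R 2)) -powRrM; congr (_ `^ _ * _)%R; lra.
    have y30 : (0 <= y ^+ 3)%R by rewrite exprn_ge0.
    have [y1|y1] := leP 1%R y.
      apply: le_trans (_ : y `^ 3 <= _)%R; last by rewrite (powR_mulrn 3)// lerDr.
      by apply: ler_powR => //; lra.
    have [->|yn0] := eqVneq y 0%R.
      by rewrite powR0 ?addr_ge0//; [apply/eqP; lra].
    apply: le_trans (_ : y `^ 1 <= _)%R; last by rewrite powRr1// lerDl.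
    apply: ger_powR; last by lra.
    by rewrite lt_neqAle eq_sym yn0 y0 ltW.
rewrite ge0_integralZl//=; last 3 first.
- by apply: emeasurable_funD; apply: measurable_funeM; exact: mpow.
- by move=> x _; rewrite adde_ge0// mule_ge0// lee_fin ?powR_ge0 ?exprn_ge0// invr_ge0.
- by rewrite lee_fin powR_ge0.
rewrite ge0_integralD//=; last 4 first.
- by move=> x _; rewrite mule_ge0// lee_fin ?powR_ge0 ?invr_ge0.
- by apply: measurable_funeM; exact: mpow.
- by move=> x _; rewrite mule_ge0// lee_fin ?powR_ge0 ?exprn_ge0 ?invr_ge0.
- by apply: measurable_funeM; exact: mpow.
rewrite !ge0_integralZl//=; try exact: mpow; try by rewrite lee_fin ?exprn_ge0 ?invr_ge0.
- rewrite -/(gauss_moment 2) -/(gauss_moment 6) gauss_moment2 gauss_moment6.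
  rewrite mule1 [X in X <= _](_ : _ = (p `^ (p / 2) * (p^-1 + p^-1 ^+ 3 * 15))%:E)//.
  rewrite lee_fin ler_piMr ?powR_ge0//.
  (* At [p = 3] the bound is [1/3 + 15/27 = 8/9], and it decreases in [p]. *)
  have pi3 : (p^-1 <= 3^-1)%R by rewrite lef_pV2 ?posrE//; lra.
  have pi0 : (0 <= p^-1)%R by rewrite invr_ge0.
  have : (p^-1 ^+ 3 <= 3^-1 ^+ 3)%R by rewrite lerXn2r ?nnegrE//; lra.
  rewrite (_ : 3^-1 ^+ 3 = 27^-1 :> R)%R; last by field.
  lra.
Qed.

End GaussMoments.

(** * Comparison of moments under a single crossing of tails *)

Section LayerCake.
Context {R : realType}.
Local Notation mu := (@lebesgue_measure R).
Local Open Scope ereal_scope.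

Lemma measurable_tail_graph d (T : measurableType d) (X : T -> R) :
  measurable_fun [set: T] X ->
  measurable [set z : T * R | (0 <= z.2)%R && (z.2 <= X z.1)%R].
Proof.
move=> mX.
have mb : measurable_fun [set: T * R] (fun z : T * R => (0 <= z.2)%R && (z.2 <= X z.1)%R).
  apply: measurable_and; first exact: measurable_fun_ler.
  by apply: measurable_fun_ler => //; exact: measurableT_comp.
have := mb measurableT [set true]; rewrite setTI; exact.
Qed.

Lemma measurable_ge d (T : measurableType d) (X : T -> R) t :
  measurable_fun [set: T] X -> measurable [set w | (t <= X w)%R].
Proof.
move=> mX.
have mb : measurable_fun [set: T] (fun w => (t <= X w)%R).
  exact: measurable_fun_ler.
have := mb measurableT [set true]; rewrite setTI; exact.
Qed.

Lemma measurable_tail d (T : measurableType d) (m : probability T R) (X : T -> R) :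
  measurable_fun [set: T] X ->
  measurable_fun (`[0%R, +oo[ : set R) (fun t : R => m [set w | (t <= X w)%R]).
Proof.
move=> mX; have mA := measurable_tail_graph mX.
apply: (@eq_measurable_fun _ _ _ _ _
  (m \o ysection [set z : T * R | (0 <= z.2)%R && (z.2 <= X z.1)%R])); last first.
  by apply: measurable_funTS; exact: measurable_fun_ysection.
move=> t; rewrite inE/= in_itv/= andbT => t0.
congr (m _); apply/seteqP; split=> w /=.
  by rewrite /ysection/= inE/= => /andP[].
by move=> h; rewrite /ysection/= inE/= t0 h.
Qed.

(** Write [g (X w)] as [g 0] plus the integral of [g'] over [[0, X w]], and exchange the integrals
    over the region under the graph of [X]. *)
Lemma ge0_integral_layer d (T : measurableType d) (m : probability T R)
    (X : T -> R) (g g' : R -> R) :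
  measurable_fun [set: T] X -> (forall w, (0 <= X w)%R) ->
  (forall t : R, is_derive t (1%R : R) g (g' t)) -> continuous g' ->
  (forall t, (0 <= t)%R -> (0 <= g' t)%R) -> (0 <= g 0)%R ->
  \int[m]_w (g (X w))%:E = (g 0%R)%:E +
    \int[mu]_(t in `[0%R, +oo[) ((g' t)%:E * m [set w | (t <= X w)%R]).
Proof.
move=> mX X0 dg cg' g'0 g00.
pose A := [set z : T * R | (0 <= z.2)%R && (z.2 <= X z.1)%R].
have mA : measurable A by exact: measurable_tail_graph.
pose h (z : T * R) : \bar R := (g' z.2 * \1_A z)%:E.
have mg' : measurable_fun [set: R] g' by exact: continuous_measurable_fun.
have mh : measurable_fun setT h.
  apply/measurable_EFinP; apply: measurable_funM; first exact: measurableT_comp.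
  exact: measurable_indic.
have h0 z : 0 <= h z.
  rewrite lee_fin indicE; case: (boolP (z \in A)); last by rewrite mulr0.
  by rewrite inE /A/= => /andP[/g'0 ? _]; rewrite mulr1.
have gE w : (g (X w))%:E = (g 0%R)%:E + \int[mu]_t h (w, t).
  transitivity ((g 0%R)%:E + \int[mu]_(t in `[0%R, X w]) (g' t)%:E).
    have [X0'|X0'] := eqVneq (X w) 0%R.
      by rewrite X0' set_itv1 integral_set1 adde0.
    have {X0'} X0' : (0 < X w)%R by rewrite lt_neqAle eq_sym X0' X0.
    have cg : continuous g.
      move=> t; apply: differentiable_continuous; apply/derivable1_diffP.
      by have [] := dg t.
    rewrite (@continuous_FTC2 _ g' g)//.
    - by rewrite -EFinB -EFinD addrC subrK.
    - exact: continuous_subspaceT.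
    - split.
      + by move=> t _; have [] := dg t.
      + by apply: cvg_at_right_filter; exact: cg.
      + by apply: cvg_at_left_filter; exact: cg.
    - by move=> t _; rewrite derive1E; have [_ ->] := dg t.
  congr (_ + _); rewrite integral_mkcond; apply: eq_integral => t _.
  rewrite /h patchE indicE.
  have -> : ((w, t) \in A) = (t \in `[0%R, X w]%classic).
    by apply/idP/idP; rewrite !inE /A /mkset/= ?in_itv/=; exact.
  by case: ifPn => _; rewrite ?mulr1 ?mulr0.
under eq_integral do rewrite gE.
rewrite ge0_integralD//=; last 2 first.
- by move=> w _; exact: integral_ge0.
- exact: (@measurable_fun_fubini_tonelli_F _ _ _ _ _ mu _ mh h0).
congr (_ + _).
  by rewrite integral_cst// [X in _ * X](@probability_setT _ _ _ m) mule1.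
rewrite (@fubini_tonelli _ _ _ _ _ m mu h mh h0).
rewrite [RHS]integral_mkcond; apply: eq_integral => t _.
rewrite patchE; case: ifPn => [|/negP].
  rewrite inE/= in_itv/= andbT => t0.
  rewrite /h /=; under eq_integral do rewrite EFinM.
  rewrite ge0_integralZl//=.
  - rewrite integral_indic//=; last first.
      have -> : (fun x : T => A (x, t)) = [set w | (t <= X w)%R].
        by apply/seteqP; split => w /=; rewrite /A/= t0.
      exact: measurable_ge.
    congr (_ * m _); rewrite setIT.
    by apply/seteqP; split => w /=; rewrite /A/= t0.
  - apply/measurable_EFinP; apply: measurableT_comp; first exact: measurable_indic.
    exact: pair2_measurable.
  - by rewrite lee_fin g'0.
move=> t0; apply: integral0_eq => w _; rewrite /h indicE.
case: (boolP ((w, t) \in A)); last by rewrite mulr0.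
by rewrite inE /A/= => /andP[h1 _]; exfalso; apply: t0; rewrite inE/= in_itv/= h1.
Qed.

(* With [k] half the slope of [g] at [t0 ^+ 2] as a function of [t ^+ 2], the
   integrands of the layer-cake formulas satisfy
   [(g' t - 2 k t) * (P (X >= t) - P (Y >= t)) <= 0] for every [t]. *)
Lemma single_crossing_le d1 (T1 : measurableType d1) (m1 : probability T1 R) (X : T1 -> R)
    d2 (T2 : measurableType d2) (m2 : probability T2 R) (Y : T2 -> R)
    (g g' : R -> R) (t0 : R) :
  measurable_fun [set: T1] X -> (forall w, (0 <= X w)%R) ->
  measurable_fun [set: T2] Y -> (forall w, (0 <= Y w)%R) ->
  (forall t : R, is_derive t (1%R : R) g (g' t)) -> continuous g' ->
  (forall t, (0 <= t)%R -> (0 <= g' t)%R) -> (0 <= g 0)%R ->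
  (forall s t, (0 <= s)%R -> (s <= t)%R -> (t * g' s <= s * g' t)%R) ->
  (0 <= t0)%R ->
  (forall t, (0 <= t < t0)%R -> m2 [set w | t <= Y w]%R <= m1 [set w | t <= X w]%R) ->
  (forall t, (t0 < t)%R -> m1 [set w | t <= X w]%R <= m2 [set w | t <= Y w]%R) ->
  \int[m1]_w ((X w) ^+ 2)%:E <= \int[m2]_w ((Y w) ^+ 2)%:E ->
  \int[m2]_w ((Y w) ^+ 2)%:E < +oo ->
  \int[m1]_w (g (X w))%:E <= \int[m2]_w (g (Y w))%:E.
Proof.
move=> mX X0 mY Y0 dg cg' g'0 g00 slope t00 below above XY Yoo.
(* If [t0 = 0], then [k = 0] by the convention [0^-1 = 0]. *)
pose k := (g' t0 / (2 * t0))%R.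
have k0 : (0 <= k)%R by rewrite /k divr_ge0 ?g'0// mulr_ge0.
pose TX t := m1 [set w | t <= X w]%R.
pose TY t := m2 [set w | t <= Y w]%R.
have dsq (t : R) : is_derive t (1%R : R) (fun t : R => t ^+ 2)%R (2 * t)%R.
  by apply: is_derive_eq; rewrite /GRing.scale/=; ring.
have csq : continuous (fun t : R => 2 * t)%R.
  by move=> t; apply: cvgM; [exact: cvg_cst|exact: cvg_id].
have sq0 t : (0 <= t)%R -> (0 <= 2 * t :> R)%R by move=> ?; rewrite mulr_ge0.
have sq00 : (0 <= (0 : R) ^+ 2)%R by rewrite expr0n.
have X2 := @ge0_integral_layer _ _ m1 X (fun t => t ^+ 2)%R _ mX X0 dsq csq sq0 sq00.
have Y2 := @ge0_integral_layer _ _ m2 Y (fun t => t ^+ 2)%R _ mY Y0 dsq csq sq0 sq00.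
rewrite expr0n/= add0e in X2; rewrite expr0n/= add0e in Y2.
rewrite (ge0_integral_layer m1 mX X0 dg cg' g'0 g00).
rewrite (ge0_integral_layer m2 mY Y0 dg cg' g'0 g00).
rewrite -/TX -/TY in X2 Y2 *.
apply: leeD => //.
set IX := \int[mu]_(t in _) _; set IY := \int[mu]_(t in _) _.
rewrite X2 Y2 in XY; rewrite Y2 in Yoo.
set VX := \int[mu]_(t in _) _ in XY; set VY := \int[mu]_(t in _) _ in XY Yoo.
have mI : measurable (`[0%R, +oo[ : set R) by exact: measurable_itv.
have I0 (x : R) : `[0%R, +oo[%classic x -> (0 <= x)%R by rewrite /= in_itv/= andbT.
have mg' : measurable_fun [set: R] g' by exact: continuous_measurable_fun.
have mTX : measurable_fun (`[0%R, +oo[ : set R) TX by exact: measurable_tail.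
have mTY : measurable_fun (`[0%R, +oo[ : set R) TY by exact: measurable_tail.
have mgE : measurable_fun (`[0%R, +oo[ : set R) (fun t => (g' t)%:E).
  by apply: measurable_funTS; exact/measurable_EFinP.
have msq : measurable_fun (`[0%R, +oo[ : set R) (fun t : R => (2 * t)%:E).
  by apply: measurable_funTS; apply/measurable_EFinP; exact: measurable_funM.
(* The multiples of the second moments are added crosswise rather than subtracted, as [IX] and [IY]
   may be infinite; only the finite [VY] is cancelled at the end. *)
have key : IX + k%:E * VY <= IY + k%:E * VX.
  have pos c (f : R -> \bar R) : (forall t, (0 <= t)%R -> (0 <= c t)%R) ->
      (forall t, 0 <= f t) ->
      forall t, `[0%R, +oo[%classic t -> 0 <= (c t)%:E * f t.
    by move=> c0 f0 t /I0 t0'; rewrite mule_ge0// lee_fin c0.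
  pose I := (`[0%R, +oo[%classic : set R).
  have comb (S S' : R -> \bar R) : measurable_fun I S -> measurable_fun I S' ->
      (forall t, 0 <= S t) -> (forall t, 0 <= S' t) ->
      \int[mu]_(t in I) ((g' t)%:E * S t) + k%:E * \int[mu]_(t in I) ((2 * t)%:E * S' t) =
      \int[mu]_(t in I) ((g' t)%:E * S t + k%:E * ((2 * t)%:E * S' t)).
    move=> mS mS' S0 S'0.
    have mgS : measurable_fun I (fun t => (g' t)%:E * S t) by exact: emeasurable_funM.
    have msS : measurable_fun I (fun t => (2 * t)%:E * S' t) by exact: emeasurable_funM.
    rewrite -(@ge0_integralZl _ _ _ mu I mI _ msS k%:E); last 2 first.
    - exact: pos.
    - by rewrite lee_fin.
    rewrite ge0_integralD//.
    - exact: pos.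
    - by move=> t tI; rewrite mule_ge0 ?lee_fin// pos.
    - exact: measurable_funeM.
  rewrite /IX /VY comb// /IY /VX comb//.
  apply: ge0_le_integral => //.
  - move=> t tI; apply: adde_ge0; first by apply: (pos g' TX g'0 _ t tI).
    by rewrite mule_ge0 ?lee_fin//; apply: (pos _ TY sq0 _ t tI).
  - apply: emeasurable_funD; first exact: emeasurable_funM.
    by apply: measurable_funeM; exact: emeasurable_funM.
  - apply: emeasurable_funD; first exact: emeasurable_funM.
    by apply: measurable_funeM; exact: emeasurable_funM.
  move=> t /I0 t_ge0.
  have [x xE] : exists x, TX t = x%:E.
    by exists (fine (TX t)); rewrite fineK// fin_num_measure//; exact: measurable_ge.
  have [y yE] : exists y, TY t = y%:E.
    by exists (fine (TY t)); rewrite fineK// fin_num_measure//; exact: measurable_ge.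
  rewrite -/(TX t) -/(TY t) xE yE -!EFinM -!EFinD lee_fin.
  have [tt0|tt0|tt0] := ltgtP t t0.
  - have := below t; rewrite -/(TX t) -/(TY t) xE yE lee_fin t_ge0 tt0 => /(_ isT) yx.
    have t0p : (0 < t0)%R by lra.
    have : (g' t <= k * (2 * t))%R.
      have := slope t t0 t_ge0 (ltW tt0).
      rewrite (_ : k * (2 * t) = t * g' t0 / t0)%R; last by rewrite /k; field; lra.
      by rewrite ler_pdivlMr// mulrC.
    nra.
  - have := above t tt0; rewrite -/(TX t) -/(TY t) xE yE lee_fin => xy.
    have : (k * (2 * t) <= g' t)%R.
      have [t00'|t00'] := eqVneq t0 0%R.
        by rewrite /k t00' mulr0 invr0 mulr0 mul0r g'0.
      have t0p : (0 < t0)%R by rewrite lt_neqAle eq_sym t00'.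
      have := slope t0 t t00 (ltW tt0).
      rewrite (_ : k * (2 * t) = t * g' t0 / t0)%R; last by rewrite /k; field; lra.
      by rewrite ler_pdivrMr// (mulrC t0).
    nra.
  (* At the crossing point neither tail is known to dominate, but there the weight [g' t - 2 k t]
     vanishes. *)
  - have -> : (g' t = k * (2 * t))%R.
      have [t00'|t00'] := eqVneq t0 0%R.
        rewrite /k tt0 t00' !mulr0; apply/le_anti; rewrite g'0// andbT.
        by have := slope 0%R 1%R (lexx _) ler01; rewrite mul1r mul0r.
      by rewrite /k tt0; field.
    lra.
have VYfin : k%:E * VY \is a fin_num.
  have VY0 : 0 <= VY.
    by apply: integral_ge0 => t /I0 t0'; rewrite mule_ge0// lee_fin mulr_ge0.
  by rewrite fin_numM// ge0_fin_numE.
rewrite -(leeD2rE IX IY VYfin); apply: le_trans key _.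
by rewrite leeD2l// lee_wpmul2l// lee_fin.
Qed.

End LayerCake.

(** * Gaussian mixtures with exponential variance *)

Section GaussCdf.
Context {R : realType}.
Local Notation mu := (@lebesgue_measure R).
Local Notation N := (@normal_prob R 0 1).
Local Notation gd := (@gauss_density R).

Definition gauss_cdf (z : R) : R := \int[mu]_(t in `]-oo, z]) gd t.

(** The identity as a random variable under the normal law, so that the limits of [cdf] at both
    infinities apply to [gauss_cdf]. *)
Let idTR : measurableTypeR R -> R := idfun.
HB.instance Definition _ :=
  @isMeasurableFun.Build _ _ _ _ idTR (@measurable_id _ _ setT).

Lemma integrable_gauss_density : mu.-integrable setT (EFin \o gd).
Proof.
rewrite (_ : EFin \o gd = (fun x => (normal_pdf 0 1 x)%:E)).
  exact: integrable_normal_pdf.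
by apply/funext => x /=; rewrite normal_pdf01E.
Qed.

Lemma gauss_cdfE z : (gauss_cdf z)%:E = cdf (idTR : {RV N >-> R}) z.
Proof.
rewrite /gauss_cdf /Rintegral fineK; last first.
  apply: integrable_fin_num => //.
  by apply: integrableS integrable_gauss_density.
rewrite /cdf /distribution /pushforward /= /normal_prob.
by apply: eq_integral => x _; rewrite normal_pdf01E.
Qed.

Lemma cvg_gauss_cdfy : gauss_cdf z @[z --> +oo] --> (1 : R).
Proof.
have := @cvg_cdfy1 _ _ _ N (idTR : {RV N >-> R}).
rewrite (_ : cdf _ = EFin \o gauss_cdf); last by apply/funext => z; exact/esym/gauss_cdfE.
by move=> /fine_cvgP[].
Qed.

Lemma cvg_gauss_cdfNy : gauss_cdf z @[z --> -oo] --> (0 : R).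
Proof.
have := @cvg_cdfNy0 _ _ _ N (idTR : {RV N >-> R}).
rewrite (_ : cdf _ = EFin \o gauss_cdf); last by apply/funext => z; exact/esym/gauss_cdfE.
by move=> /fine_cvgP[].
Qed.

Lemma is_derive_gauss_cdf (z : R) : is_derive z 1 gauss_cdf (gd z).
Proof.
have zz : z < z + 1 by rewrite ltrDl.
have ig : mu.-integrable `]-oo, z + 1] (EFin \o gd).
  by apply: integrableS integrable_gauss_density.
have FTC := @continuous_FTC1 R gd -oo%O z (z + 1) zz ig.
suff [d1 d2] : derivable gauss_cdf z 1 /\ gauss_cdf^`()%classic z = gd z.
  by rewrite derive1E in d2; exact: (DeriveDef d1 d2).
apply: FTC; [by rewrite /= ltNyr|exact: continuous_gauss_density].
Qed.

(* The probability that [sqrt r * |x| >= t > 0] for [r] exponential of mean 1; at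
   [x = 0] the formula would give [expR 0], as [0^-1 = 0]. *)
Definition gauss_tail (t x : R) : R := if x == 0 then 0 else expR (- (t ^+ 2 / x ^+ 2)).

Lemma gauss_tail_ge0 t x : 0 <= gauss_tail t x.
Proof. by rewrite /gauss_tail; case: ifP => // _; exact: expR_ge0. Qed.

(** From [exp (- u) <= 1 / u] with [u = t ^ 2 / x ^ 2]; it squeezes [gauss_tail t] to 0 at the
    origin. *)
Lemma gauss_tail_le t x : 0 < t -> gauss_tail t x <= x ^+ 2 / t ^+ 2.
Proof.
move=> t0; rewrite /gauss_tail; case: eqVneq => [->|x0].
  by rewrite expr0n/= mul0r.
have x20 : 0 < x ^+ 2 by rewrite exprn_even_gt0.
have t20 : 0 < t ^+ 2 by rewrite exprn_gt0.
rewrite expRN -[leRHS]invf_div lef_pV2 ?posrE ?expR_gt0 ?divr_gt0//.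
have := expR_ge1Dx (t ^+ 2 / x ^+ 2); lra.
Qed.

Lemma continuous_gauss_tail t : 0 < t -> continuous (gauss_tail t).
Proof.
move=> t0 x; have [->|x0] := eqVneq x 0.
  rewrite /continuous_at {2}/gauss_tail eqxx.
  apply: (@squeeze_cvgr _ _ _ _ (cst 0) (fun x => x ^+ 2 / t ^+ 2)).
  - by near=> y; rewrite gauss_tail_ge0 gauss_tail_le.
  - exact: cvg_cst.
  - rewrite [X in _ --> X](_ : _ = 0 ^+ 2 / t ^+ 2); last by rewrite expr0n mul0r.
    by apply: cvgM; [exact: sqr_continuous|exact: cvg_cst].
have h : expR (- (t ^+ 2 / y ^+ 2)) @[y --> x] --> expR (- (t ^+ 2 / x ^+ 2)).
  apply: (cvg_comp (fun y : R => - (t ^+ 2 / y ^+ 2)) expR); last exact: continuous_expR.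
  apply: cvgN; apply: cvgM; first exact: cvg_cst.
  by apply: cvgV; [rewrite expf_neq0|exact: sqr_continuous].
rewrite /continuous_at {2}/gauss_tail (negbTE x0).
apply: cvg_trans h; apply: near_eq_cvg.
near=> y; rewrite /gauss_tail ifF//; apply/eqP => y0.
have : `|x - y| < `|x|.
  near: y; exists `|x|; first by rewrite /= normr_gt0.
  by move=> y.
by rewrite y0 subr0 ltxx.
Unshelve. all: end_near. Qed.

(** The mean of [exp (- t ^ 2 / g ^ 2)], by an explicit antiderivative. With [c = sqrt 2 * t], the
    square [(x + c / x) ^ 2 / 2] is [x ^ 2 / 2 + t ^ 2 / x ^ 2 + c], and likewise with [- c], so
    both exponential factors reduce to the integrand. *)
Lemma integral_gauss_tail t : 0 < t ->
  (\int[N]_x (gauss_tail t x)%:E = (expR (- (Num.sqrt 2 * t)))%:E)%E.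
Proof.
move=> t0; pose c := Num.sqrt 2 * t.
have c0 : 0 < c by rewrite mulr_gt0// sqrtr_gt0.
have c2 : c ^+ 2 = 2 * t ^+ 2 by rewrite exprMn sqr_sqrtr.
have ct := continuous_gauss_tail t0.
have cgd := @continuous_gauss_density R.
have mt : measurable_fun [set: R] (gauss_tail t) by exact: continuous_measurable_fun.
rewrite ge0_integral_normal; last 2 first.
- exact/measurable_EFinP.
- by move=> x; rewrite lee_fin gauss_tail_ge0.
under eq_integral do rewrite -EFinM.
pose f x := gauss_tail t x * gd x.
have cf : continuous f by move=> x; apply: cvgM; [exact: ct|exact: cgd].
have f0 x : 0 <= f x by rewrite mulr_ge0 ?gauss_tail_ge0 ?gauss_density_ge0.
rewrite (@ge0_symfun_integralT _ f)//; last first.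
  by move=> x /=; rewrite /f /gauss_tail /gauss_density oppr_eq0 sqrrN.
rewrite (_ : [set x | 0 <= x] = `[0, +oo[%classic); last first.
  by apply/seteqP; split => x /=; rewrite in_itv/= andbT.
(* In the derivative the terms in [c / x ^ 2] cancel between the two summands. *)
pose H x := (expR c * gauss_cdf (x + c / x) + expR (- c) * gauss_cdf (x - c / x)) / 2.
(* [H] extended by its limit at [0+], where the arguments [x + c / x] and [x - c / x] tend to the
   two infinities. The limit at infinity exceeds it by [exp (- c) / 2]. *)
pose F x := if x <= 0 then expR c / 2 else H x.
have dF (x : R) : 0 < x -> is_derive x 1 F (f x).
  move=> x0.
  have xn0 : x != 0 by rewrite gt_eqF.
  have dq : is_derive x 1 (fun y : R => c / y) (- (c / x ^+ 2)).
    have := is_deriveZ c (is_deriveV xn0 (is_derive_id x (1 : R))).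
    by rewrite (_ : _ *: _ = - (c / x ^+ 2))// /GRing.scale/=; field.
  have dp := is_deriveD (is_derive_id x (1 : R)) dq.
  have dm := is_deriveB (is_derive_id x (1 : R)) dq.
  have dH : is_derive x 1 H ((expR c * (gd (x + c / x) * (1 - c / x ^+ 2)) +
      expR (- c) * (gd (x - c / x) * (1 + c / x ^+ 2))) / 2).
    have e1 := @is_derive1_comp _ gauss_cdf (fun y => y + c / y) _ _ _ (is_derive_gauss_cdf (x + c / x)) dp.
    have e2 := @is_derive1_comp _ gauss_cdf (fun y => y - c / y) _ _ _ (is_derive_gauss_cdf (x - c / x)) dm.
    have := is_deriveZ 2^-1 (is_deriveD (is_deriveZ (expR c) e1) (is_deriveZ (expR (- c)) e2)).
    rewrite opprK /GRing.scale/= [_^-1 * _]mulrC.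
    suff -> : H = (2^-1 \*: (expR c \*: (gauss_cdf \o (id + (fun y => c / y))) +
      expR (- c) \*: (gauss_cdf \o (id - (fun y => c / y))))) by [].
    by apply/funext => y; rewrite /H/= mulrC.
  have -> : f x = (expR c * (gd (x + c / x) * (1 - c / x ^+ 2)) +
      expR (- c) * (gd (x - c / x) * (1 + c / x ^+ 2))) / 2.
    rewrite /f /gauss_tail (negbTE xn0) /gauss_density.
    set k := (Num.sqrt _)^-1.
    have E1 : expR c * expR (- ((x + c / x) ^+ 2 / 2)) =
        expR (- (t ^+ 2 / x ^+ 2)) * expR (- (x ^+ 2 / 2)).
      rewrite -!expRD; congr expR.
      have -> : t ^+ 2 = c ^+ 2 / 2 by rewrite c2; field.
      by field.
    have E2 : expR (- c) * expR (- ((x - c / x) ^+ 2 / 2)) =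
        expR (- (t ^+ 2 / x ^+ 2)) * expR (- (x ^+ 2 / 2)).
      rewrite -!expRD; congr expR.
      have -> : t ^+ 2 = c ^+ 2 / 2 by rewrite c2; field.
      by field.
    transitivity ((k * (1 - c / x ^+ 2) * (expR c * expR (- ((x + c / x) ^+ 2 / 2))) +
      k * (1 + c / x ^+ 2) * (expR (- c) * expR (- ((x - c / x) ^+ 2 / 2)))) / 2); last by ring.
    by rewrite E1 E2; field.
  apply: near_eq_is_derive dH.
  near=> y; rewrite /F ifF//; apply/negbTE; rewrite -ltNge.
  by near: y; exact: lt_nbhsr.
have cxy : (c / x @[x --> +oo]) --> 0.
  rewrite -[X in _ --> X](mulr0 c); apply: cvgM; first exact: cvg_cst.
  by apply/gtr0_cvgV0; [near=> x|exact: cvg_id].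
have limF : F x @[x --> +oo] --> (expR c + expR (- c)) / 2.
  have limH : H x @[x --> +oo] --> (expR c + expR (- c)) / 2.
    rewrite -[X in (X + _) / 2]mulr1 -[X in (_ + X) / 2]mulr1.
    apply: cvgM; last exact: cvg_cst.
    apply: cvgD; (apply: cvgM; first exact: cvg_cst).
    - apply: (cvg_comp (fun x => x + c / x) gauss_cdf); last exact: cvg_gauss_cdfy.
      apply/cvgryPge => A; near=> x.
      have x0 : 0 < x by near: x; exact: nbhs_pinfty_gt.
      have : A <= x by near: x; apply: nbhs_pinfty_ge; exact: num_real.
      have : 0 <= c / x by rewrite divr_ge0// ltW.
      lra.
    - apply: (cvg_comp (fun x => x - c / x) gauss_cdf); last exact: cvg_gauss_cdfy.
      apply/cvgryPge => A; near=> x.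
      have x0 : 1 <= x by near: x; apply: nbhs_pinfty_ge; exact: num_real.
      have : A + c <= x by near: x; apply: nbhs_pinfty_ge; exact: num_real.
      have : c / x <= c by rewrite ler_pdivrMr ?ler_peMr//; lra.
      lra.
  apply: cvg_trans limH; apply: near_eq_cvg; near=> x.
  rewrite /F ifF//; apply/negbTE; rewrite -ltNge.
  by near: x; exact: nbhs_pinfty_gt.
have rcF : F x @[x --> 0^'+] --> F 0.
  rewrite {2}/F lexx.
  have limH : H x @[x --> 0^'+] --> expR c / 2.
    rewrite [X in _ --> X](_ : _ = (expR c * 1 + expR (- c) * 0) / 2); last by rewrite mulr1 mulr0 addr0.
    apply: cvgM; last exact: cvg_cst.
    have big A : \forall x \near 0^'+, A <= c / x.
      near=> x.
      have x0 : 0 < x by near: x; exact: nbhs_right_gt.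
      rewrite ler_pdivlMr//.
      have : x < c / (`|A| + 1) by near: x; apply: nbhs_right_lt; rewrite divr_gt0// ltr_wpDl.
      rewrite ltr_pdivlMr ?ltr_wpDl// => h.
      have := ler_norm A; nra.
    apply: cvgD; (apply: cvgM; first exact: cvg_cst).
    - apply: (cvg_comp (fun x => x + c / x) gauss_cdf); last exact: cvg_gauss_cdfy.
      apply/cvgryPge => A; near=> x.
      have x0 : 0 < x by near: x; exact: nbhs_right_gt.
      have : A <= c / x by near: x; exact: big.
      lra.
    - apply: (cvg_comp (fun x => x - c / x) gauss_cdf); last exact: cvg_gauss_cdfNy.
      apply/cvgrNyPle => A; near=> x.
      have x0 : x < 1 by near: x; exact: nbhs_right_lt.
      have : 1 - A <= c / x by near: x; exact: big.
      lra.
  apply: cvg_trans limH; apply: near_eq_cvg; near=> x.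
  rewrite /F ifF//; apply/negbTE; rewrite -ltNge.
  by near: x; exact: nbhs_right_gt.
rewrite (@ge0_continuous_FTC2y _ f F 0 ((expR c + expR (- c)) / 2))//.
- by rewrite /F lexx -EFinB -EFinM -/c; congr (_%:E); field.
- exact: continuous_subspaceT.
- by move=> x x0; have [] := dF x x0.
- by move=> x; rewrite in_itv/= andbT => x0; rewrite derive1E; have [_ ->] := dF x x0.
Unshelve. all: end_near. Qed.

End GaussCdf.

(** * The exponential law and its Gaussian scale mixture *)

Section Exponential.
Context {R : realType}.
Local Notation mu := (@lebesgue_measure R).
Local Notation N := (@normal_prob R 0 1).
Local Open Scope ereal_scope.

Definition expo : probability (measurableTypeR R) R :=
  exponential_distribution_exponential_prob__canonical__probability_measure_Probability
    (@ltr01 R).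

Lemma ge0_integral_expo (f : R -> \bar R) :
  measurable_fun [set: R] f -> (forall x, 0 <= f x) ->
  \int[expo]_x f x = \int[mu]_x (f x * (exponential_pdf 1 x)%:E).
Proof.
move=> mf f0; apply: ge0_integral_density => //.
- exact: measurable_exponential_pdf.
- exact: exponential_pdf_ge0.
Qed.

Lemma expo_itvcy (c : R) : (0 <= c)%R -> expo `[c, +oo[%classic = (expR (- c))%:E.
Proof.
move=> c0; rewrite /expo/= /exponential_prob.
pose F (x : R) := (- expR (- x))%R.
have dF (x : R) : is_derive x (1%R : R) F (expR (- x)).
  by apply: is_derive_eq; rewrite /GRing.scale/=; ring.
have cF : continuous F.
  by move=> x; apply: differentiable_continuous; apply/derivable1_diffP; have [] := dF x.
have cE : continuous (fun x : R => expR (- x)).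
  by move=> x; rewrite (_ : (fun _ => _) = (fun x => - F x)%R); [apply: cvgN; exact: cF|apply/funext => y; rewrite /F opprK].
under eq_integral => x.
  rewrite inE/= in_itv/= andbT => cx.
  rewrite exponential_pdfE ?(le_trans c0)// mul1r mulN1r.
  over.
rewrite (@ge0_continuous_FTC2y _ _ F c 0%R)//.
- by rewrite /F -EFinB sub0r opprK.
- exact: continuous_subspaceT.
- rewrite -[X in _ --> X]oppr0; apply: cvgN; exact: cvgr_expR.
- by apply: cvg_at_right_filter; exact: cF.
- by move=> x _; rewrite derive1E; have [_ ->] := dF x.
Qed.

(** Exponential tilting: the integrand is [1 / (1 - z)] times the exponential density of rate
    [1 - z]. *)
Lemma expo_mgf (z : R) : (z < 1)%R -> \int[expo]_r (expR (z * r))%:E = ((1 - z)^-1)%:E.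
Proof.
move=> z1; have z1' : (0 < 1 - z)%R by lra.
have mz : measurable_fun [set: R] (fun r : R => expR (z * r)).
  by apply: measurableT_comp => //; exact: measurable_funM.
rewrite ge0_integral_expo; last 2 first.
- exact/measurable_EFinP.
- by move=> r; rewrite lee_fin expR_ge0.
transitivity (\int[mu]_r (((1 - z)^-1)%:E * (exponential_pdf (1 - z) r)%:E)).
  apply: eq_integral => r _; rewrite -!EFinM; congr (_%:E).
  have [r0|r0] := leP 0%R r; last by rewrite !lt0_exponential_pdf// !mulr0.
  rewrite !exponential_pdfE// mul1r mulrA mulVf ?lt0r_neq0// mul1r -expRD; congr expR; ring.
rewrite ge0_integralZl//=.
- by rewrite integral_exponential_pdf// mule1.
- by apply/measurable_EFinP; exact: measurable_exponential_pdf.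
- by move=> r _; rewrite lee_fin; apply: exponential_pdf_ge0; lra.
- by rewrite lee_fin invr_ge0 ltW.
Qed.

Lemma expo_mean : \int[expo]_r (Num.max r 0%R)%:E = 1.
Proof.
have mM : measurable_fun [set: R] (fun r : R => Num.max r 0%R).
  exact: measurable_maxr.
rewrite (@ge0_integral_layer _ _ _ expo (fun r : R => Num.max r 0%R) id (cst (1%R : R)))//; last 2 first.
- by move=> r; rewrite le_max lexx orbT.
- by move=> t; exact: cvg_cst.
rewrite add0e -[RHS](@integral_exponential_pdf R 1%R)//.
rewrite integral_mkcond; apply: eq_integral => t _; rewrite patchE; case: ifPn.
  rewrite inE/= in_itv/= andbT => t0; rewrite exponential_pdfE// mul1r mulN1r.
  rewrite mul1e.
  (* At [t = 0] the event is the whole line, because of the maximum with 0, rather than the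
     half-line [[0, +oo[]; both have probability 1. *)
  have [t00|t00] := eqVneq t 0%R.
    rewrite t00 oppr0 expR0; rewrite -[RHS](@probability_setT _ _ _ expo); congr (expo _).
    by apply/seteqP; split => // r _ /=; rewrite le_max lexx orbT.
  rewrite -expo_itvcy//; congr (expo _).
  apply/seteqP; split => r /=; rewrite in_itv/= andbT le_max.
    by move=> /orP[//|h]; exfalso; move/eqP: t00; apply; apply/le_anti; rewrite h t0.
  by move=> ->.
move/negP; rewrite inE/= in_itv/= andbT => /negP; rewrite -ltNge => t0.
by rewrite lt0_exponential_pdf.
Qed.

Lemma ge0_integral_prod_comm d1 (T1 : measurableType d1) (m1 : probability T1 R)
    d2 (T2 : measurableType d2) (m2 : probability T2 R) (f : T1 * T2 -> R) :
  measurable_fun [set: T1 * T2] f -> (forall z, (0 <= f z)%R) ->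
  \int[(m1 \x m2)%E]_z (f z)%:E = \int[m2]_y \int[m1]_x (f (x, y))%:E.
Proof.
move=> mf f0.
rewrite -(@fubini_tonelli2 _ _ _ _ _ m1 m2 (EFin \o f))//; first exact/measurable_EFinP.
Qed.

(* [|k \sqrt r x|] with [r] exponential and [x] Gaussian has an exponential law. *)
Definition laplace_abs (k : R) (z : R * R) : R := (k * Num.sqrt z.2 * `|z.1|)%R.

Local Notation NE := (N \x expo)%E.

Lemma laplace_abs_ge0 k z : (0 <= k)%R -> (0 <= laplace_abs k z)%R.
Proof. by move=> k0; rewrite /laplace_abs !mulr_ge0// sqrtr_ge0. Qed.

Lemma measurable_sqrtr : measurable_fun [set: R] (@Num.sqrt R).
Proof. by apply: continuous_measurable_fun; exact: sqrt_continuous. Qed.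

Lemma measurable_laplace_abs k : measurable_fun [set: R * R] (laplace_abs k).
Proof.
apply: measurable_funM; last exact: measurableT_comp.
apply: measurable_funM => //; apply: measurableT_comp => //; exact: measurable_sqrtr.
Qed.

(** For fixed [x <> 0] the event reads [r >= (t / k) ^ 2 / x ^ 2], of probability
    [gauss_tail (t / k) x]; for [x = 0] it is empty. Then integrate over the Gaussian [x]. *)
Lemma laplace_abs_tail k t : (0 < k)%R -> (0 <= t)%R ->
  NE [set z | (t <= laplace_abs k z)%R] = (expR (- (Num.sqrt 2 / k * t)))%:E.
Proof.
move=> k0; rewrite le_eqVlt => /predU1P[<-|t0].
  rewrite mulr0 oppr0 expR0 -[RHS](@probability_setT _ _ _ NE); congr (NE _).
  by apply/seteqP; split => // z _ /=; apply: laplace_abs_ge0; exact: ltW.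
have -> : (Num.sqrt 2 / k * t)%R = (Num.sqrt 2 * (t / k))%R by rewrite mulrAC -mulrA.
rewrite -integral_gauss_tail ?divr_gt0//.
rewrite /product_measure1; apply: eq_integral => x _ /=.
have [->|x0] := eqVneq x 0%R.
  rewrite /gauss_tail eqxx (_ : xsection _ _ = set0) ?measure0//.
  apply/seteqP; split => // r; rewrite /xsection/= inE/= /laplace_abs/= normr0 mulr0.
  by rewrite leNgt t0.
rewrite /gauss_tail (negbTE x0) -expo_itvcy; last by rewrite divr_ge0 ?sqr_ge0.
have u0 : (0 < t / k)%R by rewrite divr_gt0.
have x20 : (0 < x ^+ 2)%R by rewrite lt_neqAle eq_sym sqrf_eq0 x0 sqr_ge0.
have u0' : (t / k)%R \is Num.nneg by rewrite nnegrE ltW.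
have q0 (r : R) : (Num.sqrt r * `|x|)%R \is Num.nneg by rewrite nnegrE mulr_ge0// sqrtr_ge0.
have kE (r : R) : (t <= k * Num.sqrt r * `|x|)%R = (t / k <= Num.sqrt r * `|x|)%R.
  by rewrite ler_pdivrMr// [X in _ = (_ <= X)%R]mulrC mulrA.
have sE (r : R) : (0 <= r)%R -> ((Num.sqrt r * `|x|) ^+ 2 = r * x ^+ 2)%R.
  by move=> r0; rewrite exprMn sqr_sqrtr// real_normK// num_real.
congr (expo _); apply/seteqP; split => r;
    rewrite /xsection/= inE/= /laplace_abs/= in_itv/= andbT kE (ler_pdivrMr _ _ x20).
  move=> h; have [r0|r0] := leP 0%R r.
    by rewrite -sE// (ler_sqr u0' (q0 r)).
  by exfalso; move: h; rewrite ltr0_sqrtr// mul0r leNgt u0.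
move=> h; have r0 : (0 <= r)%R.
  by rewrite -(pmulr_lge0 _ x20) (le_trans _ h)// sqr_ge0.
by move: h; rewrite -sE// (ler_sqr u0' (q0 r)).
Qed.

Lemma laplace_abs_moment2 k : \int[NE]_z (laplace_abs k z ^+ 2)%:E = (k ^+ 2)%:E.
Proof.
rewrite ge0_integral_prod_comm; last 2 first.
- by apply: measurable_funX; exact: measurable_laplace_abs.
- by move=> z; exact: sqr_ge0.
transitivity (\int[expo]_y ((k ^+ 2)%:E * (Num.max y 0%R)%:E)).
  apply: eq_integral => r _.
  transitivity (\int[N]_x ((k ^+ 2 * Num.max r 0%R)%:E * (`|x| `^ 2)%:E)).
    apply: eq_integral => x _; rewrite -EFinM; congr (_%:E).
    rewrite /laplace_abs/= !exprMn powR_mulrn// real_normK ?num_real//; congr (_ * _ * _)%R.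
    have [r0|r0] := leP 0%R r; first by rewrite sqr_sqrtr.
    by rewrite ltr0_sqrtr// expr0n.
  rewrite ge0_integralZl//=.
  - by rewrite -/(gauss_moment 2) gauss_moment2 mule1 EFinM.
  - by apply/measurable_EFinP; exact: measurable_absr_powR.
  - by rewrite lee_fin mulr_ge0 ?sqr_ge0// le_max lexx orbT.
rewrite ge0_integralZl//=.
- by rewrite expo_mean mule1.
- by apply/measurable_EFinP; exact: measurable_maxr.
- by move=> x _; rewrite lee_fin le_max lexx orbT.
- by rewrite lee_fin sqr_ge0.
Qed.

End Exponential.

(** * Replacing one variable *)

Section OneStep.
Context {R : realType} d (T : measurableType d) (P : probability T R).
Local Notation N := (@normal_prob R 0 1).
Local Notation NE := (N \x expo)%E.
Local Open Scope ereal_scope.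
Variable X : {RV P >-> R}.
Hypothesis symX : symmetric_RV X.
Hypothesis X2 : 'E_P[fun w => (X w ^+ 2)%R] = 1.

Let mX : measurable_fun [set: T] X. Proof. by []. Qed.

Let mabsX : measurable_fun [set: T] (fun w => `|X w|%R).
Proof. exact: measurableT_comp. Qed.

Lemma symmetric_integral (f : R -> \bar R) : measurable_fun [set: R] f ->
  (forall x, 0 <= f x) -> \int[P]_w f (- X w)%R = \int[P]_w f (X w).
Proof.
move=> mf f0.
pose Y w := (- X w)%R.
have mY : measurable_fun [set: T] Y by exact: measurableT_comp.
rewrite -(@ge0_integral_pushforward _ _ T (measurableTypeR R) _ Y mY P setT f)//.
rewrite -(@ge0_integral_pushforward _ _ T (measurableTypeR R) _ X mX P setT f)//.
by apply: eq_measure_integral => A mA _; rewrite /pushforward; exact: symX.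
Qed.

Lemma measurable_shift_absr_powR p (w a : R) :
  measurable_fun [set: R] (fun x : R => `|w + a * x| `^ p)%R.
Proof.
apply: (measurableT_comp (@measurable_absr_powR R p)).
by apply: measurable_funD => //; exact: measurable_funM.
Qed.

(** Serves to symmetrize moments that may still be infinite, hence the case distinction on the
    value. *)
Lemma half_integralD d' (T' : measurableType d') (m : probability T' R) (f g : T' -> R) :
  measurable_fun [set: T'] f -> measurable_fun [set: T'] g ->
  (forall x, (0 <= f x)%R) -> (forall x, (0 <= g x)%R) ->
  \int[m]_x (g x)%:E = \int[m]_x (f x)%:E ->
  \int[m]_x ((f x + g x) / 2)%:E = \int[m]_x (f x)%:E.
Proof.
move=> mf mg f0 g0 fg.
under eq_integral do rewrite mulrC EFinM EFinD.
rewrite ge0_integralZl//=.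
- rewrite ge0_integralD//=.
  + have := @integral_ge0 _ _ _ m setT (fun x => (f x)%:E) (fun x _ => f0 x).
    rewrite fg; case: (\int[m]_x (f x)%:E) => [x||] //.
    * by rewrite -EFinD -EFinM => _; congr (_%:E); field.
    * by rewrite addye// gt0_muley// lte_fin invr_gt0.
  + by move=> x _; rewrite lee_fin.
  + exact/measurable_EFinP.
  + by move=> x _; rewrite lee_fin.
  + exact/measurable_EFinP.
- by apply: emeasurable_funD; exact/measurable_EFinP.
- by move=> x _; rewrite adde_ge0 ?lee_fin.
Qed.

Lemma sympow_integral p (w a : R) :
  \int[P]_t (`|w + a * X t| `^ p)%:E = \int[P]_t (sympow p w (`|a| * `|X t|))%:E.
Proof.
rewrite -(@half_integralD _ _ P (fun t => `|w + a * X t| `^ p)%R (fun t => `|w - a * X t| `^ p)%R).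
- by apply: eq_integral => t _; rewrite -normrM sympow_norm.
- by apply: (measurableT_comp (measurable_shift_absr_powR p w a)).
- under eq_fun do rewrite -mulNr.
  by apply: (measurableT_comp (measurable_shift_absr_powR p w (- a))).
- by move=> t; exact: powR_ge0.
- by move=> t; exact: powR_ge0.
have := @symmetric_integral (fun x => (`|w + a * x| `^ p)%:E).
under eq_integral do rewrite mulrN.
apply.
- by apply/measurable_EFinP; exact: measurable_shift_absr_powR.
- by move=> x; rewrite lee_fin powR_ge0.
Qed.

Lemma sympow_integral_normal p (w s : R) :
  \int[N]_x (sympow p w (s * `|x|))%:E = \int[N]_x (`|w + s * x| `^ p)%:E.
Proof.
rewrite -(@half_integralD _ _ N (fun x => `|w + s * x| `^ p)%R (fun x => `|w - s * x| `^ p)%R).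
- apply: eq_integral => t _; congr (_%:E).
  rewrite -(sympow_norm p w (s * `|t|)) normrM normr_id -normrM sympow_norm//.
- exact: measurable_shift_absr_powR.
- under eq_fun do rewrite -mulNr.
  exact: measurable_shift_absr_powR.
- by move=> t; exact: powR_ge0.
- by move=> t; exact: powR_ge0.
have := @ge0_integral_normalN R (fun x => (`|w + s * x| `^ p)%:E).
under eq_integral do rewrite mulrN.
apply.
- by apply/measurable_EFinP; exact: measurable_shift_absr_powR.
- by move=> x; rewrite lee_fin powR_ge0.
Qed.

Lemma absX_moment2 : \int[P]_w (`|X w| ^+ 2)%:E = 1.
Proof.
rewrite -X2 unlock; apply: eq_integral => w _.
by rewrite real_normK// num_real.
Qed.

Section Crossing.
Variables (p w a : R).
Hypothesis p3 : (3%R <= p)%R.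
Let g (h : R) : R := sympow p w (`|a| * h).
Let g' (h : R) : R := (`|a| * (p * symspow p w (`|a| * h)))%R.

Let dg (t : R) : is_derive t (1%R : R) g (g' t).
Proof.
have p1 : (1 < p)%R by have := p3; lra.
have da : is_derive t (1%R : R) (fun h : R => `|a| * h)%R `|a|%R.
  by apply: is_derive_eq; rewrite /GRing.scale/=; ring.
have := @is_derive1_comp _ (sympow p w) (fun h : R => `|a| * h)%R t _ _
  (is_derive_sympow w (`|a| * t) p1) da.
by rewrite mulrC.
Qed.

Let cg' : continuous g'.
Proof.
have p2 : (2 < p)%R by have := p3; lra.
move=> t; apply: cvgM; first exact: cvg_cst.
apply: cvgM; first exact: cvg_cst.
apply: (cvg_comp (fun h => `|a| * h)%R (symspow p w)).
  by apply: cvgM; [exact: cvg_cst|exact: cvg_id].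
apply: differentiable_continuous; apply/derivable1_diffP.
by have [] := is_derive_symspow w (`|a| * t) p2.
Qed.

Let slope0 (s t : R) : (0 <= s)%R -> (s <= t)%R -> (t * g' s <= s * g' t)%R.
Proof.
move=> s0 st; rewrite /g'.
have := @symspow_slope R p w (`|a| * s) (`|a| * t) p3.
rewrite mulr_ge0// ler_wpM2l// => /(_ isT) h.
have p0 : (0 <= p)%R by have := p3; lra.
have := ler_wpM2l p0 h; nra.
Qed.

Let g'0 (t : R) : (0 <= t)%R -> (0 <= g' t)%R.
Proof.
move=> t0; rewrite /g'; apply: mulr_ge0 => //; have := p3; move=> p3'; apply: mulr_ge0; first lra.
by apply: le_trans (symspow_ge w p3 _); rewrite ?mulr_ge0// ?powR_ge0//; lra.
Qed.

(** The modulus of a random sign is the constant 1. Its tail is 1 up to the point 1 and 0 beyond, so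
    the tail of [|X|] crosses it there and [single_crossing_le] applies with [t0 = 1]. *)
Lemma conv_abs_powR_ge : (sympow p w a)%:E <= \int[P]_t (`|w + a * X t| `^ p)%:E.
Proof.
rewrite sympow_integral -(sympow_norm p w a).
rewrite -[X in _%:E <= X](_ : \int[P]_t (g `|X t|)%:E = _)//.
have -> : (sympow p w `|a|)%:E = \int[P]_t (g (cst 1%R t))%:E.
  by rewrite (integral_cst P measurableT (g 1%R)%:E) [X in _ * X](@probability_setT _ _ _ P) mule1 /g mulr1.
apply: (@single_crossing_le R _ _ P (cst 1%R) _ _ P (fun w => `|X w|%R) g g' 1%R) => //.
- exact: sympow_ge0.
- move=> t /andP[t0 t1]; apply: le_measure; rewrite ?inE.
  + exact: (measurable_ge t mabsX).
  + exact: (measurable_ge t (@measurable_cst _ _ _ _ _ (1%R : R))).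
  + by move=> u _ /=; exact: ltW.
- move=> t t1; rewrite [X in P X](_ : _ = set0) ?measure0//.
  by apply/seteqP; split => // u /=; rewrite leNgt t1.
- rewrite absX_moment2 (integral_cst P measurableT ((1%R : R) ^+ 2)%:E).
  by rewrite [X in _ * X](@probability_setT _ _ _ P) mule1 expr1n.
- by rewrite absX_moment2 ltry.
Qed.

Hypothesis lcX : log_concave_tails X.

(** The set [A] where the tail of [|X|] is above the exponential is an initial segment, by
    log-concavity between 0 and a point of [A]. It is bounded because the second moments are 1 and
    [k ^ 2 > 1]; its supremum is the crossing point. *)
Lemma log_concave_expo_crossing (k : R) : (1 < k)%R -> exists2 t0 : R, (0 <= t0)%R &
  (forall t : R, (0 <= t < t0)%R -> (expR (- (Num.sqrt 2 / k * t)))%:E <= P [set w | t <= `|X w|]%R) /\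
  (forall t : R, (t0 < t)%R -> P [set w | t <= `|X w|]%R <= (expR (- (Num.sqrt 2 / k * t)))%:E).
Proof.
move=> k1; set lam := (Num.sqrt 2 / k)%R.
have lam0 : (0 < lam)%R by rewrite divr_gt0 ?sqrtr_gt0//; lra.
pose E (t : R) := (expR (- (lam * t)))%:E.
pose TX (t : R) := P [set w | t <= `|X w|]%R.
have E_itv t : E t \in `[0, +oo] by rewrite in_itv/= lee_fin expR_ge0 leey.
have TX_itv t : TX t \in `[0, +oo] by rewrite in_itv/= measure_ge0 leey.
have lneE t : lne (E t) = (- (lam * t))%:E by rewrite lne_EFin ?expR_gt0// expRK.
have TX0 : TX 0%R = 1.
  rewrite -(@probability_setT _ _ _ P); congr (P _).
  by apply/seteqP; split => // u _ /=.
pose A := [set t : R | (0 <= t)%R /\ E t <= TX t].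
have A0 : A 0%R by split => //; rewrite TX0 /E mulr0 oppr0 expR0.
have down u t : A t -> (0 <= u <= t)%R -> A u.
  move=> [t0 Et] /andP[u0 ut]; split => //.
  have [tz|tn0] := eqVneq t 0%R.
    have -> : u = 0%R by apply/le_anti; rewrite u0 andbT -tz.
    by case: A0.
  have tp : (0 < t)%R by rewrite lt_neqAle eq_sym tn0.
  (* The second point is 0, where the logarithm of the tail is 0: only [u / t] times its value at
     [t] remains. *)
  have := @lcX t 0%R (u / t)%R t0 (lexx _); rewrite divr_ge0//= ler_pdivrMr// mul1r ut => /(_ isT).
  rewrite /log_tail -/(TX t) -/(TX 0%R) TX0 lne1 mule0 adde0 mulr0 addr0 divfK// -/(TX u) => h.
  rewrite -lee_lne// lneE; apply: le_trans h.
  have -> : (- (lam * u))%:E = (u / t)%:E * (- (lam * t))%:E by rewrite -EFinM; congr (_%:E); field.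
  by rewrite lee_wpmul2l ?lee_fin ?divr_ge0// -lneE lee_lne.
have [bA|nbA] := pselect (has_ubound A); last first.
  (* Otherwise the tail of [|X|] dominates everywhere, and the layer-cake formula for the square
     gives [k ^ 2 <= 1]. *)
  exfalso.
  have allA t : (0 <= t)%R -> A t.
    move=> t0; have [u [Au tu]] : exists u, A u /\ (t <= u)%R.
      apply: contrapT => h; apply: nbA; exists t => u Au.
      by rewrite leNgt; apply/negP => tu; apply: h; exists u; split => //; exact: ltW.
    by apply: down Au _; rewrite t0.
  have k0 : (0 < k)%R by lra.
  have : \int[NE]_z (laplace_abs k z ^+ 2)%:E <= \int[P]_w (`|X w| ^+ 2)%:E.
    have dsq (t : R) : is_derive t (1%R : R) (fun t : R => t ^+ 2)%R (2 * t)%R.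
      by apply: is_derive_eq; rewrite /GRing.scale/=; ring.
    have csq : continuous (fun t : R => 2 * t)%R.
      by move=> t; apply: cvgM; [exact: cvg_cst|exact: cvg_id].
    rewrite (@ge0_integral_layer _ _ _ NE (laplace_abs k) (fun t => t ^+ 2)%R (fun t => 2 * t)%R)//; last 3 first.
    - exact: measurable_laplace_abs.
    - by move=> z; apply: laplace_abs_ge0; exact: ltW.
    - by move=> t t0; rewrite mulr_ge0.
    rewrite (@ge0_integral_layer _ _ _ P (fun w => `|X w|%R) (fun t => t ^+ 2)%R (fun t => 2 * t)%R)//; last first.
      by move=> t t0; rewrite mulr_ge0.
    apply: leeD => //.
    have mI : measurable (`[0%R, +oo[ : set R) by exact: measurable_itv.
    have I0 (x : R) : `[0%R, +oo[%classic x -> (0 <= x)%R by rewrite /= in_itv/= andbT.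
    have msq : measurable_fun (`[0%R, +oo[ : set R) (fun t : R => (2 * t)%:E).
      by apply: measurable_funTS; apply/measurable_EFinP; exact: measurable_funM.
    apply: ge0_le_integral => //.
    - by move=> t /I0 t0; rewrite mule_ge0// lee_fin mulr_ge0.
    - apply: emeasurable_funM => //; apply: measurable_tail; exact: measurable_laplace_abs.
    - apply: emeasurable_funM => //; exact: measurable_tail.
    move=> t /I0 t0; rewrite lee_wpmul2l ?lee_fin ?mulr_ge0//.
    have [_] := allA t t0; apply: le_trans; rewrite le_eqVlt; apply/orP; left; apply/eqP.
    exact: laplace_abs_tail.
  rewrite laplace_abs_moment2 absX_moment2 lee_fin; nra.
exists (sup A); first by apply: ub_le_sup.
split.
- move=> t /andP[t0 tA].
  have hA : has_sup A by split => //; exists 0%R.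
  have e0 : (0 < sup A - t)%R by rewrite subr_gt0.
  have [u Au] := sup_adherent e0 hA.
  rewrite opprB addrC subrK => tu.
  by have [] : A t by apply: down Au _; rewrite t0 ltW.
- move=> t tA; have t0 : (0 <= t)%R.
    by apply: le_trans (ltW tA); apply: ub_le_sup.
  rewrite leNgt; apply/negP => h.
  have : A t by split => //; exact: ltW.
  by move=> At; have := ub_le_sup bA At; rewrite leNgt tA.
Qed.

(** Single crossing against [laplace_abs k]; the symmetry of the Gaussian then undoes the
    symmetrization for each fixed [r]. *)
Lemma conv_abs_powR_le (k : R) : (1 < k)%R ->
  \int[P]_t (`|w + a * X t| `^ p)%:E <=
  \int[expo]_r \int[N]_x (`|w + a * k * Num.sqrt r * x| `^ p)%:E.
Proof.
move=> k1; have k0 : (0 < k)%R by lra.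
have [t0 t00 [below above]] := log_concave_expo_crossing k1.
rewrite sympow_integral.
apply: (@le_trans _ _ (\int[NE]_z (g (laplace_abs k z))%:E)).
  apply: (@single_crossing_le R _ _ P (fun w => `|X w|%R) _ _ NE (laplace_abs k) g g' t0) => //.
  - exact: measurable_laplace_abs.
  - by move=> z; apply: laplace_abs_ge0; exact: ltW.
  - exact: sympow_ge0.
  - move=> t tt0; rewrite [X in X <= _](_ : _ = (expR (- (Num.sqrt 2 / k * t)))%:E); first exact: below.
    by apply: laplace_abs_tail => //; case/andP: tt0.
  - move=> t tt0; rewrite [X in _ <= X](_ : _ = (expR (- (Num.sqrt 2 / k * t)))%:E); first exact: above.
    by apply: laplace_abs_tail => //; apply: ltW; exact: le_lt_trans tt0.
  - by rewrite laplace_abs_moment2 absX_moment2 lee_fin; nra.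
  - by rewrite laplace_abs_moment2 ltry.
rewrite ge0_integral_prod_comm; last 2 first.
- rewrite /g /sympow; apply: measurable_funM => //.
  have mY : measurable_fun [set: R * R] (fun z => `|a| * laplace_abs k z)%R.
    by apply: measurable_funM => //; exact: measurable_laplace_abs.
  by apply: measurable_funD; apply: (measurableT_comp (@measurable_absr_powR R p));
    [apply: measurable_funD|apply: measurable_funB].
- by move=> z; exact: sympow_ge0.
rewrite le_eqVlt; apply/orP; left; apply/eqP; apply: eq_integral => r _.
rewrite -sympow_integral_normal; apply: eq_integral => x _; congr (_%:E).
rewrite /g /laplace_abs/=.
rewrite -(sympow_norm p w (a * k * _ * _)) !normrM normr_id (gtr0_norm k0) (ger0_norm (sqrtr_ge0 _)).
by rewrite !mulrA.
Qed.

End Crossing.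
End OneStep.

(** * Sums of random signs *)

Section Rademacher.
Context {R : realType}.
Implicit Types (l : seq R) (f g : R -> R) (s a p : R).

(* [E f (s + \sum_(a <- l) eps_a * a)] for independent random signs. *)
Fixpoint sign_avg l f s : R :=
  if l is a :: l' then (sign_avg l' f (s + a) + sign_avg l' f (s - a)) / 2 else f s.

Lemma sign_avg_le l f g s : (forall x, f x <= g x) -> sign_avg l f s <= sign_avg l g s.
Proof.
move=> fg; elim: l s => [|a l IH] s //=.
by have := IH (s + a); have := IH (s - a); lra.
Qed.

Lemma sign_avgZ l c f s : sign_avg l (fun x => c * f x) s = c * sign_avg l f s.
Proof. by elim: l s => [|a l IH] s //=; rewrite !IH; field. Qed.

Lemma sign_avg_shift l f s a :
  (sign_avg l f (s + a) - sign_avg l f (s - a)) / 2 = sign_avg l (fun x => (f (x + a) - f (x - a)) / 2) s.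
Proof.
elim: l s => [|b l IH] s //=; rewrite -!IH.
rewrite (addrAC s a b) (addrAC s (- a) b) (addrAC s a (- b)) (addrAC s (- a) (- b)).
by field.
Qed.

(* Gaussian integration by parts for random signs: symmetrizing in the [i]-th
   sign, [eps * g (w + eps * a)] averages to [symspow p w a] for [g x = x * |x| ^ (p - 2)]. *)
Lemma sign_avg_powR_rec p l s : 3 <= p ->
  s * sign_avg l (fun x => x * `|x| `^ (p - 2)) s +
  (p - 1) * \sum_(i < size l) l`_i ^+ 2 *
     sign_avg (take i l ++ drop i.+1 l) (fun x => `|x| `^ (p - 2)) s <=
  sign_avg l (fun x => `|x| `^ p) s.
Proof.
move=> p3; elim: l s => [|a l IH] s /=.
  rewrite big_ord0 mulr0 addr0 mulrA -expr2.
  have [->|s0] := eqVneq s 0; first by rewrite expr0n mul0r normr0 powR_ge0.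
  rewrite -(real_normK (num_real s)) -powR_mulrn// -powRD ?(addrC 2) ?subrK//.
  by rewrite normr_eq0 s0 implybT.
set f := fun x => x * `|x| `^ (p - 2); set q := fun x => `|x| `^ (p - 2).
rewrite big_ord_recl /= drop0.
set S := \sum_(i < size l) _.
pose D t := \sum_(i < size l) l`_i ^+ 2 * sign_avg (take i l ++ drop i.+1 l) q t.
have SE : S = (D (s + a) + D (s - a)) / 2.
  rewrite /S /D -big_split/= mulr_suml; apply: eq_bigr => i _.
  by rewrite add0n /bump leq0n add1n; field.
have h1 := IH (s + a); have h2 := IH (s - a).
rewrite -/f -/q -/(D (s + a)) in h1; rewrite -/f -/q -/(D (s - a)) in h2.
have h3 : (p - 1) * (a ^+ 2 * sign_avg l q s) <= a * ((sign_avg l f (s + a) - sign_avg l f (s - a)) / 2).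
  rewrite sign_avg_shift -!sign_avgZ; apply: sign_avg_le => x.
  by have := mul_symspow_ge x a p3; rewrite mulrAC -mulrA.
rewrite SE; lra.
Qed.

Lemma sum_sqr_deletion l (i : nat) : (i < size l)%N ->
  \sum_(a <- take i l ++ drop i.+1 l) a ^+ 2 = \sum_(a <- l) a ^+ 2 - l`_i ^+ 2.
Proof.
move=> il; rewrite -[X in _ = \sum_(a <- X) _ - _](cat_take_drop i l) !big_cat/= (drop_nth 0 il) big_cons.
by ring.
Qed.

Local Notation N := (@normal_prob R 0 1).

(** Parametrized by the variance [v], so that merging independent Gaussians is addition of
    parameters. *)
Definition gauss_shift r v s : \bar R := (\int[N]_x (`|s + Num.sqrt v * x| `^ r)%:E)%E.

(** * Exchanging random signs for Gaussian variables *)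

Section Lindeberg.
Local Open Scope ereal_scope.
(** The fourth-order coefficient is bounded by a quadratic [al + be * w ^ 2], because its Gaussian
    mean is explicit and stays of the same form along the exchange. *)
Variables (r al be : R).
Hypotheses (r3 : (3 <= r)%R) (al0 : (0 <= al)%R) (be0 : (0 <= be)%R).
Hypothesis sympow_upper : forall w h : R, (sympow r w h <=
  `|w| `^ r + r * (r - 1) / 2 * `|w| `^ (r - 2) * h ^+ 2
    + (al + be * w ^+ 2) * h ^+ 4 + `|h| `^ r)%R.

Let m : R := fine (gauss_moment r).

Let mE : m%:E = gauss_moment r.
Proof. by rewrite fineK// gauss_moment_fin_num//; have := r3; lra. Qed.

Lemma integral_normal_abs_poly (c0 c2 c4 cr : R) :
  (0 <= c0)%R -> (0 <= c2)%R -> (0 <= c4)%R -> (0 <= cr)%R ->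
  \int[N]_x (c0 + c2 * `|x| `^ 2 + c4 * `|x| `^ 4 + cr * `|x| `^ r)%:E =
  (c0 + c2 + c4 * 3 + cr * m)%:E.
Proof.
move=> c00 c20 c40 cr0.
have mp (c p : R) : measurable_fun [set: R] (fun x : R => (c * `|x| `^ p)%:E).
  by apply/measurable_EFinP; apply: measurable_funM => //; exact: measurable_absr_powR.
have p0 (c p : R) : (0 <= c)%R -> forall x : R, [set: R] x -> 0 <= (c * `|x| `^ p)%:E.
  by move=> ? x _; rewrite lee_fin mulr_ge0// powR_ge0.
have ip (c p : R) : (0 <= c)%R -> \int[N]_x (c * `|x| `^ p)%:E = c%:E * gauss_moment p.
  move=> ?; under eq_integral do rewrite EFinM.
  rewrite ge0_integralZl//=.
  by apply/measurable_EFinP; exact: measurable_absr_powR.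
under eq_integral do rewrite !EFinD.
rewrite ge0_integralD//=; last 4 first.
- by move=> x _; rewrite -!EFinD lee_fin !addr_ge0// mulr_ge0// powR_ge0.
- apply: emeasurable_funD; last exact: mp.
  by apply: emeasurable_funD; [exact: measurable_cst|exact: mp].
- exact: p0.
- exact: mp.
rewrite ge0_integralD//=; last 4 first.
- by move=> x _; rewrite -!EFinD lee_fin !addr_ge0// mulr_ge0// powR_ge0.
- by apply: emeasurable_funD; [exact: measurable_cst|exact: mp].
- exact: p0.
- exact: mp.
rewrite ge0_integralD//=; last 2 first.
- exact: p0.
- exact: mp.
rewrite !ip// gauss_moment2 gauss_moment4 -mE integral_normal_cst mule1.
by rewrite -!EFinM -!EFinD.
Qed.

(** A sign and a Gaussian have the same second moment, so their Taylor terms up to order two agree: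
    average the upper expansion over the Gaussian and compare with [sympow_taylor_ge] for the sign.
    The factor 3 is the fourth Gaussian moment. *)
Lemma integral_normal_sympow_le (w a : R) :
  \int[N]_x (`|w + a * x| `^ r)%:E <=
  (sympow r w a + `|a| `^ r * m + 3 * a ^+ 4 * (al + be * w ^+ 2))%:E.
Proof.
have c0 : (0 <= r * (r - 1) / 2 * `|w| `^ (r - 2) * a ^+ 2)%R.
  by rewrite mulr_ge0 ?sqr_ge0// mulr_ge0 ?powR_ge0// mulr_ge0//; have := r3; nra.
have d0 : (0 <= al + be * w ^+ 2)%R by rewrite addr_ge0// mulr_ge0// sqr_ge0.
have a40 : (0 <= a ^+ 4)%R by rewrite exprn_even_ge0.
rewrite -sympow_integral_normal.
apply: (@le_trans _ _ (\int[N]_x (`|w| `^ r + r * (r - 1) / 2 * `|w| `^ (r - 2) * a ^+ 2 * `|x| `^ 2 +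
   ((al + be * w ^+ 2) * a ^+ 4) * `|x| `^ 4 + `|a| `^ r * `|x| `^ r)%:E)).
  apply: ge0_le_integral => //.
  - by move=> x _; rewrite lee_fin sympow_ge0.
  - apply/measurable_EFinP; rewrite /sympow; apply: measurable_funM => //.
    by apply: measurable_funD; apply: (measurableT_comp (@measurable_absr_powR R r));
      [apply: measurable_funD|apply: measurable_funB] => //; apply: measurable_funM => //;
      exact: measurableT_comp.
  - apply/measurable_EFinP.
    by repeat (apply: measurable_funD => //); apply: measurable_funM => //; exact: measurable_absr_powR.
  - move=> x _; rewrite lee_fin; apply: le_trans (sympow_upper _ _) _.
    rewrite !exprMn real_normK ?num_real// normrM normr_id powRM//.
    rewrite le_eqVlt; apply/orP; left; apply/eqP.
    rewrite !powR_mulrn// real_normK ?num_real//; ring.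
rewrite (integral_normal_abs_poly (powR_ge0 _ _) c0 (mulr_ge0 d0 a40) (powR_ge0 _ _)) lee_fin.
have := sympow_taylor_ge w a r3; lra.
Qed.

Lemma integral_normal_sqr_shift (v s : R) : (0 <= v)%R ->
  \int[N]_x ((s + Num.sqrt v * x) ^+ 2)%:E = (s ^+ 2 + v)%:E.
Proof.
move=> v0.
transitivity (\int[N]_x (`|s + Num.sqrt v * x| `^ 2)%:E).
  by apply: eq_integral => x _; rewrite powR_mulrn// real_normK// num_real.
rewrite -sympow_integral_normal.
transitivity (\int[N]_x (s ^+ 2 + v * `|x| `^ 2 + 0 * `|x| `^ 4 + 0 * `|x| `^ r)%:E).
  apply: eq_integral => x _; congr (_%:E); rewrite /sympow !powR_mulrn// !real_normK ?num_real//.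
  rewrite !mul0r !addr0 -[in RHS](sqr_sqrtr v0).
  by rewrite -[in RHS](real_normK (num_real x)); field.
by rewrite integral_normal_abs_poly ?sqr_ge0// !mul0r !addr0.
Qed.

Lemma measurable_gauss_shift (v s : R) :
  measurable_fun [set: R] (fun x : R => (`|s + Num.sqrt v * x| `^ r)%R).
Proof. exact: measurable_shift_absr_powR. Qed.

(** Split the Gaussian of variance [v + a ^ 2] into independent parts, and exchange the part [a x]
    for a sign at the point [s + sqrt v * y]. The mean of the squared point is [s ^ 2 + v]. *)
Lemma gauss_shift_step (v a s : R) : (0 <= v)%R ->
  gauss_shift r (v + a ^+ 2) s <=
  (2^-1)%:E * (gauss_shift r v (s + a) + gauss_shift r v (s - a)) +
  (`|a| `^ r * m + 3 * a ^+ 4 * (al + be * (s ^+ 2 + v)))%:E.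
Proof.
move=> v0.
have a40 : (0 <= a ^+ 4)%R by rewrite exprn_even_ge0.
have m0 : (0 <= m)%R by rewrite fine_ge0// gauss_moment_ge0.
pose F (x : R) : \bar R := (`|s + x| `^ r)%:E.
have mF : measurable_fun [set: R] F.
  by apply/measurable_EFinP; apply: (measurableT_comp (@measurable_absr_powR R r)); exact: measurable_funD.
have F0 x : 0 <= F x by rewrite lee_fin powR_ge0.
have := @normal_stable R a (Num.sqrt v) F mF F0.
rewrite sqr_sqrtr// (addrC (a ^+ 2)%R) /F -/(gauss_shift r (v + a ^+ 2) s) => <-.
have K0 : (0 <= `|a| `^ r * m + 3 * a ^+ 4 * al)%R.
  by apply: addr_ge0; apply: mulr_ge0 => //; exact: mulr_ge0.
have L0 : (0 <= 3 * a ^+ 4 * be)%R by apply: mulr_ge0 => //; exact: mulr_ge0.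
have mu1 (s' : R) : measurable_fun [set: R] (fun x : R => (`|s' + Num.sqrt v * x| `^ r)%:E).
  by apply/measurable_EFinP; exact: measurable_gauss_shift.
have mw : measurable_fun [set: R] (fun y : R => s + Num.sqrt v * y)%R.
  by apply: measurable_funD => //; exact: measurable_funM.
have mw2 : measurable_fun [set: R] (fun y : R => ((s + Num.sqrt v * y) ^+ 2)%:E).
  by apply/measurable_EFinP; exact: measurable_funX.
apply: (@le_trans _ _ (\int[N]_y ((2^-1)%:E * ((`|s + a + Num.sqrt v * y| `^ r)%:E +
   (`|s - a + Num.sqrt v * y| `^ r)%:E) + ((`|a| `^ r * m + 3 * a ^+ 4 * al)%:E +
   (3 * a ^+ 4 * be)%:E * ((s + Num.sqrt v * y) ^+ 2)%:E)))).
  apply: ge0_le_integral => //.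
  - by move=> y _; apply: integral_ge0 => x _; rewrite lee_fin powR_ge0.
  - apply: (@measurable_fun_fubini_tonelli_G _ _ _ _ _ N
      (fun z => (`|s + (a * z.1 + Num.sqrt v * z.2)| `^ r)%:E)) => //.
    apply/measurable_EFinP; apply: (measurableT_comp (@measurable_absr_powR R r)).
    by apply: measurable_funD => //; apply: measurable_funD; apply: measurable_funM.
  - apply: emeasurable_funD.
      by apply: measurable_funeM; apply: emeasurable_funD; exact: mu1.
    by apply: emeasurable_funD => //; exact: measurable_funeM.
  - move=> y _; have := integral_normal_sympow_le (s + Num.sqrt v * y) a.
    under eq_integral => x _ do rewrite -addrA (addrC (Num.sqrt v * y)%R).
    move=> /le_trans; apply.
    have finE (x1 x2 z1 z2 z3 : R) : (2^-1)%:E * (x1%:E + x2%:E) + (z1%:E + z2%:E * z3%:E) =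
      (2^-1 * (x1 + x2) + (z1 + z2 * z3))%:E by [].
    rewrite finE lee_fin /sympow.
    rewrite (_ : s + Num.sqrt v * y + a = s + a + Num.sqrt v * y)%R; last by ring.
    rewrite (_ : s + Num.sqrt v * y - a = s - a + Num.sqrt v * y)%R; last by ring.
    lra.
rewrite ge0_integralD//=; last 4 first.
- by move=> y _; rewrite mule_ge0// ?lee_fin ?invr_ge0// adde_ge0// lee_fin powR_ge0.
- by apply: measurable_funeM; apply: emeasurable_funD; exact: mu1.
- by move=> y _; rewrite adde_ge0 ?lee_fin// mulr_ge0// sqr_ge0.
- by apply: emeasurable_funD => //; exact: measurable_funeM.
apply: leeD.
  rewrite ge0_integralZl//=; last 2 first.
  - by apply: emeasurable_funD; exact: mu1.
  - by move=> y _; rewrite adde_ge0// lee_fin powR_ge0.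
  by rewrite ge0_integralD//=; exact: mu1.
rewrite ge0_integralD//=; last 2 first.
- by move=> y _; rewrite lee_fin mulr_ge0// sqr_ge0.
- exact: measurable_funeM.
rewrite integral_normal_cst ge0_integralZl//=; last 1 first.
- by move=> y _; rewrite lee_fin sqr_ge0.
rewrite integral_normal_sqr_shift// -EFinM -EFinD lee_fin; lra.
Qed.

Let half_fin (x y z : R) :
  (2^-1)%:E * (x%:E + y%:E) + z%:E = (2^-1 * (x + y) + z)%:E.
Proof. by []. Qed.

(** The recursive calls start from [s + a] and [s - a], whose squares average to [s ^ 2 + a ^ 2];
    thus [s ^ 2] plus the remaining sum of squares is constant along the induction. *)
Lemma gauss_sign_avg_le (l : seq R) (s : R) :
  gauss_shift r (\sum_(a <- l) a ^+ 2) s <=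
  (sign_avg l (fun x => `|x| `^ r) s + m * \sum_(a <- l) `|a| `^ r +
   3 * (al + be * (s ^+ 2 + \sum_(a <- l) a ^+ 2)) * \sum_(a <- l) a ^+ 4)%:E.
Proof.
elim: l s => [|a l IH] s.
  rewrite !big_nil /gauss_shift sqrtr0 /=.
  under eq_integral do rewrite mul0r addr0.
  by rewrite integral_normal_cst lee_fin; lra.
have v0 : (0 <= \sum_(a <- l) a ^+ 2)%R by apply: sumr_ge0 => b _; exact: sqr_ge0.
have q0 : (0 <= \sum_(a <- l) a ^+ 4)%R by apply: sumr_ge0 => b _; exact: exprn_even_ge0.
have a40 : (0 <= a ^+ 4)%R by rewrite exprn_even_ge0.
rewrite !big_cons addrC; apply: le_trans (gauss_shift_step a s v0) _.
have h : (0 <= (2^-1 : R)%:E) by rewrite lee_fin invr_ge0.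
apply: le_trans (leeD2r _ (lee_wpmul2l h (leeD (IH (s + a)%R) (IH (s - a)%R)))) _.
rewrite half_fin lee_fin /=.
set q := (\sum_(j <- l) j ^+ 4)%R in q0 *; set v := (\sum_(j <- l) j ^+ 2)%R in v0 *.
set T := (\sum_(j <- l) `|j| `^ r)%R.
have : (0 <= 3 * be * a ^+ 2 * a ^+ 4)%R by apply: mulr_ge0 => //; apply: mulr_ge0; [exact: mulr_ge0|exact: sqr_ge0].
set A4 := (a ^+ 4)%R; set A2 := (a ^+ 2)%R.
have -> : ((s + a) ^+ 2 = s ^+ 2 + 2 * s * a + A2)%R by rewrite /A2; ring.
have -> : ((s - a) ^+ 2 = s ^+ 2 - 2 * s * a + A2)%R by rewrite /A2; ring.
lra.
Qed.

End Lindeberg.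

Lemma gauss_shift_scale r v : 0 <= v ->
  gauss_shift r v 0 = ((Num.sqrt v `^ r)%:E * gauss_moment r)%E.
Proof.
move=> v0; rewrite /gauss_shift -ge0_integralZl//=.
- apply: eq_integral => x _.
  by rewrite add0r normrM powRM// (ger0_norm (sqrtr_ge0 v)) EFinM.
- by apply/measurable_EFinP; exact: measurable_absr_powR.
Qed.

Lemma ler_sqrtr_sqr (x y : R) : x ^+ 2 <= y -> x <= Num.sqrt y.
Proof. by move=> h; apply: le_trans (ler_norm x) _; rewrite -sqrtr_sqr ler_wsqrtr. Qed.

(** Finds [al] and [be] for which the total exchange error is at most
    [gamma_r ^ r * sqrt r * A * S ^ (r - 1)]. Up to [r = 4] no fourth-order term is needed. *)
Lemma lindeberg_remainder r A S : 3 <= r < 5 -> 0 < A -> Num.sqrt r * A <= S ->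
  exists al be, [/\ 0 <= al, 0 <= be,
    forall w h : R, sympow r w h <=
      `|w| `^ r + r * (r - 1) / 2 * `|w| `^ (r - 2) * h ^+ 2
       + (al + be * w ^+ 2) * h ^+ 4 + `|h| `^ r &
    fine (gauss_moment r) * (A `^ (r - 2) * S ^+ 2) +
      3 * (al + be * S ^+ 2) * (A ^+ 2 * S ^+ 2) <=
    fine (gauss_moment r) * (Num.sqrt r * A * S `^ (r - 1))].
Proof.
move=> /andP[r3 r5] A0 AS; set m := fine _.
have r0 : 0 <= r by lra.
have q1 : 1 <= Num.sqrt r by rewrite -(@sqrtr1 R) ler_wsqrtr; lra.
have qr : Num.sqrt r ^+ 2 = r by rewrite sqr_sqrtr.
have AS' : A <= S by nra.
have S0 : 0 < S by lra.
have mE : m%:E = gauss_moment r by rewrite fineK// gauss_moment_fin_num.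
have m1 : 1 <= m by rewrite -lee_fin mE gauss_moment_ge1//; lra.
have monoA q : 0 <= q -> A `^ q <= S `^ q by move=> q0; apply: ge0_ler_powR; rewrite ?nnegrE; lra.
have [r4|r4] := leP r 4.
  exists 0, 0; split => //.
    by move=> w h; rewrite mul0r addr0 mul0r addr0; apply: sympow_le4; lra.
  rewrite mul0r addr0 mulr0 mul0r addr0 ler_wpM2l//; first by lra.
  rewrite (_ : r - 2 = 1 + (r - 3)); last by ring.
  rewrite (_ : r - 1 = 2 + (r - 3)); last by ring.
  rewrite (@powRD_gt0 R A 1 (r - 3) A0) (@powRD_gt0 R S 2 (r - 3) S0).
  rewrite powRr1 ?(ltW A0)// powR_mulrn ?(ltW S0)//.
  have h := monoA (r - 3) ltac:(lra).
  have a0 := powR_ge0 A (r - 3).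
  rewrite (_ : A * A `^ (r - 3) * S ^+ 2 = A `^ (r - 3) * (A * S ^+ 2)); last by ring.
  apply: le_trans (_ : S `^ (r - 3) * (A * S ^+ 2) <= _).
    by rewrite ler_wpM2r// mulr_ge0 ?sqr_ge0// ltW.
  rewrite (_ : Num.sqrt r * A * _ = Num.sqrt r * (S `^ (r - 3) * (A * S ^+ 2))); last by ring.
  by rewrite ler_peMl// mulr_ge0 ?powR_ge0// mulr_ge0 ?sqr_ge0// ltW.
pose C := r * (r - 1) * (r - 2) * (r - 3) / 24.
have C0 : 0 <= C by rewrite /C !mulr_ge0//; lra.
pose q := (r - 4) / 2.
have q01 : 0 < q <= 1 by rewrite /q; lra.
have S20 : 0 < S ^+ 2 by rewrite exprn_gt0.
have T0 := powR_ge0 S (r - 4).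
(* The coefficients of the tangent to [u ^ q] at [u = S ^ 2], with [u = w ^ 2]. The error bound
   evaluates the quadratic at [S ^ 2], so the tangent loses nothing there. *)
exists (C * S `^ (r - 4) * (1 - q)), (C * S `^ (r - 4) * q / S ^+ 2); split.
- by rewrite mulr_ge0 ?mulr_ge0//; lra.
- by rewrite mulr_ge0 ?invr_ge0 ?sqr_ge0// mulr_ge0 ?mulr_ge0//; lra.
- move=> w h; have r46 : 4 < r <= 6 by lra.
  apply: le_trans (sympow_le6 w h r46) _; rewrite lerD2r lerD2l -/C.
  rewrite ler_wpM2r ?exprn_even_ge0//.
  have e (x : R) : `|x| `^ (r - 4) = (x ^+ 2) `^ q.
    rewrite -(real_normK (num_real x)) -powR_mulrn// -powRrM.
    by congr (_ `^ _); rewrite /q; field.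
  have := powR_le_tangent q01 (sqr_ge0 w) S20.
  rewrite -!e (gtr0_norm S0) => /(ler_wpM2l C0) h1; apply: le_trans h1 _.
  by rewrite le_eqVlt; apply/orP; left; apply/eqP; field; lra.
rewrite (_ : _ + _ / _ * _ = C * S `^ (r - 4)); last by field; lra.
rewrite (_ : r - 2 = 2 + (r - 4)); last by ring.
rewrite (_ : r - 1 = 3 + (r - 4)); last by ring.
rewrite (@powRD_gt0 R A 2 (r - 4) A0) (@powRD_gt0 R S 3 (r - 4) S0).
rewrite !powR_mulrn ?(ltW A0) ?(ltW S0)//.
have h := monoA (r - 4) ltac:(lra).
have mr : r - 1 <= m.
  rewrite -lee_fin mE gauss_moment_rec; last by lra.
  rewrite -[X in (X <= _)%E]mule1; apply: lee_wpmul2l; first by rewrite lee_fin; lra.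
  by apply: gauss_moment_ge1; lra.
have mC : m + 3 * C <= m * r.
  have : r * (r - 2) * (r - 3) <= 8 * (r - 1) by nra.
  move=> hr; have : 3 * C <= (r - 1) * (r - 1).
    rewrite (_ : 3 * C = (r - 1) * (r * (r - 2) * (r - 3) / 8)); last by rewrite /C; field.
    by apply: ler_wpM2l; lra.
  have : (r - 1) * (r - 1) <= m * (r - 1) by apply: ler_wpM2r; lra.
  lra.
apply: le_trans (_ : S `^ (r - 4) * (A * S ^+ 2) * ((m + 3 * C) * A) <= _).
  have : A `^ (r - 4) * (m * (A ^+ 2 * S ^+ 2)) <= S `^ (r - 4) * (m * (A ^+ 2 * S ^+ 2)).
    by rewrite ler_wpM2r// !mulr_ge0 ?sqr_ge0//; lra.
  lra.
rewrite (_ : m * _ = S `^ (r - 4) * (A * S ^+ 2) * (m * Num.sqrt r * S)); last by ring.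
apply: ler_wpM2l; first by rewrite !mulr_ge0 ?sqr_ge0// ltW.
apply: le_trans (_ : m * r * A <= _); first by apply: ler_wpM2r => //; exact: ltW.
rewrite -{1}qr (_ : m * _ * A = m * Num.sqrt r * (Num.sqrt r * A)); last by ring.
by apply: ler_wpM2l => //; apply: mulr_ge0; lra.
Qed.

Let norm2 l := Num.sqrt (\sum_(a <- l) a ^+ 2).

Let sum_sqr_ge0 l : 0 <= \sum_(a <- l) a ^+ 2.
Proof. by apply: sumr_ge0 => a _; exact: sqr_ge0. Qed.

Lemma sign_avg_powR_ge_base r A l : 3 <= r < 5 -> 0 < A ->
  (forall a, a \in l -> `|a| <= A) -> Num.sqrt r * A <= norm2 l ->
  fine (gauss_moment r) * (norm2 l - Num.sqrt r * A) `^ r <=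
  sign_avg l (fun x => `|x| `^ r) 0.
Proof.
move=> r35 A0 lA AS; have /andP[r3 r5] := r35.
set m := fine _; set S := norm2 l.
have S2 : S ^+ 2 = \sum_(a <- l) a ^+ 2 by rewrite /S sqr_sqrtr.
have [al [be [al0 be0 up rem]]] := lindeberg_remainder r35 A0 AS.
have m0 : 0 <= m by rewrite fine_ge0// gauss_moment_ge0.
have mE : m%:E = gauss_moment r by rewrite fineK// gauss_moment_fin_num//; lra.
have q0 : 0 < Num.sqrt r by rewrite sqrtr_gt0; lra.
have S0 : 0 < S by apply: lt_le_trans AS; exact: mulr_gt0.
have := gauss_sign_avg_le r3 al0 be0 up l 0.
rewrite gauss_shift_scale// -/(norm2 l) -/S -/m -mE -EFinM lee_fin -S2 expr0n add0r.
have h1 : \sum_(a <- l) `|a| `^ r <= A `^ (r - 2) * S ^+ 2.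
  rewrite S2 mulr_sumr !big_seq; apply: ler_sum => a /lA aA.
  have [->|a0] := eqVneq a 0.
    by rewrite normr0 powR0 ?expr0n ?mulr0//; apply/eqP; lra.
  rewrite {1}(_ : r = (r - 2) + 2); last by ring.
  rewrite powRD_gt0 ?normr_gt0// powR_mulrn// real_normK ?num_real//.
  by rewrite ler_wpM2r ?sqr_ge0//; apply: ge0_ler_powR; rewrite ?nnegrE//; lra.
have h2 : \sum_(a <- l) a ^+ 4 <= A ^+ 2 * S ^+ 2.
  rewrite S2 mulr_sumr !big_seq; apply: ler_sum => a /lA aA.
  rewrite (exprD a 2 2) ler_wpM2r ?sqr_ge0// -(real_normK (num_real a)).
  by rewrite ler_sqr ?nnegrE// ltW.
have k0 : 0 <= 3 * (al + be * S ^+ 2) by rewrite mulr_ge0// addr_ge0// mulr_ge0 ?sqr_ge0.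
have := ler_wpM2l m0 h1; have := ler_wpM2l k0 h2 => h3 h4 h5.
have h6 : S `^ r * m <= sign_avg l (fun x => `|x| `^ r) 0 + m * (Num.sqrt r * A * S `^ (r - 1)).
  by rewrite -/m -/S in rem; lra.
have Spow (x : R) : 0 <= x -> x `^ r = x * x `^ (r - 1).
  move=> x0; have [->|xn0] := eqVneq x 0.
    by rewrite mul0r powR0//; apply/eqP; lra.
  rewrite {1}(_ : r = 1 + (r - 1)); last by ring.
  by rewrite powRD_gt0 ?powRr1// lt_neqAle eq_sym xn0.
have D0 : 0 <= S - Num.sqrt r * A by rewrite subr_ge0.
(* Hence [(S - sqrt r * A) ^ r] is at most [(S - sqrt r * A) * S ^ (r - 1)], which is what the
   exchange error leaves of [S ^ r]. *)
have DS : (S - Num.sqrt r * A) `^ (r - 1) <= S `^ (r - 1).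
  have : 0 < Num.sqrt r * A by rewrite mulr_gt0.
  by move=> ?; apply: ge0_ler_powR; rewrite ?nnegrE; lra.
have := ler_wpM2l m0 (ler_wpM2l D0 DS).
rewrite -Spow//; rewrite Spow in h6; last exact: ltW.
lra.
Qed.

(** Each term of [sign_avg_powR_rec] is a moment of order [p - 2] of a list with one entry deleted.
    The induction hypothesis bounds them all by the same quantity, and the weights sum to
    [S ^ 2]. *)
Lemma sign_avg_powR_ge p A l : 3 <= p -> 0 < A ->
  (forall a, a \in l -> `|a| <= A) -> Num.sqrt p * A <= norm2 l ->
  fine (gauss_moment p) * (norm2 l - Num.sqrt p * A) `^ p <=
  sign_avg l (fun x => `|x| `^ p) 0.
Proof.
move=> p3 A0; have [n pn] : exists n, p < n%:R.
  by exists (Num.bound p); apply/archi_boundP; lra.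
elim: n p p3 pn l => [|n IH] p p3 pn l lA AS; first by exfalso; lra.
have [p5|p5] := ltP p 5; first by apply: sign_avg_powR_ge_base => //; rewrite p3.
set S := norm2 l in AS *.
have S2 : S ^+ 2 = \sum_(a <- l) a ^+ 2 by rewrite /S sqr_sqrtr.
have p2 : 2 <= p by lra.
pose m' := fine (gauss_moment (p - 2)).
have m'0 : 0 <= m' by rewrite fine_ge0// gauss_moment_ge0.
have mE : fine (gauss_moment p) = (p - 1) * m'.
  rewrite gauss_moment_rec// fineM//.
  by rewrite gauss_moment_fin_num//; lra.
have := @sign_avg_powR_rec p l 0 p3; rewrite mul0r add0r; apply: le_trans.
set u := Num.sqrt p; set u' := Num.sqrt (p - 2).
have u2 : u ^+ 2 = p by rewrite sqr_sqrtr//; lra.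
have u'2 : u' ^+ 2 = p - 2 by rewrite sqr_sqrtr//; lra.
have u0 : 0 <= u by exact: sqrtr_ge0.
have u'0 : 0 <= u' by exact: sqrtr_ge0.
have uu' : u' <= u by rewrite ler_wsqrtr//; lra.
have D0 : 0 <= S - u * A by rewrite subr_ge0.
have S0 : 0 <= S by rewrite /S sqrtr_ge0.
have term (i : 'I_(size l)) : m' * (S - u * A) `^ (p - 2) <=
    sign_avg (take i l ++ drop i.+1 l) (fun x => `|x| `^ (p - 2)) 0.
  set li := take i l ++ drop i.+1 l.
  have liA a : a \in li -> `|a| <= A.
    by rewrite mem_cat => /orP[/mem_take|/mem_drop]; exact: lA.
  have liS : S ^+ 2 - A ^+ 2 <= \sum_(a <- li) a ^+ 2.
    rewrite S2 sum_sqr_deletion// lerD2l lerN2 -(real_normK (num_real l`_i)).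
    have A0' := ltW A0.
    by rewrite ler_sqr ?nnegrE//; apply: lA; exact: mem_nth.
  (* Put [c = u - u']. Since [S >= u A], the left side is at most [S ^ 2 - (2 c u - c ^ 2) * A ^ 2],
     and [2 c u - c ^ 2 = u ^ 2 - u' ^ 2 = 2]. *)
  have key : (S - (u - u') * A) ^+ 2 <= S ^+ 2 - A ^+ 2.
    have : (u - u') * u * A * A <= (u - u') * S * A.
      rewrite -!mulrA ler_wpM2l ?subr_ge0// mulrA ler_wpM2r//; exact: ltW.
    have : u * u' * 2 = p + (p - 2) - (u - u') ^+ 2 by rewrite -{1}u2 -u'2; ring.
    have : (u - u') * u = p - u * u' by rewrite -u2; ring.
    set c := u - u' => e1 e2 e3; have e4 : c * u * 2 = 2 + c ^+ 2 by lra.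
    have A2 : 0 <= A * A by rewrite mulr_ge0 ?ltW.
    have : c * u * 2 * (A * A) = (2 + c ^+ 2) * (A * A) by rewrite e4.
    nra.
  have Si : S - (u - u') * A <= norm2 li by apply: ler_sqrtr_sqr; exact: le_trans liS.
  have AiS : u' * A <= norm2 li by lra.
  have n5 : p - 2 < n%:R by rewrite -natr1 in pn; lra.
  have := IH (p - 2) ltac:(lra) n5 li liA AiS; apply: le_trans.
  apply: ler_wpM2l => //; apply: ge0_ler_powR; rewrite ?nnegrE -/u'; lra.
have p10 : 0 <= p - 1 by lra.
have : (p - 1) * (S ^+ 2 * (m' * (S - u * A) `^ (p - 2))) <= (p - 1) * \sum_(i < size l) l`_i ^+ 2 *
     sign_avg (take i l ++ drop i.+1 l) (fun x => `|x| `^ (p - 2)) 0.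
  apply: ler_wpM2l => //; rewrite S2 (big_nth 0) big_mkord mulr_suml.
  by apply: ler_sum => i _; rewrite ler_wpM2l ?sqr_ge0.
apply: le_trans; rewrite mE -mulrA ler_wpM2l// mulrCA ler_wpM2l//.
have [->|D0'] := eqVneq (S - u * A) 0.
  rewrite powR0 ?mulr_ge0 ?sqr_ge0 ?powR_ge0//; apply/eqP; lra.
rewrite {1}(_ : p = 2 + (p - 2)); last by ring.
rewrite (@powRD_gt0 R _ 2 (p - 2)); last by rewrite lt_neqAle eq_sym D0'.
rewrite powR_mulrn// ler_wpM2r ?powR_ge0//.
have : 0 <= u * A by rewrite mulr_ge0// ltW.
by move=> ?; rewrite ler_sqr ?nnegrE//; lra.
Qed.

End Rademacher.

(** * Sums of independent variables *)

Section Independence.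
Context {R : realType} d (T : measurableType d) (P : probability T R).
Local Open Scope ereal_scope.
Implicit Types (U V : {RV P >-> R}).

Let measurable_pair U V : measurable_fun [set: T] (fun w => (U w, V w)).
Proof. exact: measurable_fun_pair. Qed.

(** The restriction to [E] is a measure of mass [c], hence the scaling. With [E] an event about the
    variables not yet summed, this carries independence from rectangles to all sets, so to the sum
    of [U] and [V]. *)
Lemma pair_law_scaled U V (E : set T) (mE : measurable E) (c : {nonneg R}) :
  (forall A B, measurable A -> measurable B ->
    P (U @^-1` A `&` V @^-1` B `&` E) = P (U @^-1` A) * P (V @^-1` B) * c%:num%:E) ->
  forall M : set (R * R), measurable M ->
  P ([set w | M (U w, V w)] `&` E) =
  c%:num%:E * (distribution P U \x distribution P V) M.
Proof.
move=> rect M mM.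
pose UV (w : T) : measurableTypeR R * measurableTypeR R := (U w, V w).
pose m' := measure_function_pushforward__canonical__measure_function_Measure
  (mrestr P mE) (measurable_pair U V).
transitivity (m' M) => //.
have <- := @product_measure_unique _ _ _ _ R (mscale c (distribution P U)) (distribution P V) m' _ M mM.
  rewrite /product_measure1/= ge0_integral_mscale//.
  exact: measurable_fun_xsection.
move=> A B mA mB; rewrite /m'/= /pushforward/= /mrestr/= /mscale/= /distribution/= /pushforward.
by rewrite -muleA muleC -rect.
Qed.

Lemma pair_integral U V (F : R * R -> \bar R) :
  (forall A B, measurable A -> measurable B ->
    P (U @^-1` A `&` V @^-1` B) = P (U @^-1` A) * P (V @^-1` B)) ->
  measurable_fun [set: R * R] F -> (forall z, 0 <= F z) ->
  \int[P]_w F (U w, V w) = \int[P]_w \int[P]_w' F (U w, V w').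
Proof.
move=> rect mF F0.
rewrite -(@ge0_integral_pushforward _ _ T _ R (fun w => (U w, V w)) (measurable_pair U V) P setT F)//.
transitivity (\int[(distribution P U \x distribution P V)%E]_z F z).
  apply: eq_measure_integral => M mM _; rewrite /pushforward.
  have := @pair_law_scaled U V setT measurableT (NngNum (@ler01 R)) _ M mM.
  rewrite setIT mul1e; apply => A B mA mB.
  by rewrite setIT rect// mule1.
rewrite fubini_tonelli1//.
rewrite ge0_integral_distribution//.
- apply: eq_integral => w _; rewrite /= /fubini_F ge0_integral_distribution//.
  by apply: measurableT_comp => //; exact: measurable_fun_pair.
- exact: measurable_fun_fubini_tonelli_F.
- by move=> x; apply: integral_ge0.
Qed.

Variables (n : nat) (X : 'I_n -> {RV P >-> R}) (a : 'I_n -> R).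
Hypothesis indX : independent_RVs X.

Definition psum (k : nat) (w : T) : R := (\sum_(i < n | (i < k)%N) a i * X i w)%R.

Lemma measurable_psum k : measurable_fun [set: T] (psum k).
Proof.
have -> : psum k = (fun w => \sum_(i < n) (if (i < k)%N then a i * X i w else 0))%R.
  by apply/funext => w; exact: big_mkcond.
apply: measurable_sum => i; have [_|_] := boolP (i < k)%N => //; exact: measurable_funM.
Qed.

Let psumRV k : {RV P >-> R} := mfun_Sub (mem_set (measurable_psum k)).

Lemma big_ord_ltS (V : nmodType) (F : 'I_n -> V) (i0 : 'I_n) :
  (\sum_(i < n | (i < i0.+1)%N) F i = \sum_(i < n | (i < i0)%N) F i + F i0)%R.
Proof.
rewrite (bigD1 i0)/= ?ltnSn// addrC; congr (_ + _)%R; apply: eq_bigl => i.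
by rewrite ltnS ltn_neqAle andbC.
Qed.

Lemma psum0 w : psum 0 w = 0%R.
Proof. by rewrite /psum big_pred0. Qed.

Lemma psumS (i0 : 'I_n) w : psum i0.+1 w = (psum i0 w + a i0 * X i0 w)%R.
Proof. exact: big_ord_ltS. Qed.

Let cyl (D : set 'I_n) (B : 'I_n -> set R) := \bigcap_(i in D) (X i @^-1` B i).

Let mcyl D B : (forall i, measurable (B i)) -> measurable (cyl D B).
Proof.
move=> mB; apply: fin_bigcap_measurable => // i _.
by rewrite -[X in measurable X]setTI; exact: measurable_funP.
Qed.

Let cyl_prod D B : (forall i, measurable (B i)) ->
  P (cyl D B) = \prod_(i < n) P (X i @^-1` (if i \in D then B i else setT)).
Proof.
move=> mB; rewrite -indX; last by move=> i; case: ifP.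
congr (P _); apply/seteqP; split => w h i.
  by move=> _; case: ifPn => // /set_mem; exact: h.
by move=> /mem_set iD; have := h i Logic.I; rewrite iD.
Qed.

Let cyl_indep (D : set 'I_n) B i0 A : ~ D i0 -> (forall i, measurable (B i)) -> measurable A ->
  P (X i0 @^-1` A `&` cyl D B) = P (X i0 @^-1` A) * P (cyl D B).
Proof.
move=> Di0 mB mA.
pose B' i := if i == i0 then A else B i.
have mB' i : measurable (B' i) by rewrite /B'; case: ifP.
have -> : X i0 @^-1` A `&` cyl D B = cyl (i0 |` D) B'.
  apply/seteqP; split => w.
    move=> [wA h] i; rewrite /B' => -[->|iD]; first by rewrite eqxx.
    by case: eqP => [->//|_]; exact: h.
  move=> h; split; first by have := h i0 (or_introl erefl); rewrite /B' eqxx.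
  move=> i iD; have := h i (or_intror iD); rewrite /B'.
  by case: eqP => // e; exfalso; apply: Di0; rewrite -e.
rewrite !cyl_prod// (bigD1 i0)//= [in RHS](bigD1 i0)//=.
have -> : (i0 \in D) = false by exact: memNset.
have -> : (i0 \in i0 |` D) by rewrite mem_set//; left.
rewrite preimage_setT probability_setT mul1e.
rewrite {1}/B' eqxx; congr (_ * _); apply: eq_bigr => i ii0.
rewrite /B' (negbTE ii0); congr (P (_ @^-1` _)).
have -> // : (i \in i0 |` D) = (i \in D).
apply/idP/idP => /set_mem; last by move=> ?; apply/mem_set; right.
by move=> [e|?]; [rewrite e eqxx in ii0|exact/mem_set].
Qed.

Let above k : set 'I_n := [set i | (k <= i)%N].

(** Independence of [psum k] from the next variable alone would not survive the induction; it is
    stated against all remaining variables at once. *)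
Let psum_law_aux k : (k <= n)%N -> forall C B, measurable C -> (forall i, measurable (B i)) ->
  P (psum k @^-1` C `&` cyl (above k) B) = P (psum k @^-1` C) * P (cyl (above k) B).
Proof.
elim: k => [_|k IH kn] C B mC mB.
  have [C0|C0] := pselect (C 0%R).
    have -> : psum 0 @^-1` C = setT by apply/seteqP; split => // w _ /=; rewrite psum0.
    by rewrite setTI probability_setT mul1e.
  have -> : psum 0 @^-1` C = set0 by apply/seteqP; split => // w /=; rewrite psum0.
  by rewrite set0I measure0 mul0e.
pose i0 := Ordinal kn.
pose M := [set z : R * R | C (z.1 + a i0 * z.2)%R].
have mM : measurable M.
  have mf : measurable_fun [set: R * R] (fun z : R * R => z.1 + a i0 * z.2)%R.
    by apply: measurable_funD => //; exact: measurable_funM.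
  by have := mf measurableT C mC; rewrite setTI.
have psumE : psum k.+1 @^-1` C = [set w | M (psumRV k w, X i0 w)].
  by apply/seteqP; split => w /=; rewrite -[k.+1]/(i0.+1) psumS.
(* The condition on [X i0] is absorbed into the cylinder over the indices from [k] on, to which the
   induction hypothesis applies. *)
have rect (B' : 'I_n -> set R) (A A' : set R) : (forall i, measurable (B' i)) ->
    measurable A -> measurable A' ->
    P (psumRV k @^-1` A `&` X i0 @^-1` A' `&` cyl (above k.+1) B') =
    P (psumRV k @^-1` A) * P (X i0 @^-1` A') * P (cyl (above k.+1) B').
  move=> mB' mA mA'.
  rewrite -muleA -cyl_indep//; last by rewrite /above/= ltnn.
  rewrite -setIA.
  pose B2 i := if i == i0 then A' else B' i.
  have mB2 i : measurable (B2 i) by rewrite /B2; case: ifP.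
  have -> : X i0 @^-1` A' `&` cyl (above k.+1) B' = cyl (above k) B2.
    apply/seteqP; split => w.
      move=> [wA h] i; rewrite /above/= leq_eqVlt => ki.
      rewrite /B2; case: eqP => [->//|/eqP ii0]; apply: h.
      by move: ki => /orP[/eqP e|//]; exfalso; move/negP: ii0; apply; apply/eqP/val_inj.
    move=> h; split; first by have := h i0 (leqnn k); rewrite /B2 eqxx.
    move=> i iD; have := h i (ltnW iD); rewrite /B2.
    by case: eqP => // e; exfalso; move: iD; rewrite e /above/= ltnn.
  by rewrite -IH// ltnW.
have Pfin (E : set T) : measurable E -> {c : {nonneg R} | P E = c%:num%:E}.
  move=> mE; have f0 : (0 <= fine (P E))%R by rewrite fine_ge0.
  by exists (NngNum f0); rewrite /= fineK// fin_num_measure.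
have mE : measurable (cyl (above k.+1) B) by exact: mcyl.
have [c cE] := Pfin _ mE.
rewrite psumE (pair_law_scaled mE (c := c))//; last first.
  by move=> A A' mA mA'; rewrite -cE; exact: rect.
have := @pair_law_scaled (psumRV k) (X i0) setT measurableT (NngNum (@ler01 R)) _ M mM.
rewrite setIT mul1e => ->; first by rewrite muleC cE.
move=> A A' mA mA'; have := rect (fun=> setT) A A' (fun=> measurableT) mA mA'.
have -> : cyl (above k.+1) (fun=> setT) = setT by apply/seteqP; split.
by rewrite probability_setT.
Qed.

Lemma psumS_integral (i0 : 'I_n) (F : R -> \bar R) :
  measurable_fun [set: R] F -> (forall x, 0 <= F x) ->
  \int[P]_w F (psum i0.+1 w) = \int[P]_w \int[P]_w' F (psum i0 w + a i0 * X i0 w')%R.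
Proof.
move=> mF F0.
under eq_integral do rewrite psumS.
apply: (@pair_integral (psumRV i0) (X i0) (fun z => F (z.1 + a i0 * z.2)%R)) => //.
  move=> A A' mA mA'.
  pose B i := if i == i0 then A' else setT.
  have mB i : measurable (B i) by rewrite /B; case: ifP.
  have cylE : cyl (above i0) B = X i0 @^-1` A'.
    apply/seteqP; split => w.
      by move=> h; have := h i0 (leqnn _); rewrite /B eqxx.
    by move=> wA i _; rewrite /B; case: eqP => // ->.
  by have := psum_law_aux (ltnW (ltn_ord i0)) mA mB; rewrite cylE.
by apply: measurableT_comp => //; apply: measurable_funD => //; exact: measurable_funM.
Qed.

End Independence.

(** * Moments with an added independent Gaussian *)

Section GaussShift.
Context {R : realType}.
Local Notation N := (@normal_prob R 0 1).
Local Open Scope ereal_scope.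

Lemma measurable_gauss_shift_pair (p : R) :
  measurable_fun [set: R * R] (fun z : R * R => gauss_shift p z.1 z.2).
Proof.
pose f (t : (R * R) * R) : \bar R := (`|t.1.2 + Num.sqrt t.1.1 * t.2| `^ p)%:E.
have mf : measurable_fun [set: (R * R) * R] f.
  apply/measurable_EFinP; apply: (measurableT_comp (@measurable_absr_powR R p)).
  apply: measurable_funD; first exact: measurableT_comp.
  apply: measurable_funM => //; apply: measurableT_comp; first exact: measurable_sqrtr.
  exact: measurableT_comp.
have f0 t : 0 <= f t by rewrite lee_fin powR_ge0.
exact: (@measurable_fun_fubini_tonelli_F _ _ _ _ _ N f mf f0).
Qed.

Lemma measurable_gauss_shiftr (p v : R) : measurable_fun [set: R] (gauss_shift p v).
Proof.
exact: (measurableT_comp (measurable_gauss_shift_pair p) (measurable_pair1 v)).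
Qed.

Lemma gauss_shift_ge0 (p v s : R) : 0 <= gauss_shift p v s.
Proof. by apply: integral_ge0 => x _; rewrite lee_fin powR_ge0. Qed.

(** The truncation keeps the variance nonnegative for every real [r]; the law only charges
    [r >= 0]. *)
Lemma expo_mgf_max (z : R) : (z < 1)%R ->
  \int[expo]_r (expR (z * Num.max r 0%R))%:E = ((1 - z)^-1)%:E.
Proof.
move=> z1; rewrite -expo_mgf//.
have mM : measurable_fun [set: R] (fun r : R => expR (z * Num.max r 0%R)).
  apply: measurableT_comp => //; apply: measurable_funM => //; exact: measurable_maxr.
have mz : measurable_fun [set: R] (fun r : R => expR (z * r)).
  by apply: measurableT_comp => //; exact: measurable_funM.
rewrite !ge0_integral_expo; try exact/measurable_EFinP;
  try by move=> r; rewrite lee_fin expR_ge0.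
apply: eq_integral => r _; have [r0|r0] := leP 0%R r => //.
by rewrite lt0_exponential_pdf// !mule0.
Qed.

End GaussShift.

Section OneStepGauss.
Context {R : realType} d (T : measurableType d) (P : probability T R).
Local Notation N := (@normal_prob R 0 1).
Local Open Scope ereal_scope.
Variables (X : {RV P >-> R}) (p a k v s : R).
Hypotheses (symX : symmetric_RV X) (lcX : log_concave_tails X)
  (X2 : 'E_P[fun w => (X w ^+ 2)%R] = 1) (p3 : (3 <= p)%R) (k1 : (1 < k)%R) (v0 : (0 <= v)%R).

(** Fix the Gaussian [x] and replace [X] at the point [s + sqrt v * x]; for each fixed [r] the old
    and new Gaussians then merge by stability. *)
Lemma conv_gauss_shift_le :
  \int[P]_w gauss_shift p v (s + a * X w) <=
  \int[expo]_r gauss_shift p (v + (a * k) ^+ 2 * Num.max r 0%R) s.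
Proof.
pose h (z : T * R) : \bar R := (`|s + a * X z.1 + Num.sqrt v * z.2| `^ p)%:E.
have mh : measurable_fun [set: T * R] h.
  apply/measurable_EFinP; apply: (measurableT_comp (@measurable_absr_powR R p)).
  apply: measurable_funD; last exact: measurable_funM.
  by apply: measurable_funD => //; apply: measurable_funM => //; exact: measurableT_comp.
have h0 z : 0 <= h z by rewrite lee_fin powR_ge0.
rewrite [X in X <= _](_ : _ = \int[N]_x \int[P]_w h (w, x)); last first.
  exact: (@fubini_tonelli _ _ _ _ _ P N h mh h0).
pose f (t : (R * R) * R) : \bar R :=
  (`|s + Num.sqrt v * t.1.1 + a * k * Num.sqrt t.1.2 * t.2| `^ p)%:E.
have mf : measurable_fun [set: (R * R) * R] f.
  apply/measurable_EFinP; apply: (measurableT_comp (@measurable_absr_powR R p)).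
  apply: measurable_funD.
    apply: measurable_funD => //; apply: measurable_funM => //; exact: measurableT_comp.
  apply: measurable_funM => //; apply: measurable_funM => //.
  by apply: measurableT_comp; [exact: measurable_sqrtr|exact: measurableT_comp].
have f0 t : 0 <= f t by rewrite lee_fin powR_ge0.
pose g (z : R * R) : \bar R := \int[N]_y f (z, y).
have mg : measurable_fun [set: R * R] g.
  exact: (@measurable_fun_fubini_tonelli_F _ _ _ _ _ N f mf f0).
have g0 z : 0 <= g z by exact: integral_ge0.
apply: (@le_trans _ _ (\int[N]_x \int[expo]_r g (x, r))).
  apply: ge0_le_integral => //.
  - by move=> x _; exact: integral_ge0.
  - exact: (@measurable_fun_fubini_tonelli_G _ _ _ _ _ P h mh h0).
  - exact: (@measurable_fun_fubini_tonelli_F _ _ _ _ _ expo g mg g0).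
  move=> x _.
  have := conv_abs_powR_le symX X2 (s + Num.sqrt v * x) a p3 lcX k1.
  by under eq_integral do rewrite addrAC.
rewrite (@fubini_tonelli _ _ _ _ _ N expo g mg g0).
rewrite le_eqVlt; apply/orP; left; apply/eqP; apply: eq_integral => r _.
pose F (x : R) : \bar R := (`|s + x| `^ p)%:E.
have mF : measurable_fun [set: R] F.
  by apply/measurable_EFinP; apply: (measurableT_comp (@measurable_absr_powR R p)); exact: measurable_funD.
have F0 x : 0 <= F x by rewrite lee_fin powR_ge0.
have := @normal_stable R (a * k * Num.sqrt r) (Num.sqrt v) F mF F0.
have -> : ((a * k * Num.sqrt r) ^+ 2 + Num.sqrt v ^+ 2 = v + (a * k) ^+ 2 * Num.max r 0)%R.
  rewrite sqr_sqrtr// addrC exprMn; congr (_ + _ * _)%R.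
  have [r0|r0] := leP 0%R r; first by rewrite sqr_sqrtr.
  by rewrite ltr0_sqrtr// expr0n.
rewrite /F -/(gauss_shift p _ s) => <-.
apply: eq_integral => x _; apply: eq_integral => y _.
by rewrite /f/= addrAC -addrA.
Qed.

End OneStepGauss.

(** * Moment bounds *)

Section Moments.
Context {R : realType} d (T : measurableType d) (P : probability T R).
Local Notation N := (@normal_prob R 0 1).
Local Open Scope ereal_scope.
Variables (n : nat) (X : 'I_n -> {RV P >-> R}) (a : 'I_n -> R) (p : R).
Hypotheses (indX : independent_RVs X) (symX : forall i, symmetric_RV (X i))
  (lcX : forall i, log_concave_tails (X i))
  (X2 : forall i, 'E_P[fun w => (X i w ^+ 2)%R] = 1) (p3 : (3 <= p)%R).
Variable A : R.
Hypotheses (A0 : (0 < A)%R) (aA : forall i, (`|a i| <= A)%R).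

Let S k := psum X a k.
Let m : R := fine (gauss_moment p).

Let mE : m%:E = gauss_moment p.
Proof. by rewrite fineK// gauss_moment_fin_num//; have := p3; lra. Qed.

Let m0 : (0 <= m)%R. Proof. by rewrite fine_ge0// gauss_moment_ge0. Qed.

Section Upper.
(** [y] bounds all the rates at which the exponential variables are tilted; below 1 it keeps their
    exponential moments finite. *)
Variables (k lam y : R).
Hypotheses (k1 : (1 < k)%R) (lam0 : (0 < lam)%R) (y1 : (y < 1)%R)
  (zy : forall i, (lam * (a i * k) ^+ 2 <= y)%R).

Let q := (p / 2)%R.
Let c := (m * ((q / expR 1) `^ q / lam `^ q))%R.

Let c0 : (0 <= c)%R.
Proof. by rewrite /c mulr_ge0// divr_ge0// powR_ge0. Qed.

Let sqrt_powR (v : R) : (0 <= v)%R -> (Num.sqrt v `^ p <= (q / expR 1) `^ q / lam `^ q * expR (lam * v))%R.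
Proof.
move=> v0; have q0 : (0 < q)%R by rewrite /q; have := p3; lra.
have lv : (0 <= lam * v)%R by rewrite mulr_ge0// ltW.
have := powR_le_expR q0 lv; rewrite powRM ?(ltW lam0)// => h.
rewrite -powR12_sqrt// -powRrM (_ : 2^-1 * p = q)%R; last by rewrite /q mulrC.
rewrite mulrAC ler_pdivlMr ?powR_gt0// mulrC; exact: h.
Qed.

(** Variables are replaced from the last to the first. The variance [v] gathered so far is arbitrary
    because each replacement adds a random amount to it, and the bound [exp (lam v)] turns this
    amount into an independent factor. *)
Lemma psum_gauss_shift_le j (v : R) : (j <= n)%N -> (0 <= v)%R ->
  \int[P]_w gauss_shift p v (S j w) <=
  (c * expR (lam * v + lam * k ^+ 2 / (1 - y) * \sum_(i < n | (i < j)%N) a i ^+ 2))%:E.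
Proof.
elim: j v => [|j IH] v jn v0.
  rewrite big_pred0// mulr0 addr0.
  under eq_integral do rewrite /S psum0.
  rewrite (integral_cst P measurableT (gauss_shift p v 0%R)).
  rewrite [X in _ * X](@probability_setT _ _ _ P) mule1 gauss_shift_scale//.
  by rewrite -mE -EFinM lee_fin /c mulrC -mulrA ler_wpM2l// sqrt_powR.
pose i0 := Ordinal jn.
set W := (lam * k ^+ 2 / (1 - y) * _)%R.
pose W' := (lam * k ^+ 2 / (1 - y) * \sum_(i < n | (i < j)%N) a i ^+ 2)%R.
pose z := (lam * (a i0 * k) ^+ 2)%R.
have z0 : (0 <= z)%R by rewrite mulr_ge0 ?sqr_ge0// ltW.
have zy' : (z <= y)%R by exact: zy.
have y1' : (0 < 1 - y)%R by have := y1; lra.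
have WE : (W = W' + z / (1 - y))%R.
  rewrite /W -[j.+1]/(i0.+1) big_ord_ltS mulrDr; congr (_ + _)%R.
  by rewrite /z exprMn; field; rewrite lt0r_neq0.
have mr r : (0 <= Num.max r 0 :> R)%R by rewrite le_max lexx orbT.
pose G (t : T * R) := gauss_shift p (v + (a i0 * k) ^+ 2 * Num.max t.2 0%R) (S j t.1).
have mG : measurable_fun [set: T * R] G.
  have mG' : measurable_fun [set: T * R]
      (fun t => (v + (a i0 * k) ^+ 2 * Num.max t.2 0, S j t.1)%R).
    apply: measurable_fun_pair.
      apply: measurable_funD => //; apply: measurable_funM => //.
      exact: measurable_maxr.
    by apply: measurableT_comp => //; exact: measurable_psum.
  exact: (measurableT_comp (measurable_gauss_shift_pair p) mG').
have G0 t : 0 <= G t by exact: gauss_shift_ge0.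
rewrite -[j.+1]/(i0.+1).
rewrite (psumS_integral a indX i0 (measurable_gauss_shiftr p v) (@gauss_shift_ge0 R p v)).
apply: (@le_trans _ _ (\int[P]_w \int[expo]_r G (w, r))).
  apply: ge0_le_integral => //.
  - by move=> w _; apply: integral_ge0 => w' _; exact: gauss_shift_ge0.
  - pose H (t : T * T) := gauss_shift p v (S j t.1 + a i0 * X i0 t.2).
    apply: (@measurable_fun_fubini_tonelli_F _ _ _ _ _ P H); last first.
      by move=> t; exact: gauss_shift_ge0.
    apply: (measurableT_comp (measurable_gauss_shiftr p v)).
    apply: measurable_funD; first by apply: measurableT_comp => //; exact: measurable_psum.
    by apply: measurable_funM => //; exact: measurableT_comp.
  - exact: (@measurable_fun_fubini_tonelli_F _ _ _ _ _ expo G mG G0).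
  - by move=> w _; exact: conv_gauss_shift_le.
rewrite (@fubini_tonelli _ _ _ _ _ P expo G mG G0).
apply: (@le_trans _ _ (\int[expo]_r ((c * expR (lam * v + W'))%:E * (expR (z * Num.max r 0%R))%:E))).
  apply: ge0_le_integral => //.
  - by move=> r _; exact: integral_ge0.
  - exact: (@measurable_fun_fubini_tonelli_G _ _ _ _ _ P G mG G0).
  - apply: measurable_funeM; apply/measurable_EFinP; apply: measurableT_comp => //.
    by apply: measurable_funM => //; exact: measurable_maxr.
  - move=> r _.
    have vr0 : (0 <= v + (a i0 * k) ^+ 2 * Num.max r 0)%R.
      by rewrite addr_ge0// mulr_ge0 ?sqr_ge0.
    have := IH _ (ltnW jn) vr0; rewrite /G/= -/W' => /le_trans; apply.
    rewrite -EFinM lee_fin -(mulrA c) ler_wpM2l// -expRD ler_expR /z; lra.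
have mexp : measurable_fun [set: R] (fun r : R => (expR (z * Num.max r 0%R))%:E).
  apply/measurable_EFinP; apply: measurableT_comp => //.
  by apply: measurable_funM => //; exact: measurable_maxr.
rewrite ge0_integralZl//=; last first.
  by rewrite lee_fin mulr_ge0// expR_ge0.
rewrite expo_mgf_max; last by have := y1; lra.
rewrite -EFinM lee_fin WE addrA (expRD (lam * v + W')) mulrA ler_wpM2l//.
  by rewrite mulr_ge0// expR_ge0.
(* [1 / (1 - z) = 1 + z / (1 - z)], and [z <= y] bounds this by [1 + z / (1 - y)]. *)
apply: le_trans (expR_ge1Dx _).
have z1' : (0 < 1 - z)%R by have := y1; lra.
rewrite (_ : (1 - z)^-1 = 1 + z / (1 - z))%R; last by field; rewrite lt0r_neq0.
by rewrite lerD2l ler_wpM2l// lef_pV2 ?posrE//; lra.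
Qed.

End Upper.

Let B := (\sum_(i < n) a i ^+ 2)%R.

Lemma gauss_shift0 (s : R) : gauss_shift p 0 s = (`|s| `^ p)%:E.
Proof.
rewrite /gauss_shift sqrtr0; under eq_integral do rewrite mul0r addr0.
exact: integral_normal_cst.
Qed.

Lemma psum_moment_le (k : R) : (1 < k)%R -> (0 < B)%R ->
  \int[P]_w (`|S n w| `^ p)%:E <=
  (m * (k ^+ 2 * (B + p / 2 * A ^+ 2)) `^ (p / 2))%:E.
Proof.
move=> k1 B0; set q := (p / 2)%R.
have q0 : (0 < q)%R by rewrite /q; have := p3; lra.
have k0 : (0 < k)%R by lra.
have A20 : (0 < A ^+ 2)%R by rewrite exprn_gt0.
have D0 : (0 < B + q * A ^+ 2)%R by rewrite addr_gt0// mulr_gt0.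
(* With this [lam] and [y] one has [1 - y = B / (B + q * A ^ 2)], so the exponent is exactly [q];
   [exp q] cancels the power of [e] in the constant and [(q / lam) ^ q] remains. *)
pose lam := (q / (k ^+ 2 * (B + q * A ^+ 2)))%R.
pose y := (q * A ^+ 2 / (B + q * A ^+ 2))%R.
have lam0 : (0 < lam)%R by rewrite /lam divr_gt0// mulr_gt0// exprn_gt0.
have y1 : (y < 1)%R by rewrite /y ltr_pdivrMr// mul1r ltrDr.
have zy i : (lam * (a i * k) ^+ 2 <= y)%R.
  rewrite (_ : lam * _ = q * a i ^+ 2 / (B + q * A ^+ 2))%R; last first.
    by rewrite /lam; field; rewrite !lt0r_neq0.
  rewrite /y ler_pM2r ?invr_gt0// ler_pM2l// -(real_normK (num_real (a i))).
  by rewrite ler_sqr ?nnegrE ?(ltW A0).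
have := psum_gauss_shift_le k1 lam0 y1 zy (leqnn n) (lexx 0%R).
under eq_integral do rewrite gauss_shift0.
move=> /le_trans; apply; rewrite lee_fin mulr0 add0r -mulrA ler_wpM2l//.
have -> : (\sum_(i < n | (i < n)%N) a i ^+ 2 = B)%R.
  by apply: eq_bigl => i; rewrite ltn_ord.
have -> : (lam * k ^+ 2 / (1 - y) * B = q)%R.
  have Dn : (1 - y = B / (B + q * A ^+ 2))%R by rewrite /y; field; rewrite lt0r_neq0.
  by rewrite Dn /lam; field; rewrite !lt0r_neq0.
have lam_ : (k ^+ 2 * (B + q * A ^+ 2) = q / lam)%R.
  by rewrite /lam; field; rewrite !lt0r_neq0.
rewrite lam_; have q0' := ltW q0; have lam0' := ltW lam0.
have e1 : ((q / expR 1) `^ q * expR q = q `^ q)%R.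
  transitivity ((q / expR 1 * expR 1) `^ q)%R; last by rewrite divfK// gt_eqF// expR_gt0.
  have h : (0 <= q / expR 1)%R by rewrite divr_ge0// expR_ge0.
  by rewrite -[in expR q](mul1r q) expRM [RHS]powRM// expR_ge0.
have e2 : ((q / lam) `^ q * lam `^ q = q `^ q)%R.
  transitivity ((q / lam * lam) `^ q)%R; last by rewrite divfK// gt_eqF.
  by rewrite [RHS]powRM// divr_ge0.
by rewrite -/q mulrAC e1 -e2 mulfK// gt_eqF// powR_gt0.
Qed.

(** Stated for every shift [s], because exchanging the last variable for a sign moves the starting
    point to [s + a_j] or [s - a_j]. *)
Lemma psum_sign_avg_ge j : (j <= n)%N -> exists l : seq R,
  [/\ (\sum_(x <- l) x ^+ 2 = \sum_(i < n | (i < j)%N) a i ^+ 2)%R,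
    forall x, x \in l -> (`|x| <= A)%R &
    forall s : R, (sign_avg l (fun x => `|x| `^ p) s)%:E <= \int[P]_w (`|s + S j w| `^ p)%:E].
Proof.
elim: j => [_|j IH jn].
  exists [::]; split => //; first by rewrite big_nil big_pred0.
  move=> s; under eq_integral do rewrite /S psum0 addr0.
  by rewrite (integral_cst P measurableT (`|s| `^ p)%:E) [X in _ * X](@probability_setT _ _ _ P) mule1.
have [l [l2 lA lI]] := IH (ltnW jn); pose i0 := Ordinal jn.
exists (a i0 :: l); split.
- by rewrite big_cons l2 -[j.+1]/(i0.+1) big_ord_ltS addrC.
- by move=> x; rewrite inE => /predU1P[->|]; [exact: aA|exact: lA].
move=> s; rewrite -[j.+1]/(i0.+1).
have mS : measurable_fun [set: T] (S j) by exact: measurable_psum.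
have mF (s' : R) : measurable_fun [set: R] (fun x : R => (`|s' + x| `^ p)%:E).
  by apply/measurable_EFinP; apply: (measurableT_comp (@measurable_absr_powR R p)); exact: measurable_funD.
rewrite (psumS_integral a indX i0 (mF s)); last by move=> x; rewrite lee_fin powR_ge0.
have mSs (s' : R) : measurable_fun [set: T] (fun w => (`|s' + S j w| `^ p)%:E).
  by apply: (measurableT_comp (mF s')).
apply: (@le_trans _ _ (\int[P]_w ((2^-1)%:E * ((`|s + a i0 + S j w| `^ p)%:E + (`|s - a i0 + S j w| `^ p)%:E)))).
  rewrite ge0_integralZl//=; last 2 first.
  - by apply: emeasurable_funD; exact: mSs.
  - by move=> w _; rewrite adde_ge0// lee_fin powR_ge0.
  rewrite ge0_integralD//=; try exact: mSs; try by move=> w _; rewrite lee_fin powR_ge0.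
  have h : (0 <= (2^-1 : R)%:E) by rewrite lee_fin invr_ge0.
  apply: le_trans (lee_wpmul2l h (leeD (lI (s + a i0)%R) (lI (s - a i0)%R))).
  by rewrite -EFinD -EFinM lee_fin; lra.
apply: ge0_le_integral => //.
- by move=> w _; rewrite mule_ge0 ?lee_fin ?invr_ge0// adde_ge0// lee_fin powR_ge0.
- by apply: measurable_funeM; apply: emeasurable_funD; exact: mSs.
- pose H (t : T * T) : \bar R := (`|s + (S j t.1 + a i0 * X i0 t.2)| `^ p)%:E.
  apply: (@measurable_fun_fubini_tonelli_F _ _ _ _ _ P H); last first.
    by move=> t; rewrite lee_fin powR_ge0.
  apply: (measurableT_comp (mF s)).
  apply: measurable_funD; first exact: measurableT_comp.
  by apply: measurable_funM => //; exact: measurableT_comp.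
- move=> w _; have := conv_abs_powR_ge (symX i0) (X2 i0) (s + S j w) (a i0) p3.
  under eq_integral do rewrite -addrA.
  apply: le_trans; rewrite -EFinD -EFinM lee_fin /sympow.
  by rewrite (addrAC s) (addrAC s (- _)%R) mulrC.
Qed.

Lemma psum_moment_ge : (Num.sqrt p * A <= Num.sqrt B)%R ->
  (m * (Num.sqrt B - Num.sqrt p * A) `^ p)%:E <= \int[P]_w (`|S n w| `^ p)%:E.
Proof.
have [l [l2 lA lI]] := psum_sign_avg_ge (leqnn n).
have BE : (\sum_(i < n | (i < n)%N) a i ^+ 2 = B)%R.
  by apply: eq_bigl => i; rewrite ltn_ord.
rewrite BE in l2; rewrite -l2 => AB.
have := lI 0%R; under eq_integral do rewrite add0r.
apply: le_trans; rewrite lee_fin; exact: sign_avg_powR_ge.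
Qed.

End Moments.

(** * From moments to norms: assembling both bounds *)

Lemma ler_mul_gt1 (R : realType) (x y : R) : 0 <= y ->
  (forall k, 1 < k -> x <= k * y) -> x <= y.
Proof.
move=> y0 h; apply/ler_addgt0Pr => e e0.
have y1 : 0 < y + 1 by lra.
have k1 : 1 < 1 + e / (y + 1) by rewrite ltrDl divr_gt0.
apply: le_trans (h _ k1) _; rewrite mulrDl mul1r lerD2l.
by rewrite mulrAC ler_pdivrMr//; nra.
Qed.

Lemma linfnorm_ge (R : realType) n (a : 'I_n -> R) i : `|a i| <= linfnorm a.
Proof.
apply: ub_le_sup; last by exists i.
exists (\sum_(j < n) `|a j|) => _ [j _ <-].
by rewrite (bigD1 j)//= lerDl sumr_ge0.
Qed.

Lemma linfnorm_ge0 (R : realType) n (a : 'I_n -> R) : 0 <= linfnorm a.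
Proof.
case: n a => [|n] a; last by apply: le_trans (linfnorm_ge a ord0).
rewrite /linfnorm [X in sup X](_ : _ = set0) ?sup0//.
by apply/seteqP; split => // x [i _ _]; case: i.
Qed.

Local Open Scope ereal_scope.

Lemma LnormE (R : realType) d (T : measurableType d)
    (mu : {measure set T -> \bar R}) (f : T -> R) (p : R) :
  'N[mu]_(p%:E)[(fun w => (f w)%:E)] = (\int[mu]_w (`|f w| `^ p)%:E) `^ p^-1.
Proof.
by rewrite unlock; congr (_ `^ _); exact: eq_integral.
Qed.

Theorem corollary3 (R : realType) (d : measure_display) (T : measurableType d)
    (P : probability T R) (n : nat) (X : 'I_n -> {RV P >-> R}) (a : 'I_n -> R)
    (p : R) :
  independent_RVs X ->
  (forall i, symmetric_RV (X i)) ->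
  (forall i, log_concave_tails (X i)) ->
  (forall i, 'E_P[fun w => (X i w ^+ 2)%R] = 1) ->
  (3 <= p)%R ->
  `| 'N[P]_(p%:E)[(fun w => (\sum_(i < n) a i * X i w)%R%:E)]
     - gaussian_Lnorm p * (l2norm a)%:E |
  <= (p * linfnorm a)%:E.
Proof.
move=> indX symX lcX X2 p3.
have p0 : (0 <= p)%R by lra.
have pn0 : p != 0%R by rewrite gt_eqF//; lra.
have ip0 : (0 <= p^-1)%R by rewrite invr_ge0.
set m := fine (gauss_moment p).
have mE : gauss_moment p = m%:E by rewrite fineK// gauss_moment_fin_num.
have m0 : (0 <= m)%R by rewrite fine_ge0// gauss_moment_ge0.
pose gam := (m `^ p^-1)%R.
have gam0 : (0 <= gam)%R by exact: powR_ge0.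
have -> : gaussian_Lnorm p = gam%:E.
  by rewrite /gaussian_Lnorm LnormE -/(gauss_moment p) mE poweR_EFin.
have root (x : R) : (0 <= x)%R -> ((x `^ p) `^ p^-1 = x)%R.
  by move=> x0; rewrite -powRrM mulfV// powRr1.
have gamp : (gam <= Num.sqrt p)%R.
  have := gauss_moment_le p3; rewrite mE lee_fin => h.
  rewrite -[leRHS]root ?sqrtr_ge0//; apply: ge0_ler_powR; rewrite ?nnegrE ?powR_ge0//.
  by rewrite -powR12_sqrt// -powRrM mulrC.
set A := linfnorm a; have A0 : (0 <= A)%R by exact: linfnorm_ge0.
have aA i : (`|a i| <= A)%R by exact: linfnorm_ge.
rewrite LnormE /l2norm.
set B := (\sum_(i < n) a i ^+ 2)%R.
have B0 : (0 <= B)%R by apply: sumr_ge0 => i _; exact: sqr_ge0.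
(* The zero sequence is set apart: the moment bounds assume [A > 0]. *)
have [BE|Bn0] := eqVneq B 0%R.
  have ai0 i : a i = 0%R.
    apply/eqP; rewrite -sqrf_eq0; apply/eqP/le_anti; rewrite sqr_ge0 andbT -BE /B.
    by rewrite (bigD1 i)//= lerDl sumr_ge0// => j _; exact: sqr_ge0.
  rewrite BE sqrtr0 mule0 sube0.
  under eq_integral => w _.
    rewrite big1; last by move=> i _; rewrite ai0 mul0r.
    rewrite normr0 powR0//.
    over.
  by rewrite integral0 poweR0r ?invr_neq0// abse0 lee_fin mulr_ge0.
have Bp : (0 < B)%R by rewrite lt_neqAle eq_sym Bn0.
have Ap : (0 < A)%R.
  rewrite lt_neqAle A0 andbT eq_sym; apply: contra Bn0 => /eqP AE; apply/eqP.
  apply: big1 => i _; have := aA i; rewrite AE normr_le0 => /eqP ->.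
  by rewrite expr0n.
pose S := psum X a n.
have SE w : (\sum_(i < n) a i * X i w = S w)%R.
  by apply: eq_bigl => i; rewrite ltn_ord.
under eq_integral do rewrite SE.
set I := \int[P]_w _.
have I0 : 0 <= I by apply: integral_ge0 => w _; rewrite lee_fin powR_ge0.
have upper k : (1 < k)%R -> I <= (m * (k ^+ 2 * (B + p / 2 * A ^+ 2)) `^ (p / 2))%:E.
  by move=> k1; exact: psum_moment_le.
have lower : (Num.sqrt p * A <= Num.sqrt B)%R ->
    (m * (Num.sqrt B - Num.sqrt p * A) `^ p)%:E <= I.
  exact: psum_moment_ge.
(* Finiteness of the moment, from the upper bound at [k = 2]. *)
have Ifin : I \is a fin_num.
  by rewrite ge0_fin_numE//; apply: le_lt_trans (upper 2%R _) (ltry _); lra.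
have IE : I = (fine I)%:E by rewrite fineK.
set i := fine I in IE; have i0 : (0 <= i)%R by rewrite fine_ge0.
rewrite IE poweR_EFin -EFinM -EFinB abse_EFin lee_fin.
set Np := (i `^ p^-1)%R.
have Np0 : (0 <= Np)%R by exact: powR_ge0.
have sqp : (Num.sqrt p * Num.sqrt p = p)%R by rewrite -expr2 sqr_sqrtr.
set D := (B + p / 2 * A ^+ 2)%R in upper.
have D0 : (0 <= D)%R by rewrite addr_ge0// mulr_ge0 ?sqr_ge0// divr_ge0.
have up1 : (Np <= gam * Num.sqrt D)%R.
  apply: ler_mul_gt1; first by rewrite mulr_ge0 ?sqrtr_ge0.
  move=> k k1; have k0 : (0 <= k)%R by lra.
  have := upper k k1; rewrite IE lee_fin => h.
  have -> : (k * (gam * Num.sqrt D) = (m * (k ^+ 2 * D) `^ (p / 2)) `^ p^-1)%R.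
    rewrite powRM ?powR_ge0// -powRrM (_ : p / 2 * p^-1 = 2^-1)%R; last by field.
    rewrite powR12_sqrt ?mulr_ge0 ?sqr_ge0// sqrtrM ?sqr_ge0// sqrtr_sqr ger0_norm//.
    by rewrite mulrCA.
  by apply: ge0_ler_powR; rewrite ?nnegrE ?mulr_ge0 ?powR_ge0.
(* Square both sides: the right side contains [p * A ^ 2], twice what is needed, besides a
   nonnegative cross term. *)
have up2 : (Num.sqrt D <= Num.sqrt B + Num.sqrt p * A)%R.
  have h0 : (0 <= Num.sqrt B + Num.sqrt p * A)%R by rewrite addr_ge0 ?mulr_ge0 ?sqrtr_ge0.
  rewrite -[leRHS](ger0_norm h0) -sqrtr_sqr ler_wsqrtr//.
  rewrite sqrrD sqr_sqrtr// exprMn sqr_sqrtr// /D -addrA lerD2l.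
  have : (0 <= Num.sqrt B * (Num.sqrt p * A) *+ 2)%R by rewrite mulrn_wge0// !mulr_ge0 ?sqrtr_ge0.
  have := mulr_ge0 p0 (sqr_ge0 A); lra.
have gA : (gam * (Num.sqrt p * A) <= p * A)%R.
  by rewrite -{2}sqp -mulrA ler_wpM2r// mulr_ge0 ?sqrtr_ge0.
rewrite ler_norml; apply/andP; split; last first.
  have := ler_wpM2l gam0 up2; lra.
(* If [sqrt B < sqrt p * A], then [gam * sqrt B <= p * A] and the norm is nonnegative. *)
have [AB|AB] := leP (Num.sqrt p * A)%R (Num.sqrt B); last first.
  have := ler_wpM2l gam0 (ltW AB); lra.
have := lower AB; rewrite IE lee_fin => h.
have D1 : (0 <= Num.sqrt B - Num.sqrt p * A)%R by rewrite subr_ge0.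
have : (gam * (Num.sqrt B - Num.sqrt p * A) <= Np)%R.
  rewrite -[X in (gam * X)%R]root// -powRM ?powR_ge0//.
  by apply: ge0_ler_powR; rewrite ?nnegrE ?mulr_ge0 ?powR_ge0.
lra.
Qed.
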